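(* Fix $0<p<1$, $\gamma\in(0,1)\cap\mathbb Q$, and a finite $d$-regular graph $H$ with $d\ge1$. Let $W_0=f^\gamma_p$. Let $r\in[p,1]$ and define $t^\gamma_r=t(H,f^\gamma_r)$. 1. If $(r^d,h_p(r))$ lies on the convex minorant of $x\mapsto h_p(x^{1/d})$, then $t^\gamma_r$ is in the symmetric regime for $W_0$ and $t(H,\cdot)$. Moreover, $\tilde f^\gamma_r$ is the unique symmetric solution. 2. If $(r^d,h_p(r))$ does not lie on the convex minorant of $x\mapsto h_p(x^{1/d})$, then $t^\gamma_r$ is not in the symmetric regime for $W_0$ and $t(H,\cdot)$.
   Context: A graphon is a measurable symmetric function $f:[0,1]^2\to[0,1]$; $\mathcal W$ is the set of graphons. $d_\square(f,g)=\sup_{S,T\subseteq[0,1]}\left|\int_{S\times T}(f-g)\right|$ over measurable $S,T$; $\delta_\square(f,g)=\inf_{\phi}d_\square(f,g^\phi)$ over bijective Lebesgue-measure-preserving $\phi:[0,1]\to[0,1]$, where $g^\phi(x,y)=g(\phi(x),\phi(y))$. $\tilde f$ is the class of $f$ under $f\sim g\iff\delta_\square(f,g)=0$, and $\tilde{\mathcal W}=\mathcal W/\!\sim$ with metric $\delta_\square$ (a compact metric space). For a finite simple graph $H$ on $v$ vertices, $t(H,f)=\int_{[0,1]^v}\prod_{(i,j)\in E(H)}f(x_i,x_j)\,dx_1\cdots dx_v$; it is well defined and continuous on $\tilde{\mathcal W}$. $f^\gamma_r$ is the graphon equal to $0$ on $[0,\gamma]^2\cup(\gamma,1]^2$ and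 $r$ elsewhere. $\mathcal B^{(\gamma,1-\gamma)}$ is the set of graphons constant on each of $[0,\gamma]^2$, $(\gamma,1]^2$, and $([0,\gamma]\times(\gamma,1])\cup((\gamma,1]\times[0,\gamma])$; $\tilde{\mathcal B}^{(\gamma,1-\gamma)}$ is the set of $\tilde f\in\tilde{\mathcal W}$ with $\delta_\square(\tilde f,g)=0$ for some $g\in\mathcal B^{(\gamma,1-\gamma)}$. $h_p(u)=u\log\frac up+(1-u)\log\frac{1-u}{1-p}$ (with $0\log0=0$, $0\log(0/0)=0$, value $+\infty$ if $p\in\{0,1\}$, $u\ne p$). The convex minorant of a function on $[0,1]$ is the largest convex function below it. $I_{W_0}(f)=\frac12\int_{[0,1]^2}h_{W_0(x,y)}(f(x,y))\,dx\,dy$; $\Omega=\{W_0\in(0,1)\}$; $\mathcal W_\Omega$ is the set of graphons equal to $W_0$ a.e. on $\Omega^c$; $\tilde{\mathcal W}_\Omega$ is the set of classes $\tilde f$ with $\delta_\square(\tilde f,g)=0$ for some $g\in\mathcal W_\Omega$. $J_{W_0}(\tilde f)=\sup_{\eta>0}\inf\{I_{W_0}(h):h\in\mathcal W,\delta_\square(\tilde f,h)\le\eta\}$ if $\tilde f\in\tilde{\mathcal W}_\Omega$ and $\infty$ otherwise. For a continuous graph parameter $\tau$ (a $\delta_\square$-continuous function $\tilde{\mathcal W}\to\mathbb R$), a value $t\le\max_{\tilde{\mathcal W}_\Omega}\tau$ is in the symmetric regime for $W_0$ and $\tau$ if all minimizers $\tilde g$ of $\min\{J_{W_0}(\tilde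 f):\tilde f\in\tilde{\mathcal W},\tau(\tilde f)\ge t\}$ satisfy $\tilde g\in\tilde{\mathcal B}^{(\gamma,1-\gamma)}$. The symmetric solution is unique if a unique element of $\tilde{\mathcal W}_\Omega$ attains this minimum.
   Formalization: For r > p the graph H is additionally assumed bipartite; for non-bipartite H one has t(H,f_r)=0, the only minimizer is the class of f_p, and the printed claim fails (e.g. H = K_3, r = 1). H is also taken to be nonempty. *)

(* Defs.v *)
From HB Require Import structures.
From mathcomp Require Export all_boot all_order all_algebra.
From mathcomp Require Export all_classical all_reals all_analysis.

Set Implicit Arguments.
Unset Strict Implicit.
Unset Printing Implicit Defensive.
Import Order.TTheory GRing.Theory Num.Theory.
Import numFieldNormedType.Exports.

Local Open Scope classical_set_scope.
Local Open Scope ring_scope.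

Section graphons.
Context {R : realType}.

Local Notation mu := (@lebesgue_measure R).
Local Notation mu2 := (mu \x mu)%E.

Definition unit_itv : set R := `[0, 1].
Definition unit_sq : set (R * R) := unit_itv `*` unit_itv.

(* A graphon is represented by a function on R * R of which only the values on
   [0,1]^2 matter.  Measurability is with respect to the Borel sigma-algebra:
   every Lebesgue measurable graphon agrees a.e. with a Borel one, and all the
   notions below are insensitive to null sets up to [weakly_equal]. *)
Definition graphon : set (R * R -> R) :=
  [set f : R * R -> R | [/\ measurable_fun unit_sq f,
      {in unit_sq, forall z, f z = f (z.2, z.1)} &
      {in unit_sq, forall z, 0 <= f z <= 1}]].

Definition cut_dist (f g : R * R -> R) : R :=
  sup [set x | exists S T : set R,
    [/\ measurable S /\ S `<=` unit_itv,
        measurable T /\ T `<=` unit_itv &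
        x = `| \int[mu2]_(z in S `*` T) (f z - g z) |]].

(* For a Borel bijection of [0,1] the measurability of the inverse (third
   clause) is automatic by the Lusin-Souslin theorem. *)
Definition measure_preserving_bij (phi : R -> R) : Prop :=
  [/\ set_bij unit_itv unit_itv phi,
      measurable_fun unit_itv phi,
      forall A, measurable A -> A `<=` unit_itv -> measurable (phi @` A) &
      forall A, measurable A -> A `<=` unit_itv ->
        mu (unit_itv `&` phi @^-1` A) = mu A].

Definition relabel (g : R * R -> R) (phi : R -> R) : R * R -> R :=
  fun z => g (phi z.1, phi z.2).

Definition delta_cut (f g : R * R -> R) : R :=
  inf [set cut_dist f (relabel g phi) | phi in measure_preserving_bij].

(* Equality of the classes of f and g in the quotient space of graphons.
   Elements of the quotient are handled through representatives throughout. *)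
Definition weakly_equal (f g : R * R -> R) : Prop := delta_cut f g = 0.

(* The graphons whose class is the class of some element of A. *)
Definition tilde (A : set (R * R -> R)) : set (R * R -> R) :=
  [set f | graphon f /\ exists2 g, A g & weakly_equal f g].

(* Iterated integral over [0,1]^n; by Fubini it is the integral against the
   n-fold product measure, which the library does not provide. *)
Fixpoint cube_integral (n : nat) : (n.-tuple R -> R) -> R :=
  match n with
  | 0 => fun F => F [tuple]
  | m.+1 => fun F =>
      \int[mu]_(x in unit_itv) cube_integral (fun s => F [tuple of x :: s])
  end.

Definition simple_graph (v : nat) (e : rel 'I_v) : Prop :=
  symmetric e /\ irreflexive e.

Definition regular_graph (v : nat) (e : rel 'I_v) (d : nat) : Prop :=
  forall i, #|[set j | e i j]%SET| = d.

Definition bipartite_graph (v : nat) (e : rel 'I_v) : Prop :=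
  exists c : 'I_v -> bool, forall i j, e i j -> c i != c j.

(* Each unordered edge is counted once, through its ordered pair. *)
Definition hom_density (v : nat) (e : rel 'I_v) (f : R * R -> R) : R :=
  cube_integral (fun x : v.-tuple R =>
    \prod_(ij : 'I_v * 'I_v | (ij.1 < ij.2)%N && e ij.1 ij.2)
      f (tnth x ij.1, tnth x ij.2)).

(* Equal to 0 on [0,gam]^2 and on (gam,1]^2, and to r elsewhere. *)
Definition bip_graphon (gam r : R) : R * R -> R :=
  fun z => if (z.1 <= gam) == (z.2 <= gam) then 0 else r.

Definition constant_on (f : R * R -> R) (A : set (R * R)) : Prop :=
  exists c, forall z, A z -> f z = c.

Definition block_graphon (gam : R) : set (R * R -> R) :=
  [set f : R * R -> R | [/\ graphon f,
      constant_on f (`[0, gam] `*` `[0, gam]),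
      constant_on f (`]gam, 1] `*` `]gam, 1]) &
      constant_on f ((`[0, gam] `*` `]gam, 1]) `|` (`]gam, 1] `*` `[0, gam]))]].

(* [ln 0 = 0] in the library, whence the convention 0 log 0 = 0. *)
Definition rel_entropy (p u : R) : \bar R :=
  if (p == 0) || (p == 1) then (if u == p then 0 else +oo)%E
  else (u * ln (u / p) + (1 - u) * ln ((1 - u) / (1 - p)))%:E.

Definition is_convex_minorant (f m : R -> R) : Prop :=
  let minorizes (g : R -> R) :=
    convex_function (unit_itv : set R) (g : R -> R) /\
    {in unit_itv, forall x, g x <= f x} in
  minorizes m /\ forall g, minorizes g -> {in unit_itv, forall x, g x <= m x}.

Definition on_convex_minorant (f : R -> R) (x y : R) : Prop :=
  exists2 m, is_convex_minorant f m & m x = y.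

Definition rate_I (W0 f : R * R -> R) : \bar R :=
  ((2^-1)%:E * \int[mu2]_(z in unit_sq) rel_entropy (W0 z) (f z))%E.

Definition Omega (W0 : R * R -> R) : set (R * R) :=
  unit_sq `&` [set z | 0 < W0 z < 1].

Definition graphon_Omega (W0 : R * R -> R) : set (R * R -> R) :=
  [set f | graphon f /\
    {ae mu2, forall z, (unit_sq `\` Omega W0) z -> f z = W0 z}].

Definition rate_J (W0 f : R * R -> R) : \bar R :=
  if f \in tilde (graphon_Omega W0) then
    ereal_sup [set ereal_inf [set rate_I W0 h | h in
                     [set h | graphon h /\ delta_cut f h <= eta]]
              | eta in [set eta : R | 0 < eta]]
  else +oo%E.

Definition is_minimizer (W0 : R * R -> R) (tau : (R * R -> R) -> R) (t : R)
    (g : R * R -> R) : Prop :=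
  [/\ graphon g, t <= tau g &
      forall f, graphon f -> t <= tau f -> (rate_J W0 g <= rate_J W0 f)%E].

(* t <= max of tau, the maximum being attained. *)
Definition admissible_value (W0 : R * R -> R) (tau : (R * R -> R) -> R)
    (t : R) : Prop :=
  exists f, [/\ tilde (graphon_Omega W0) f,
    forall g, tilde (graphon_Omega W0) g -> tau g <= tau f & t <= tau f].

Definition symmetric_regime (gam : R) (W0 : R * R -> R)
    (tau : (R * R -> R) -> R) (t : R) : Prop :=
  admissible_value W0 tau t /\
  forall g, is_minimizer W0 tau t g -> tilde (block_graphon gam) g.

Definition unique_solution (W0 : R * R -> R)
    (tau : (R * R -> R) -> R) (t : R) (f : R * R -> R) : Prop :=
  [/\ tilde (graphon_Omega W0) f, is_minimizer W0 tau t f &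
      forall g, tilde (graphon_Omega W0) g -> is_minimizer W0 tau t g ->
        weakly_equal g f].

End graphons.

(* Main.v *)
Require Import Defs.
From mathcomp Require Import measurable_realfun.
From mathcomp Require Import ring lra.

Set Implicit Arguments.
Unset Strict Implicit.
Unset Printing Implicit Defensive.
Import Order.TTheory GRing.Theory Num.Theory.
Import numFieldNormedType.Exports.
Local Open Scope classical_set_scope.
Local Open Scope ring_scope.

(** Let P = [0,gam] and Q = (gam,1].  A graphon h has finite rate only if it
    vanishes almost everywhere on P x P and Q x Q, and its rate is then the
    integral over P x Q of the Bernoulli relative entropy kl p (h(x,y)).

    Hoelder's inequality.  Splitting each variable of t(H,h) according to the
    part it lies in writes t(H,h) as a sum over the proper 2-colourings of H.
    As H is d-regular, each colouring has v/2 vertices of either colour.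
    Integrating the vertices of one colour first and applying Hoelder's
    inequality with d functions bounds each term by M^(v/2), where M is the
    integral of h^d over P x Q ([colour_weight_le]).  When h(x,y) depends only
    on x in P, all these inequalities are equalities ([tau_row]).  So
    t(H,h) >= t(H,f_r) forces the mean of h^d to be at least r^d, and what is
    left is a problem on the function x |-> kl p (x^(1/d)) alone, in which
    convexity decides.

    If (r^d, kl p r) lies on the convex minorant, a line of nonnegative slope
    supports the graph at r^d, hence the rate of f_r is minimal.  For
    uniqueness, r^d must not lie strictly between two further contact points of
    that line ([no_three_contacts], by Rolle); then nearly minimal rate together
    with nearly the right d-th moment forces h^d to be close to r^d in L1
    ([entropy_stability]).

    If it does not lie on the minorant, the minorant at r^d is given by a
    bitangent line touching at u1^d < r^d < u2^d ([bitangent]).  The graphon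
    whose value on P x Q is u1 for a proportion lam of the x in P and u2 for the
    others, with lam u1^d + (1 - lam) u2^d = r^d, has density t(H,f_r) by the
    equality case and attains the lower bound, so it is a minimizer.  It is not
    equivalent to a block graphon: triangle densities would force that block
    graphon to vanish on the diagonal blocks, t(H,.) its value to be r, and edge
    densities r = lam u1 + (1 - lam) u2, against the convexity of kl p.

    The function J is a lower semicontinuous envelope, so each bound above is
    proved with some slack on t(H,h); the counting lemma, which bounds
    |t(H,f) - t(H,g)| by a multiple of the cut distance, transfers it to J
    ([rate_J_ge]). *)

(** * Means of bounded measurable functions *)

Section bounded_measurable.
Context {R : realType}.

Definition bmeas d (T : measurableType d) (F : T -> R) : Prop :=
  measurable_fun setT F /\ exists M, forall x, `|F x| <= M.

Section closure.
Context d (T : measurableType d).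
Implicit Types F G : T -> R.

Lemma bmeas_meas F : bmeas F -> measurable_fun setT F. Proof. by case. Qed.

Lemma bmeas_itv F (a b : R) : measurable_fun setT F ->
  (forall x, a <= F x <= b) -> bmeas F.
Proof.
move=> mF Fab; split=> //; exists (`|a| + `|b|) => x.
have /andP[aF Fb] := Fab x; rewrite ler_norml; apply/andP; split.
  rewrite (le_trans _ aF)// lerNl (le_trans (ler_norm (- a)))// normrN.
  by rewrite lerDl.
by rewrite (le_trans Fb)// (le_trans (ler_norm b))// lerDr.
Qed.

Lemma bmeas_cst (c : R) : bmeas (fun _ : T => c).
Proof. by split=> //; exists `|c|. Qed.

Lemma bmeasD F G : bmeas F -> bmeas G -> bmeas (fun x => F x + G x).
Proof.
move=> [mF [M FM]] [mG [N GN]]; split; first exact: measurable_funD.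
by exists (M + N) => x; rewrite (le_trans (ler_normD _ _))// lerD.
Qed.

Lemma bmeasN F : bmeas F -> bmeas (fun x => - F x).
Proof.
move=> [mF [M FM]]; split; first exact: measurableT_comp.
by exists M => x; rewrite normrN.
Qed.

Lemma bmeasB F G : bmeas F -> bmeas G -> bmeas (fun x => F x - G x).
Proof. by move=> bF bG; apply: bmeasD => //; exact: bmeasN. Qed.

Lemma bmeasM F G : bmeas F -> bmeas G -> bmeas (fun x => F x * G x).
Proof.
move=> [mF [M FM]] [mG [N GN]]; split; first exact: measurable_funM.
by exists (M * N) => x; rewrite normrM ler_pM.
Qed.

Lemma bmeas_norm F : bmeas F -> bmeas (fun x => `|F x|).
Proof.
move=> [mF [M FM]]; split; first exact: measurableT_comp.
by exists M => x; rewrite normr_id.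
Qed.

Lemma bmeasX F n : bmeas F -> bmeas (fun x => F x ^+ n).
Proof.
move=> bF; elim: n => [|n IH]; first by apply: bmeas_cst.
rewrite [X in bmeas X](_ : _ = fun x => F x * F x ^+ n).
  exact: bmeasM.
by apply/funext => x; rewrite exprS.
Qed.

Lemma bmeas_prod (I : Type) (s : seq I) (P : pred I) (F : I -> T -> R) :
  (forall i, P i -> bmeas (F i)) ->
  bmeas (fun x => \prod_(i <- s | P i) F i x).
Proof.
move=> bF; elim: s => [|i s IH].
  rewrite [X in bmeas X](_ : _ = fun=> 1); first exact: bmeas_cst.
  by apply/funext => x; rewrite big_nil.
rewrite [X in bmeas X](_ : _ = fun x =>
  (if P i then F i x else 1) * \prod_(i <- s | P i) F i x).
  by apply: bmeasM => //; case Pi : (P i); [exact: bF|exact: bmeas_cst].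
by apply/funext => x; rewrite big_cons; case: ifP => //; rewrite mul1r.
Qed.

Lemma bmeas_sum (I : Type) (s : seq I) (P : pred I) (F : I -> T -> R) :
  (forall i, P i -> bmeas (F i)) ->
  bmeas (fun x => \sum_(i <- s | P i) F i x).
Proof.
move=> bF; elim: s => [|i s IH].
  rewrite [X in bmeas X](_ : _ = fun=> 0); first exact: bmeas_cst.
  by apply/funext => x; rewrite big_nil.
rewrite [X in bmeas X](_ : _ = fun x =>
  (if P i then F i x else 0) + \sum_(i <- s | P i) F i x).
  by apply: bmeasD => //; case Pi : (P i); [exact: bF|exact: bmeas_cst].
by apply/funext => x; rewrite big_cons; case: ifP => //; rewrite add0r.
Qed.

Lemma bmeas_indic (A : set T) : measurable A -> bmeas (\1_A : T -> R).
Proof.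
move=> mA; apply: (@bmeas_itv _ 0 1).
  exact: measurable_indic.
by move=> x; rewrite indicE; case: (x \in A); rewrite /= ?ler01 ?lexx.
Qed.

Lemma bmeas_integrable (P : probability T R) F :
  bmeas F -> P.-integrable setT (EFin \o F).
Proof.
move=> [mF [M FM]]; apply: measurable_bounded_integrable => //.
  by rewrite (le_lt_trans (probability_le1 _ _))// ltry.
exists M; split=> //; first exact: num_real.
by move=> x Mx y _ /=; rewrite (le_trans (FM y))// ltW.
Qed.

End closure.

Lemma bmeas_comp d1 d2 (T1 : measurableType d1) (T2 : measurableType d2)
    (F : T2 -> R) (phi : T1 -> T2) :
  bmeas F -> measurable_fun setT phi -> bmeas (fun x => F (phi x)).
Proof.
move=> [mF [M FM]] mphi; split; first exact: measurableT_comp.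
by exists M.
Qed.

Section expectation.
Context d (T : measurableType d) (P : probability T R).
Implicit Types F G : T -> R.

Local Notation mean F := (Rintegral P setT F).

Lemma mean_cst (c : R) : mean (fun=> c) = c.
Proof. by rewrite Rintegral_cst//= (@probability_setT _ _ _ P) mulr1. Qed.

Lemma meanD F G : bmeas F -> bmeas G ->
  mean (fun x => F x + G x) = mean F + mean G.
Proof. by move=> bF bG; rewrite RintegralD//; exact: bmeas_integrable. Qed.

Lemma meanB F G : bmeas F -> bmeas G ->
  mean (fun x => F x - G x) = mean F - mean G.
Proof. by move=> bF bG; rewrite RintegralB//; exact: bmeas_integrable. Qed.

Lemma meanZ (c : R) F : bmeas F -> mean (fun x => c * F x) = c * mean F.
Proof. by move=> bF; rewrite RintegralZl//; exact: bmeas_integrable. Qed.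

Lemma mean_sum (I : Type) (s : seq I) (Q : pred I) (F : I -> T -> R) :
  (forall i, Q i -> bmeas (F i)) ->
  mean (fun x => \sum_(i <- s | Q i) F i x) = \sum_(i <- s | Q i) mean (F i).
Proof.
move=> bF; elim: s => [|i s IH].
  by under eq_Rintegral do rewrite big_nil; rewrite mean_cst big_nil.
under eq_Rintegral do rewrite big_cons; rewrite big_cons.
case: ifPn => // Qi; rewrite meanD ?IH//; first exact: bF.
exact: bmeas_sum.
Qed.

Lemma le_mean F G : bmeas F -> bmeas G -> (forall x, F x <= G x) ->
  mean F <= mean G.
Proof.
by move=> bF bG FG; apply: le_Rintegral => //; exact: bmeas_integrable.
Qed.

Lemma mean_ge0 F : (forall x, 0 <= F x) -> 0 <= mean F.
Proof. by move=> F0; exact: Rintegral_ge0. Qed.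

Lemma mean_itv F (a b : R) : measurable_fun setT F ->
  (forall x, a <= F x <= b) -> a <= mean F <= b.
Proof.
move=> mF Fab; have bF := bmeas_itv mF Fab.
apply/andP; split.
  by rewrite -[leLHS]mean_cst le_mean//; [exact: bmeas_cst|
     move=> x; case/andP: (Fab x)].
by rewrite -[leRHS]mean_cst le_mean//; [exact: bmeas_cst|
     move=> x; case/andP: (Fab x)].
Qed.

Lemma norm_mean_le F (M : R) : bmeas F -> (forall x, `|F x| <= M) ->
  `|mean F| <= M.
Proof.
move=> bF FM; rewrite ler_norml; apply: mean_itv; first exact: bmeas_meas.
by move=> x; rewrite -ler_norml.
Qed.

Lemma norm_mean F : bmeas F -> `|mean F| <= mean (fun x => `|F x|).
Proof. by move=> bF; apply: le_normr_Rintegral => //; exact: bmeas_integrable. Qed.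

Lemma EFin_mean F : bmeas F -> ((mean F)%:E = \int[P]_x (F x)%:E)%E.
Proof.
move=> bF; rewrite /Rintegral fineK//.
by have /(integrable_fin_num measurableT) := bmeas_integrable P bF.
Qed.

End expectation.

Section fubini.
Context d (T : measurableType d).

(** Tonelli's theorem applies to F + M, which is nonnegative when M bounds |F|. *)
Lemma bmeas_mean d2 (T2 : measurableType d2) (P : probability T2 R)
    (F : T * T2 -> R) :
  bmeas F -> bmeas (fun t => Rintegral P setT (fun y => F (t, y))).
Proof.
move=> bF; have [mF [M FM]] := bF.
have bFt t : bmeas (fun y => F (t, y)).
  by apply: (@bmeas_comp _ _ _ _ F (pair t)).
split; last by exists M => t; exact: norm_mean_le.
have FM' z : 0 <= F z + M.
  by rewrite -lerBlDr sub0r; move: (FM z); rewrite ler_norml => /andP[].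
have bFM : bmeas (fun z => F z + M).
  by apply: bmeasD => //; exact: bmeas_cst.
rewrite [X in measurable_fun _ X](_ : _ = fun t =>
   fine (\int[P]_y (F (t, y) + M)%:E)%E - M).
  apply: measurable_funB => //; apply: (measurableT_comp (@fine_measurable R _ _)) => //.
  apply: (measurable_fun_fubini_tonelli_F (fun z : T * T2 => (F z + M)%:E)).
    by apply/measurable_EFinP; case: bFM.
  by move=> z; rewrite lee_fin.
apply/funext => t.
rewrite -[X in _ = X - M]/(Rintegral P setT (fun y => F (t, y) + M)).
by rewrite meanD ?mean_cst ?addrK//; exact: bmeas_cst.
Qed.

Lemma mean_swap d2 (T2 : measurableType d2) (P : probability T R)
    (Q : probability T2 R) (F : T * T2 -> R) : bmeas F ->
  Rintegral P setT (fun x => Rintegral Q setT (fun y => F (x, y))) =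
  Rintegral Q setT (fun y => Rintegral P setT (fun x => F (x, y))).
Proof.
move=> bF.
have bFx x : bmeas (fun y => F (x, y)) by apply: (@bmeas_comp _ _ _ _ F (pair x)).
have bFy y : bmeas (fun x => F (x, y)) by apply: (@bmeas_comp _ _ _ _ F (fun x => (x, y))).
rewrite /Rintegral; congr fine.
under eq_integral do rewrite -/(Rintegral Q setT _) (EFin_mean _ (bFx _)).
under [RHS]eq_integral do rewrite -/(Rintegral P setT _) (EFin_mean _ (bFy _)).
apply: (@Fubini _ _ _ _ _ P Q (EFin \o F)).
exact: (@bmeas_integrable _ _ (P \x Q)%E).
Qed.

Lemma mean_prod d2 (T2 : measurableType d2) (P : probability T R)
    (Q : probability T2 R) (F : T * T2 -> R) : bmeas F ->
  Rintegral (P \x Q)%E setT F =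
  Rintegral P setT (fun x => Rintegral Q setT (fun y => F (x, y))).
Proof.
move=> bF.
have bFx x : bmeas (fun y => F (x, y)) by apply: (@bmeas_comp _ _ _ _ F (pair x)).
rewrite /Rintegral; congr fine.
under [RHS]eq_integral do rewrite -/(Rintegral Q setT _) (EFin_mean _ (bFx _)).
by rewrite -integral12_prod_meas1//; exact: (@bmeas_integrable _ _ (P \x Q)%E).
Qed.

End fubini.

End bounded_measurable.

(** * The uniform measure on the unit interval *)

Section unit_interval.
Context {R : realType}.
Local Notation mu := (@lebesgue_measure R).

Definition nu : probability (measurableTypeR R) R := uniform_prob (@ltr01 R).

Local Notation mu2 := (mu \x mu)%E.
Local Notation nu2 := (nu \x nu)%E.

Lemma measurable_unit_itv : measurable (unit_itv : set R).
Proof. exact: measurable_itv. Qed.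

Lemma measurable_unit_sq : measurable (unit_sq : set (R * R)).
Proof. by apply: measurableX; exact: measurable_unit_itv. Qed.

Lemma ge0_integral_unit_itv (F : R -> \bar R) : measurable_fun setT F ->
  (forall x, 0 <= F x)%E ->
  (\int[mu]_(x in unit_itv) F x = \int[nu]_x F x)%E.
Proof. by move=> mF F0; rewrite integral_uniform// subr0 invr1 mul1e. Qed.

Lemma Rintegral_unit_itv (F : R -> R) : measurable_fun setT F ->
  \int[mu]_(x in unit_itv) F x = \int[nu]_x F x.
Proof.
move=> mF; have mEF : measurable_fun setT (EFin \o F) by apply/measurable_EFinP.
rewrite /Rintegral; congr fine; rewrite integralE [RHS]integralE.
by rewrite !ge0_integral_unit_itv//;
  [exact: measurable_funeneg|exact: measurable_funepos].
Qed.

Lemma ge0_integral_unit_sq (F : R * R -> \bar R) : measurable_fun setT F ->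
  (forall z, 0 <= F z)%E ->
  (\int[mu2]_(z in unit_sq) F z = \int[nu2]_z F z)%E.
Proof.
move=> mF F0; rewrite integral_mkcond fubini_tonelli1; last 2 first.
- by apply/(measurable_restrictT _ measurable_unit_sq)/measurable_funTS.
- by move=> z; exact: erestrict_ge0.
rewrite fubini_tonelli1// /fubini_F.
transitivity (\int[mu]_(x in unit_itv) (\int[nu]_y F (x, y)))%E; last first.
  rewrite ge0_integral_unit_itv//.
    exact: measurable_fun_fubini_tonelli_F.
  by move=> x; exact: integral_ge0.
rewrite [RHS]integral_mkcond; apply: eq_integral => x _.
rewrite patchE; case: ifPn => xI.
  rewrite -ge0_integral_unit_itv//; last exact: measurableT_comp.
  rewrite [RHS]integral_mkcond; apply: eq_integral => y _.
  by rewrite !patchE /unit_sq in_setX/= xI.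
apply: integral0_eq => y _; rewrite patchE /unit_sq in_setX/=.
by rewrite (negbTE xI).
Qed.

Lemma Rintegral_unit_sq (F : R * R -> R) : measurable_fun setT F ->
  \int[mu2]_(z in unit_sq) F z = \int[nu2]_z F z.
Proof.
move=> mF; have mEF : measurable_fun setT (EFin \o F) by apply/measurable_EFinP.
rewrite /Rintegral; congr fine; rewrite integralE [RHS]integralE.
by rewrite !ge0_integral_unit_sq//;
  [exact: measurable_funeneg|exact: measurable_funepos].
Qed.

End unit_interval.

(** * Iterated means over coordinates *)

Section coordinates.
Context {R : realType}.
Local Notation mu := (@lebesgue_measure R).
Implicit Types (F G : (nat -> R) -> R) (z : nat -> R) (s : seq nat).

Definition upd z (i : nat) (y : R) : nat -> R :=
  fun j => if j == i then y else z j.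

(** Measurability is asked along every measurable family of points rather than
    for a sigma-algebra on nat -> R: the class is then closed under integrating
    out one coordinate, by Fubini's theorem on T * R. *)
Definition smeas F : Prop :=
  (exists M, forall z, `|F z| <= M) /\
  forall d (T : measurableType d) (x : nat -> T -> R),
    (forall i, measurable_fun setT (x i)) ->
    measurable_fun setT (fun t => F (fun i => x i t)).

Definition integ (i : nat) F : (nat -> R) -> R :=
  fun z => \int[nu]_y F (upd z i y).

(** Integrates out the coordinates listed in s; the remaining coordinates of the
    argument are parameters. *)
Definition Es s F := foldr integ F s.

Definition indep (i : nat) F := forall z y, F (upd z i y) = F z.

Lemma upd_eq z i y : upd z i y i = y. Proof. by rewrite /upd eqxx. Qed.

Lemma upd_neq z i j y : j != i -> upd z i y j = z j.
Proof. by rewrite /upd => /negbTE ->. Qed.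

Lemma updC z i j x y : i != j -> upd (upd z i x) j y = upd (upd z j y) i x.
Proof.
move=> ij; apply/funext => k; rewrite /upd.
by case: (eqVneq k j) => // ->; rewrite eq_sym (negbTE ij).
Qed.

Lemma upd_upd z i x y : upd (upd z i x) i y = upd z i y.
Proof. by apply/funext => k; rewrite /upd; case: eqP. Qed.

Lemma smeas_bmeas F d (T : measurableType d) (x : nat -> T -> R) : smeas F ->
  (forall i, measurable_fun setT (x i)) -> bmeas (fun t => F (fun i => x i t)).
Proof. by move=> [[M FM] mF] mx; split; [exact: mF|exists M]. Qed.

Lemma measurable_upd d (T : measurableType d) (x : nat -> T -> R) i
    (y : T -> R) : (forall i, measurable_fun setT (x i)) ->
  measurable_fun setT y ->
  forall j, measurable_fun setT (fun t => upd (fun i => x i t) i (y t) j).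
Proof. by move=> mx my j; rewrite /upd; case: (j == i). Qed.

Lemma smeas_upd F z i : smeas F -> bmeas (fun y => F (upd z i y)).
Proof.
by move=> sF; apply: (smeas_bmeas (x := fun j y => upd z i y j)) => //;
   apply: (@measurable_upd _ _ (fun i _ => z i)).
Qed.

Lemma smeas_upd2 F z i j : smeas F ->
  bmeas (fun u : R * R => F (upd (upd z i u.1) j u.2)).
Proof.
move=> sF; apply: (smeas_bmeas (x := fun k u => upd (upd z i u.1) j u.2 k)) => //.
apply: (@measurable_upd _ _ (fun k u => upd z i u.1 k)) => //.
exact: (@measurable_upd _ _ (fun i _ => z i)).
Qed.

Lemma smeas_cst (c : R) : smeas (fun=> c).
Proof. by split=> //; exists `|c|. Qed.

Lemma smeasM F G : smeas F -> smeas G -> smeas (fun z => F z * G z).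
Proof.
move=> [[M FM] mF] [[N GN] mG]; split=> [|d T x mx].
  by exists (M * N) => z; rewrite normrM ler_pM.
by apply: measurable_funM; [exact: mF|exact: mG].
Qed.

Lemma smeasD F G : smeas F -> smeas G -> smeas (fun z => F z + G z).
Proof.
move=> [[M FM] mF] [[N GN] mG]; split=> [|d T x mx].
  by exists (M + N) => z; rewrite (le_trans (ler_normD _ _))// lerD.
by apply: measurable_funD; [exact: mF|exact: mG].
Qed.

Lemma smeasB F G : smeas F -> smeas G -> smeas (fun z => F z - G z).
Proof.
move=> [[M FM] mF] [[N GN] mG]; split=> [|d T x mx].
  by exists (M + N) => z; rewrite (le_trans (ler_normB _ _))// lerD.
by apply: measurable_funB; [exact: mF|exact: mG].
Qed.

Lemma smeas_prod (I : Type) (r : seq I) (P : pred I) (F : I -> (nat -> R) -> R) :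
  (forall i, P i -> smeas (F i)) ->
  smeas (fun z => \prod_(i <- r | P i) F i z).
Proof.
move=> sF; elim: r => [|i r IH].
  rewrite [X in smeas X](_ : _ = fun=> 1); first exact: smeas_cst.
  by apply/funext => x; rewrite big_nil.
rewrite [X in smeas X](_ : _ = fun x =>
  (if P i then F i x else 1) * \prod_(i <- r | P i) F i x).
  by apply: smeasM => //; case Pi : (P i); [exact: sF|exact: smeas_cst].
by apply/funext => x; rewrite big_cons; case: ifP => //; rewrite mul1r.
Qed.

Lemma smeas_coord (g : R -> R) i : bmeas g -> smeas (fun z => g (z i)).
Proof.
move=> [mg [M gM]]; split; first by exists M.
by move=> d T x mx; exact: measurableT_comp.
Qed.

Lemma smeas_coord2 (g : R * R -> R) i j : bmeas g ->
  smeas (fun z => g (z i, z j)).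
Proof.
move=> [mg [M gM]]; split; first by exists M.
move=> d T x mx; apply: (measurableT_comp mg).
exact: measurable_fun_pair.
Qed.

Lemma smeas_integ i F : smeas F -> smeas (integ i F).
Proof.
move=> sF; have [[M FM] mF] := sF; split.
  exists M => z; apply: norm_mean_le => //; exact: smeas_upd.
move=> d T x mx.
have := @bmeas_mean _ _ T _ _ nu (fun u : T * R => F (upd (fun i => x i u.1) i u.2)).
case=> //; apply: (smeas_bmeas (x := fun j (u : T * R) => upd (fun i => x i u.1) i u.2 j)) => //.
apply: (@measurable_upd _ _ (fun i (u : T * R) => x i u.1)) => //.
by move=> k; exact: measurableT_comp.
Qed.

Lemma smeas_Es s F : smeas F -> smeas (Es s F).
Proof. by move=> sF; elim: s => //= i s IH; exact: smeas_integ. Qed.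

Lemma Es_cat s s' F : Es (s ++ s') F = Es s (Es s' F).
Proof. exact: foldr_cat. Qed.

Lemma integC i j F : smeas F -> integ i (integ j F) = integ j (integ i F).
Proof.
move=> sF; have [->//|ij] := eqVneq i j.
apply/funext => z; rewrite /integ.
rewrite (mean_swap nu nu (smeas_upd2 z i j sF)).
apply: eq_Rintegral => y _; apply: eq_Rintegral => x _ /=.
by rewrite updC.
Qed.

Lemma Es_rem i s F : smeas F -> i \in s -> Es s F = Es (i :: rem i s) F.
Proof.
move=> sF; elim: s => // j s IH; rewrite inE /=.
have [-> //|ji /=] := eqVneq j i.
move=> /IH -> /=.
by rewrite integC//; exact: smeas_Es.
Qed.

(** Fubini's theorem: the order of integration is immaterial. *)
Lemma Es_perm s s' F : smeas F -> perm_eq s s' -> Es s F = Es s' F.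
Proof.
move=> sF; elim: s s' => [|i s IH] s' ss'.
  by rewrite perm_sym in ss'; rewrite (perm_nilP ss').
have is' : i \in s' by rewrite -(perm_mem ss') mem_head.
rewrite (Es_rem sF is') /= (IH (rem i s'))//.
by rewrite -(perm_cons i) (perm_trans ss')// perm_to_rem.
Qed.

Lemma Es_ext s F G : F =1 G -> Es s F =1 Es s G.
Proof. by move=> /funext ->. Qed.

Lemma Es_le s F G : smeas F -> smeas G -> (forall z, F z <= G z) ->
  forall z, Es s F z <= Es s G z.
Proof.
move=> sF sG FG; elim: s => //= i s IH z; apply: le_mean => //.
- by apply: smeas_upd; exact: smeas_Es.
- by apply: smeas_upd; exact: smeas_Es.
Qed.

Lemma Es_cst s (c : R) z : Es s (fun=> c) z = c.
Proof.
elim: s z => //= i s IH z; rewrite /integ.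
by under eq_Rintegral do rewrite IH; rewrite mean_cst.
Qed.

Lemma norm_Es_le s F (M : R) z : smeas F -> (forall z, `|F z| <= M) ->
  `|Es s F z| <= M.
Proof.
move=> sF FM; rewrite ler_norml; apply/andP; split.
  rewrite -(Es_cst s (- M) z) Es_le//; first exact: smeas_cst.
  by move=> y; move: (FM y); rewrite ler_norml => /andP[].
rewrite -(Es_cst s M z) Es_le//; first exact: smeas_cst.
by move=> y; move: (FM y); rewrite ler_norml => /andP[].
Qed.

Lemma EsB s F G z : smeas F -> smeas G ->
  Es s (fun z => F z - G z) z = Es s F z - Es s G z.
Proof.
move=> sF sG; elim: s z => //= i s IH z; rewrite /integ.
rewrite -meanB; [|by apply: smeas_upd; exact: smeas_Es..].
by apply: eq_Rintegral => y _; rewrite IH.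
Qed.

Lemma Es_sum (I : Type) (r : seq I) (P : pred I) (F : I -> (nat -> R) -> R) s z :
  (forall i, P i -> smeas (F i)) ->
  Es s (fun z => \sum_(i <- r | P i) F i z) z = \sum_(i <- r | P i) Es s (F i) z.
Proof.
move=> sF; elim: s z => //= i s IH z; rewrite /integ.
rewrite -mean_sum; last first.
  by move=> k Pk; apply: smeas_upd; apply: smeas_Es; exact: sF.
by apply: eq_Rintegral => y _; rewrite IH.
Qed.

Lemma Es_indepl s F G z : smeas F -> (forall i, i \in s -> indep i G) ->
  Es s (fun z => G z * F z) z = G z * Es s F z.
Proof.
move=> sF; elim: s z => //= i s IH z iG; rewrite /integ.
rewrite -meanZ; last by apply: smeas_upd; exact: smeas_Es.
apply: eq_Rintegral => y _; rewrite IH; last first.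
  by move=> j js; apply: iG; rewrite inE js orbT.
by rewrite iG// mem_head.
Qed.

Lemma indep_integ i j F : indep i F -> indep i (integ j F).
Proof.
move=> iF z y; rewrite /integ; apply: eq_Rintegral => x _.
have [->|ij] := eqVneq i j; first by rewrite upd_upd.
by rewrite updC// iF.
Qed.

(** When no factor depends on the variable of another one, the integral of the
    product splits.  The factors may share variables outside s. *)
Lemma Es_prod (I : eqType) (ix : I -> nat) (s : seq I)
    (F : I -> (nat -> R) -> R) z : injective ix -> uniq s ->
  (forall i, i \in s -> smeas (F i)) ->
  (forall i j, i \in s -> j \in s -> i != j -> indep (ix i) (F j)) ->
  Es (map ix s) (fun z => \prod_(i <- s) F i z) z =
  \prod_(i <- s) integ (ix i) (F i) z.
Proof.
move=> ixI; elim: s z => [|i s IH] z /=; first by rewrite !big_nil.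
move=> /andP[is_ us] sF iF.
have sFs j : j \in s -> smeas (F j) by move=> js; apply: sF; rewrite inE js orbT.
have sP : smeas (fun z => \prod_(j <- s) F j z).
  rewrite [X in smeas X](_ : _ = fun z => \prod_(j <- s | j \in s) F j z).
    by apply: smeas_prod => j; exact: sFs.
  by apply/funext => w; rewrite big_seq.
rewrite big_cons /integ -/integ.
transitivity (\int[nu]_y (\prod_(j <- s) integ (ix j) (F j) z * F i (upd z (ix i) y))).
  apply: eq_Rintegral => y _.
  rewrite (_ : (fun z0 => \prod_(i0 <- i :: s) F i0 z0) =
     fun z0 => F i z0 * \prod_(j <- s) F j z0); last first.
    by apply/funext => w; rewrite big_cons.
  rewrite Es_indepl//; last first.
    move=> _ /mapP[j js ->]; apply: iF; rewrite ?inE ?eqxx ?js ?orbT//.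
    by apply: contraNneq is_ => <-.
  rewrite mulrC; congr (_ * _); rewrite IH//; last first.
    by move=> j k js ks; apply: iF; rewrite inE ?js ?ks orbT.
  rewrite !big_seq; apply: eq_bigr => j js.
  apply: indep_integ; apply: iF; rewrite ?inE ?eqxx ?js ?orbT//.
  by apply: contraNneq is_ => ->.
rewrite meanZ 1?mulrC//; apply: smeas_upd; apply: sF; exact: mem_head.
Qed.

(** Comparing integrands on the hyperplane z i = x is enough as long as the
    coordinate i stays frozen. *)
Lemma Es_agree s i x F G : i \notin s ->
  (forall z, z i = x -> F z = G z) -> forall z, z i = x -> Es s F z = Es s G z.
Proof.
move=> + FG; elim: s => //= j s IH; rewrite inE negb_or => /andP[ij js] z zi.
by rewrite /integ; apply: eq_Rintegral => y _; apply: IH => //; rewrite upd_neq.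
Qed.

End coordinates.

Section cube.
Context {R : realType}.

(** The offset k names the outermost variable k and the remaining ones k + 1,
    k + 2, and so on, which is what the induction on n produces. *)
Lemma cube_integralE (n : nat) (F : n.-tuple R -> R) (k : nat) (z0 : nat -> R) :
  smeas (fun z => F [tuple z (k + i)%N | i < n]) ->
  cube_integral F = Es (iota k n) (fun z => F [tuple z (k + i)%N | i < n]) z0.
Proof.
elim: n F k z0 => [|n IH] F k z0 sF /=.
  by congr F; apply/val_inj/esym/size0nil; rewrite size_tuple.
have E x z : z k = x -> F [tuple of x :: [tuple z (k.+1 + i)%N | i < n]] =
    F [tuple z (k + i)%N | i < n.+1].
  move=> zk; congr F; apply: eq_from_tnth => i; rewrite tnth_mktuple.
  case: (unliftP ord0 i) => [j|] ->; first by rewrite tnthS tnth_mktuple /= /bump /= addSnnS.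
  by rewrite tnth0 addn0.
have sFx x : smeas (fun z => F [tuple of x :: [tuple z (k.+1 + i)%N | i < n]]).
  rewrite [X in smeas X](_ : _ = fun z => F [tuple upd z k x (k + i)%N | i < n.+1]).
    case: sF => -[M FM] mF; split; first by exists M.
    move=> dT T y my; apply: (mF _ _ (fun j t => upd (fun i => y i t) k x j)) => j.
    by apply: (@measurable_upd _ _ _ y k (fun=> x)).
  apply/funext => z; rewrite -(E x (upd z k x)) ?upd_eq//; congr F.
  apply: eq_from_tnth => i; case: (unliftP ord0 i) => [j|] ->; last by rewrite !tnth0.
  by rewrite !tnthS !tnth_mktuple upd_neq// gtn_eqF// ltn_addr.
have sI : measurable_fun setT (fun x => Es (iota k.+1 n)
    (fun z => F [tuple z (k + i)%N | i < n.+1]) (upd z0 k x)).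
  have : smeas (Es (iota k.+1 n) (fun z => F [tuple z (k + i)%N | i < n.+1])).
    exact: smeas_Es.
  by move=> /(smeas_upd z0 k)/bmeas_meas.
rewrite /integ -Rintegral_unit_itv//; apply: eq_Rintegral => x _.
rewrite (IH _ k.+1 (upd z0 k x))//.
apply: (@Es_agree _ _ k x) => //.
- by rewrite mem_iota ltnn.
- by move=> z; exact: E.
- by rewrite upd_eq.
Qed.

End cube.

(** * The cut distance *)

Section clipping.
Context {R : realType}.
Local Notation mu := (@lebesgue_measure R).
Local Notation mu2 := (mu \x mu)%E.
Local Notation nu := (@nu R).
Local Notation nu2 := (nu \x nu)%E.
Implicit Types f g h : R * R -> R.

(** A graphon is constrained on the unit square only; cutting it off outside
    makes it measurable on the whole plane without changing any integral. *)
Definition clip f : R * R -> R := f \_ unit_sq.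

Record global_graphon f : Prop := GlobalGraphon {
  gg_meas : measurable_fun setT f;
  gg_sym : forall x y, f (x, y) = f (y, x);
  gg_itv : forall z, 0 <= f z <= 1 }.

Lemma gg_bmeas f : global_graphon f -> bmeas f.
Proof. by case=> mf _ f01; exact: bmeas_itv f01. Qed.

Lemma unit_sqC (x y : R) : ((x, y) \in unit_sq) = ((y, x) \in unit_sq).
Proof. by rewrite /unit_sq !in_setX/= andbC. Qed.

Lemma clipE f z : z \in unit_sq -> clip f z = f z.
Proof. by rewrite /clip patchE => ->. Qed.

Lemma clip_out f z : z \notin unit_sq -> clip f z = 0.
Proof. by rewrite /clip patchE => /negbTE ->. Qed.

Lemma graphon_clip f : graphon f -> global_graphon (clip f).
Proof.
move=> [mf fsym f01]; split.
- by apply/(measurable_restrictT _ measurable_unit_sq).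
- move=> x y; have [xy|xy] := boolP ((x, y) \in unit_sq).
    by rewrite (clipE _ xy) fsym// (clipE f (z := (y, x)))// unit_sqC.
  by rewrite (clip_out _ xy) clip_out// unit_sqC.
- move=> z; have [zI|zI] := boolP (z \in unit_sq); first by rewrite clipE// f01.
  by rewrite clip_out// lexx ler01.
Qed.

Definition L1dist f g : R := \int[nu2]_z `|f z - g z|.

Definition cut_form f g (a b : R -> R) : R :=
  \int[nu2]_z (a z.1 * b z.2 * (f z - g z)).

Lemma rect_integral f g S T : graphon f -> graphon g ->
  measurable S -> S `<=` unit_itv -> measurable T -> T `<=` unit_itv ->
  \int[mu2]_(z in S `*` T) (f z - g z) = cut_form (clip f) (clip g) \1_S \1_T.
Proof.
move=> Gf Gg mS SI mT TI; rewrite /cut_form -Rintegral_unit_sq; last first.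
  apply: measurable_funM.
    apply: measurable_funM; apply: measurableT_comp => //; exact: measurable_indic.
  by apply: measurable_funB; [case: (graphon_clip Gf)|case: (graphon_clip Gg)].
rewrite (_ : S `*` T = unit_sq `&` (S `*` T)); last first.
  by apply/seteqP; split => [z [/= Sz Tz]|z []//]; split=> //; split; [exact: SI|exact: TI].
rewrite Rintegral_mkcondr; apply: eq_Rintegral => z zI.
rewrite patchE in_setX !clipE// !indicE.
by case: (z.1 \in S); case: (z.2 \in T); rewrite ?mul1r ?mulr0 ?mul0r.
Qed.

Lemma cut_form_le_L1 f g a b : global_graphon f -> global_graphon g ->
  bmeas a -> bmeas b -> (forall x, `|a x| <= 1) -> (forall x, `|b x| <= 1) ->
  `|cut_form f g a b| <= L1dist f g.
Proof.
move=> Gf Gg ba bb a1 b1.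
have bfg : bmeas (fun z => f z - g z) by apply: bmeasB; exact: gg_bmeas.
have bw : bmeas (fun z : R * R => a z.1 * b z.2 * (f z - g z)).
  by apply: bmeasM => //; apply: bmeasM; exact: (bmeas_comp (F := _)).
apply: (le_trans (norm_mean nu2 bw)); apply: le_mean.
- exact: bmeas_norm.
- exact: bmeas_norm.
- move=> z; rewrite normrM ler_piMl// normrM -[leRHS]mulr1.
  by rewrite ler_pM.
Qed.

Lemma indic_norm_le1 (A : set R) x : `|\1_A x : R| <= 1.
Proof. by rewrite indicE; case: (_ \in _); rewrite /= ?normr0 ?normr1 ?ler01. Qed.

Definition cut_values f g : set R := [set x | exists S T : set R,
    [/\ measurable S /\ S `<=` unit_itv,
        measurable T /\ T `<=` unit_itv &
        x = `| \int[mu2]_(z in S `*` T) (f z - g z) |]].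

Lemma cut_values_L1 f g : graphon f -> graphon g ->
  ubound (cut_values f g) (L1dist (clip f) (clip g)).
Proof.
move=> Gf Gg _ [S [T [[mS SI] [mT TI] ->]]]; rewrite rect_integral//.
apply: cut_form_le_L1; try exact: graphon_clip; try exact: bmeas_indic;
  by move=> x; exact: indic_norm_le1.
Qed.

Lemma cut_values0 f g : cut_values f g !=set0.
Proof.
exists `| \int[mu2]_(z in set0 `*` set0) (f z - g z) |, set0, set0.
by split => //; split.
Qed.

Lemma cut_dist_ge f g S T : graphon f -> graphon g ->
  measurable S -> S `<=` unit_itv -> measurable T -> T `<=` unit_itv ->
  `| \int[mu2]_(z in S `*` T) (f z - g z) | <= cut_dist f g.
Proof.
move=> Gf Gg mS SI mT TI; apply: ub_le_sup.
  by exists (L1dist (clip f) (clip g)); exact: cut_values_L1.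
by exists S, T.
Qed.

Lemma cut_dist_ge0 f g : graphon f -> graphon g -> 0 <= cut_dist f g.
Proof.
move=> Gf Gg; rewrite (le_trans (normr_ge0 _) (cut_dist_ge (S := set0) (T := set0) Gf Gg _ _ _ _))//.
Qed.

Lemma cut_distD_L1 f g h : graphon f -> graphon g -> graphon h ->
  cut_dist f h <= cut_dist f g + L1dist (clip g) (clip h).
Proof.
move=> Gf Gg Gh; apply: ge_sup; first exact: cut_values0.
move=> _ [S [T [[mS SI] [mT TI] ->]]].
have -> : \int[mu2]_(z in S `*` T) (f z - h z) =
    \int[mu2]_(z in S `*` T) (f z - g z) + \int[mu2]_(z in S `*` T) (g z - h z).
  have bS x : bmeas (\1_x : R -> R) -> bmeas (fun z : R * R => \1_x z.1 : R).
    by move=> bx; exact: (bmeas_comp bx).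
  have bT x : bmeas (\1_x : R -> R) -> bmeas (fun z : R * R => \1_x z.2 : R).
    by move=> bx; exact: (bmeas_comp bx).
  rewrite !rect_integral// /cut_form -meanD; first last.
  - apply: bmeasM; [apply: bmeasM; [apply: bS|apply: bT]; exact: bmeas_indic|].
    by apply: bmeasB; apply: gg_bmeas; exact: graphon_clip.
  - apply: bmeasM; [apply: bmeasM; [apply: bS|apply: bT]; exact: bmeas_indic|].
    by apply: bmeasB; apply: gg_bmeas; exact: graphon_clip.
  by apply: eq_Rintegral => z _; ring.
rewrite (le_trans (ler_normD _ _))// lerD//; first exact: cut_dist_ge.
by apply: cut_values_L1 => //; exists S, T.
Qed.

Lemma cut_dist_le_L1 f g : graphon f -> graphon g ->
  cut_dist f g <= L1dist (clip f) (clip g).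
Proof.
by move=> Gf Gg; apply: ge_sup; [exact: cut_values0|exact: cut_values_L1].
Qed.

(** The form is linear in each weight, so it is maximised by the indicator of
    the set where the coefficient of that weight is nonnegative; replacing first
    a and then b leads to the integral over a rectangle. *)
Lemma cut_form_le f g a b : graphon f -> graphon g ->
  bmeas a -> bmeas b ->
  (forall x, 0 <= a x <= 1) -> (forall x, 0 <= b x <= 1) ->
  cut_form (clip f) (clip g) a b <= cut_dist f g /\
  - cut_dist f g <= cut_form (clip f) (clip g) a b.
Proof.
move=> Gf Gg ba bb a01 b01.
have bD : bmeas (fun z => clip f z - clip g z).
  by apply: bmeasB; apply: gg_bmeas; exact: graphon_clip.
have step (sgn : R) : sgn = 1 \/ sgn = -1 ->
    sgn * cut_form (clip f) (clip g) a b <= cut_dist f g.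
  move=> sgn1.
  have bs (u v : R -> R) : bmeas u -> bmeas v ->
      bmeas (fun z : R * R => u z.1 * v z.2 * (sgn * (clip f z - clip g z))).
    move=> bu bv; apply: bmeasM; last by apply: bmeasM => //; exact: bmeas_cst.
    by apply: bmeasM; [exact: (bmeas_comp bu)|exact: (bmeas_comp bv)].
  have cutE u v : bmeas u -> bmeas v -> sgn * cut_form (clip f) (clip g) u v =
      \int[nu2]_z (u z.1 * v z.2 * (sgn * (clip f z - clip g z))).
    move=> bu bv; rewrite /cut_form -meanZ; last first.
      apply: bmeasM => //.
      by apply: bmeasM; [exact: (bmeas_comp bu)|exact: (bmeas_comp bv)].
    by apply: eq_Rintegral => z _; ring.
  (* L is the coefficient of the weight a; outside [0,1] it is 0, so S may be
     taken inside the unit interval *)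
  pose L x := \int[nu]_y (b y * (sgn * (clip f (x, y) - clip g (x, y)))).
  have bL' (u : R -> R) : bmeas u ->
      bmeas (fun z : R * R => u z.2 * (sgn * (clip f z - clip g z))).
    move=> bu; apply: bmeasM; first exact: (bmeas_comp bu).
    by apply: bmeasM => //; exact: bmeas_cst.
  have bL : bmeas L.
    by apply: (@bmeas_mean R _ R _ _ nu (fun z => b z.2 * (sgn * (clip f z - clip g z)))); exact: bL'.
  pose S := unit_itv `&` [set x | 0 <= L x].
  have mS : measurable S.
    apply: measurableI; first exact: measurable_unit_itv.
    rewrite -[X in measurable X]setTI.
    have [mL _] := bL.
    have := mL measurableT `[0, +oo[%classic (measurable_itv _).
    congr measurable; apply/seteqP; split=> x /=; rewrite in_itv/= andbT => -[//].
  have first_step : sgn * cut_form (clip f) (clip g) a b <=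
      sgn * cut_form (clip f) (clip g) \1_S b.
    have bS : bmeas (\1_S : R -> R) := bmeas_indic mS.
    rewrite !cutE// (mean_prod nu nu (bs _ _ ba bb)) (mean_prod nu nu (bs _ _ bS bb)).
    have eqL (u : R -> R) : bmeas u -> \int[nu]_x \int[nu]_y
        (u x * b y * (sgn * (clip f (x, y) - clip g (x, y)))) =
        \int[nu]_x (u x * L x).
      move=> bu; apply: eq_Rintegral => x _; rewrite -meanZ.
        by apply: eq_Rintegral => y _; ring.
      by apply: (bmeas_comp (bL' _ bb) (phi := pair x)).
    rewrite /= !eqL//; apply: le_mean; [exact: bmeasM..|] => x.
    rewrite indicE; have /andP[a0 a1] := a01 x.
    have [xI|xI] := boolP (x \in unit_itv); last first.
      rewrite (_ : L x = 0) ?mulr0//.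
      rewrite /L (_ : (fun _ => _) = fun=> 0) ?mean_cst//; apply/funext => y.
      by rewrite !clip_out ?subr0 ?mulr0// /unit_sq in_setX/= (negbTE xI).
    rewrite in_setI xI/=.
    have [Lx|Lx] := leP 0 (L x).
      by rewrite mem_set// ler_wpM2r.
    rewrite memNset/= ?mul0r; first by rewrite mulr_ge0_le0// ltW.
    by apply/negP; rewrite -ltNge.
  apply: (le_trans first_step).
  pose K y := \int[nu]_x (\1_S x * (sgn * (clip f (x, y) - clip g (x, y)))).
  have bS : bmeas (\1_S : R -> R) := bmeas_indic mS.
  have bK' : bmeas (fun z : R * R => \1_S z.1 * (sgn * (clip f z - clip g z)) : R).
    apply: bmeasM; first exact: (bmeas_comp bS).
    by apply: bmeasM => //; exact: bmeas_cst.
  have bK : bmeas K.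
    apply: (@bmeas_mean R _ R _ _ nu (fun z : R * R => \1_S z.2 * (sgn * (clip f (z.2, z.1) - clip g (z.2, z.1))))).
    by apply: (bmeas_comp bK' (phi := fun z => (z.2, z.1))); exact: measurable_fun_pair.
  pose T := unit_itv `&` [set x | 0 <= K x].
  have mT : measurable T.
    apply: measurableI; first exact: measurable_unit_itv.
    rewrite -[X in measurable X]setTI.
    have [mK _] := bK.
    have := mK measurableT `[0, +oo[%classic (measurable_itv _).
    congr measurable; apply/seteqP; split=> x /=; rewrite in_itv/= andbT => -[//].
  have bT : bmeas (\1_T : R -> R) := bmeas_indic mT.
  apply: (@le_trans _ _ (sgn * cut_form (clip f) (clip g) \1_S \1_T)).
    rewrite !cutE// (mean_prod nu nu (bs _ _ bS bb)) (mean_prod nu nu (bs _ _ bS bT)).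
    have eqK (u : R -> R) : bmeas u -> \int[nu]_x \int[nu]_y
        (\1_S x * u y * (sgn * (clip f (x, y) - clip g (x, y)))) =
        \int[nu]_y (u y * K y).
      move=> bu; rewrite (mean_swap nu nu (bs _ _ bS bu)).
      apply: eq_Rintegral => y _; rewrite -meanZ.
        by apply: eq_Rintegral => x _ /=; ring.
      by apply: (bmeas_comp bK' (phi := fun x => (x, y))).
    rewrite /= !eqK//; apply: le_mean; [exact: bmeasM..|] => y.
    rewrite indicE; have /andP[b0 b1] := b01 y.
    have [yI|yI] := boolP (y \in unit_itv); last first.
      rewrite (_ : K y = 0) ?mulr0//.
      rewrite /K (_ : (fun _ => _) = fun=> 0) ?mean_cst//; apply/funext => x.
      by rewrite !clip_out ?subr0 ?mulr0// /unit_sq in_setX/= (negbTE yI) andbF.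
    rewrite in_setI yI/=.
    have [Ky|Ky] := leP 0 (K y).
      by rewrite mem_set// ler_wpM2r.
    rewrite memNset/= ?mul0r; first by rewrite mulr_ge0_le0// ltW.
    by apply/negP; rewrite -ltNge.
  rewrite -rect_integral//; [|by move=> x []..].
  apply: le_trans (cut_dist_ge Gf Gg mS _ mT _); [|by move=> x []..].
  case: sgn1 => ->; rewrite ?mul1r ?mulN1r; first exact: ler_norm.
  by rewrite -normrN ler_norm.
split; first by rewrite -[leLHS]mul1r; apply: step; left.
by rewrite lerNl -mulN1r; apply: step; right.
Qed.

End clipping.

(** * The counting lemma *)

Section counting.
Context {R : realType}.
Local Notation mu := (@lebesgue_measure R).
Local Notation nu := (@nu R).
Local Notation nu2 := (nu \x nu)%E.
Implicit Types f g h : R * R -> R.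
Implicit Types (l : seq (nat * nat)) (z : nat -> R).

Definition edge_prod f l z : R := \prod_(k <- l) f (z k.1, z k.2).

Lemma smeas_edge_prod f l : bmeas f -> smeas (edge_prod f l).
Proof. by move=> bf; apply: smeas_prod => k _; exact: smeas_coord2. Qed.

(** Each factor w k misses x_i or x_j, since no other edge joins i and j.
    Once the remaining variables are frozen, the product of the w k thus has the
    form a(x_i) b(x_j), to which the bound on [cut_form] applies. *)
Lemma Es_one_edge f g (D : R) s i j (n : nat) (w : 'I_n -> (nat -> R) -> R) z :
  bmeas f -> bmeas g ->
  (forall a b : R -> R, bmeas a -> bmeas b -> (forall x, 0 <= a x <= 1) ->
     (forall x, 0 <= b x <= 1) -> `|cut_form f g a b| <= D) ->
  i != j -> i \in s -> j \in s ->
  (forall k, smeas (w k)) -> (forall k z, 0 <= w k z <= 1) ->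
  (forall k, indep i (w k) \/ indep j (w k)) ->
  `|Es s (fun z => (f (z i, z j) - g (z i, z j)) * \prod_k w k z) z| <= D.
Proof.
move=> bf bg fgD ij is_ js sw w01 wij.
pose wA k z := if `[< indep j (w k) >] then w k z else 1.
pose wB k z := if `[< indep j (w k) >] then 1 else w k z.
pose A z := \prod_k wA k z; pose B z := \prod_k wB k z.
have prodAB y : \prod_k w k y = A y * B y.
  rewrite /A /B -big_split; apply: eq_bigr => k _.
  by rewrite /wA /wB; case: asboolP; rewrite /= ?mulr1 ?mul1r.
have sA : smeas A.
  apply: smeas_prod => k _; rewrite /wA.
  by case: asboolP => _; [exact: sw|exact: smeas_cst].
have sB : smeas B.
  apply: smeas_prod => k _; rewrite /wB.
  by case: asboolP => _; [exact: smeas_cst|exact: sw].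
have prod01 (u : 'I_n -> (nat -> R) -> R) y :
    (forall k, 0 <= u k y <= 1) -> 0 <= \prod_k u k y <= 1.
  move=> u01; apply/andP; split.
    by apply: prodr_ge0 => k _; case/andP: (u01 k).
  by apply: prodr_ile1 => k _; exact: u01.
have A01 y : 0 <= A y <= 1.
  by apply: prod01 => k; rewrite /wA; case: ifP => // _; rewrite ler01 lexx.
have B01 y : 0 <= B y <= 1.
  by apply: prod01 => k; rewrite /wB; case: ifP => // _; rewrite ler01 lexx.
have Aj : indep j A.
  by move=> y x; apply: eq_bigr => k _; rewrite /wA; case: asboolP => // ->.
have Bi : indep i B.
  move=> y x; apply: eq_bigr => k _; rewrite /wB; case: asboolP => // nj.
  by have [->|/nj] := wij k.
pose F z := (f (z i, z j) - g (z i, z j)) * (A z * B z).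
have sF : smeas F.
  apply: smeasM; last exact: smeasM.
  by apply: smeasB; exact: smeas_coord2.
rewrite (_ : (fun _ => _) = F); last by apply/funext => y; rewrite prodAB.
have ps : perm_eq s (rem j (rem i s) ++ [:: i; j]).
  rewrite perm_sym perm_catC /= perm_sym (perm_trans (perm_to_rem is_))//.
  by rewrite perm_cons perm_to_rem// rem_mem// eq_sym.
rewrite (Es_perm sF ps) Es_cat; apply: norm_Es_le; first exact: smeas_Es.
move=> y /=.
pose a x := A (upd y i x); pose b x := B (upd y j x).
have ba : bmeas a by exact: smeas_upd.
have bb : bmeas b by exact: smeas_upd.
have := fgD a b ba bb (fun x => A01 _) (fun x => B01 _).
rewrite /cut_form mean_prod; last first.
  apply: bmeasM; last exact: bmeasB.
  by apply: bmeasM; [exact: (bmeas_comp ba)|exact: (bmeas_comp bb)].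
congr (`|_| <= D); apply: eq_Rintegral => x _; apply: eq_Rintegral => x' _ /=.
rewrite /F upd_eq upd_neq// upd_eq Aj (updC y x x' ij) Bi /a /b.
by rewrite mulrC.
Qed.

(** The edges are switched from f to g one at a time, each switch costing at
    most D; in the induction l1 collects the edges already switched. *)
Lemma Es_edge_prod_diff f g (D : R) s l z : bmeas f -> bmeas g ->
  (forall u, 0 <= f u <= 1) -> (forall u, 0 <= g u <= 1) ->
  (forall a b : R -> R, bmeas a -> bmeas b -> (forall x, 0 <= a x <= 1) ->
     (forall x, 0 <= b x <= 1) -> `|cut_form f g a b| <= D) ->
  uniq l -> (forall k, k \in l -> [/\ (k.1 < k.2)%N, k.1 \in s & k.2 \in s]) ->
  `|Es s (edge_prod f l) z - Es s (edge_prod g l) z| <= (size l)%:R * D.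
Proof.
move=> bf bg f01 g01 fgD ul ls.
suff H l2 l1 : uniq (l1 ++ l2) ->
    (forall k, k \in l1 ++ l2 -> [/\ (k.1 < k.2)%N, k.1 \in s & k.2 \in s]) ->
    `|Es s (fun z => edge_prod g l1 z * edge_prod f l2 z) z -
      Es s (fun z => edge_prod g l1 z * edge_prod g l2 z) z| <= (size l2)%:R * D.
  have := H l [::] ul ls; congr (`|Es s _ z - Es s _ z| <= _);
  by apply/funext => y; rewrite /edge_prod big_nil mul1r.
elim: l2 l1 => [|k l2 IH] l1 u12 s12.
  have -> : edge_prod f [::] = edge_prod g [::].
    by apply/funext => y; rewrite /edge_prod !big_nil.
  by rewrite subrr normr0 mul0r.
have kin : k \in l1 ++ k :: l2 by rewrite mem_cat mem_head orbT.
have [k12 k1s k2s] := s12 k kin.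
have := IH (rcons l1 k); rewrite cat_rcons => /(_ u12 s12) {}IH.
have rconsE h y : edge_prod g (rcons l1 k) y * edge_prod h l2 y =
    edge_prod g l1 y * (g (y k.1, y k.2) * edge_prod h l2 y).
  by rewrite /edge_prod big_rcons/= mulrA; congr (_ * _); rewrite mulrC.
have consE h y : edge_prod g l1 y * edge_prod h (k :: l2) y =
    edge_prod g l1 y * (h (y k.1, y k.2) * edge_prod h l2 y).
  by rewrite /edge_prod big_cons.
have fgs h h' : bmeas h -> bmeas h' -> smeas (fun y =>
    edge_prod g l1 y * (h (y k.1, y k.2) * edge_prod h' l2 y)).
  move=> bh bh'; apply: smeasM; first exact: smeas_edge_prod.
  by apply: smeasM; [exact: smeas_coord2|exact: smeas_edge_prod].
under Es_ext do rewrite consE.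
under [X in _ - X]Es_ext do rewrite consE.
rewrite (_ : Es s _ z - Es s _ z =
  (Es s (fun y => edge_prod g l1 y * (f (y k.1, y k.2) * edge_prod f l2 y)) z -
   Es s (fun y => edge_prod g l1 y * (g (y k.1, y k.2) * edge_prod f l2 y)) z) +
  (Es s (fun y => edge_prod g l1 y * (g (y k.1, y k.2) * edge_prod f l2 y)) z -
   Es s (fun y => edge_prod g l1 y * (g (y k.1, y k.2) * edge_prod g l2 y)) z));
  last by rewrite addrA subrK.
rewrite (le_trans (ler_normD _ _))//= -addn1 natrD mulrDl mul1r addrC lerD//.
  move: IH; congr (`|Es s _ z - Es s _ z| <= _); apply/funext => y; exact: rconsE.
rewrite -EsB; [|exact: fgs..].
pose ll := l1 ++ l2.
pose w (m : 'I_(size ll)) y := let k' := tnth (in_tuple ll) m in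
   (if (m < size l1)%N then g else f) (y k'.1, y k'.2).
have prodw y : edge_prod g l1 y * edge_prod f l2 y = \prod_m w m y.
  rewrite /edge_prod /w.
  rewrite (big_nth (0%N, 0%N)) [X in _ * X](big_nth (0%N, 0%N)).
  transitivity (\prod_(0 <= m < size ll) (if (m < size l1)%N then g else f)
     (y (nth (0%N, 0%N) ll m).1, y (nth (0%N, 0%N) ll m).2)).
    rewrite /ll size_cat [RHS](big_cat_nat (n := size l1))//= ?leq_addr//; congr (_ * _).
      rewrite !big_nat; apply: eq_bigr => m /andP[_ m1].
      by rewrite m1 nth_cat m1.
    rewrite -[X in \prod_(X <= _ < _ + _) _]add0n big_addn addKn.
    apply: eq_bigr => m _.
    by rewrite nth_cat ltnNge leq_addl/= addnK.
  by rewrite big_mkord; apply: eq_bigr => m _; rewrite (tnth_nth (0%N, 0%N)).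
rewrite (_ : (fun _ => _) = fun y => (f (y k.1, y k.2) - g (y k.1, y k.2)) *
     \prod_m w m y); last first.
  by apply/funext => y; rewrite -prodw; ring.
apply: Es_one_edge => //; first by rewrite ltn_eqF.
- by move=> m; apply: smeas_coord2; case: ifP.
- by move=> m y; rewrite /w; case: ifP.
- move=> m; set k' := tnth (in_tuple ll) m.
  have k'll : k' \in ll by exact: mem_tnth.
  have k'k : k' != k.
    apply: contraTneq k'll => ->; move: u12; rewrite -cat_rcons -cats1 -catA.
    rewrite (perm_uniq (_ : perm_eq _ (k :: ll))); last first.
      by rewrite perm_catCA.
    by case/andP.
  have [k'12 _ _] : [/\ (k'.1 < k'.2)%N, k'.1 \in s & k'.2 \in s].
    by apply: s12; move: k'll; rewrite !mem_cat inE => /orP[->|->]//; rewrite !orbT.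
  have ind i : i != k'.1 -> i != k'.2 -> indep i (w m).
    by move=> i1 i2 y x; rewrite /w -/k' !upd_neq// eq_sym.
  have [e1|n1] := eqVneq k.1 k'.1.
    right; apply: ind; first by rewrite -e1 gtn_eqF.
    by apply: contra k'k => /eqP e2; rewrite [k]surjective_pairing e1 e2 -surjective_pairing.
  have [e2|n2] := eqVneq k.1 k'.2; last by left; exact: ind.
  right; apply: ind; rewrite gtn_eqF//; last by rewrite -e2.
  by rewrite (ltn_trans k'12)// -e2.
Qed.

End counting.

Section hom_density.
Context {R : realType} (v : nat) (e : rel 'I_v).
Local Notation mu := (@lebesgue_measure R).
Implicit Types f g h : R * R -> R.

Definition edges : seq ('I_v * 'I_v) :=
  [seq ij : 'I_v * 'I_v <- index_enum _ | (ij.1 < ij.2)%N && e ij.1 ij.2].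

Definition nat_edges : seq (nat * nat) :=
  [seq (val ij.1, val ij.2) | ij <- edges].

Lemma cube_integral_ext (n : nat) (F G : n.-tuple R -> R) :
  (forall s, (forall i, tnth s i \in unit_itv) -> F s = G s) ->
  cube_integral F = cube_integral G.
Proof.
elim: n F G => [|n IH] F G FG /=; first by apply: FG => -[].
apply: eq_Rintegral => x xI; apply: IH => s sI; apply: FG => i.
by case: (unliftP ord0 i) => [j|] ->; rewrite ?tnthS ?tnth0.
Qed.

Lemma hom_density_global f z : bmeas f ->
  hom_density e f = Es (iota 0 v) (edge_prod f nat_edges) z.
Proof.
move=> bf.
have E y : edge_prod f nat_edges y =
    \prod_(ij : 'I_v * 'I_v | (ij.1 < ij.2)%N && e ij.1 ij.2)
      f (tnth [tuple y (0 + i)%N | i < v] ij.1,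
              tnth [tuple y (0 + i)%N | i < v] ij.2).
  rewrite /edge_prod /nat_edges /edges big_map big_filter.
  by apply: eq_bigr => ij _; rewrite !tnth_mktuple.
rewrite (Es_ext _ E) -(@cube_integralE _ v (fun x : v.-tuple R =>
    \prod_(ij : 'I_v * 'I_v | (ij.1 < ij.2)%N && e ij.1 ij.2)
      f (tnth x ij.1, tnth x ij.2)) 0 z)//.
rewrite (_ : (fun _ => _) = edge_prod f nat_edges); last first.
  by apply/funext => y; rewrite E.
exact: smeas_edge_prod.
Qed.

Lemma hom_density_ext f g : {in unit_sq, f =1 g} ->
  hom_density e f = hom_density e g.
Proof.
move=> fg; apply: cube_integral_ext => s sI; apply: eq_bigr => ij _.
by rewrite fg// /unit_sq in_setX/= !sI.
Qed.

Lemma hom_densityE f z : graphon f ->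
  hom_density e f = Es (iota 0 v) (edge_prod (clip f) nat_edges) z.
Proof.
move=> Gf; rewrite -hom_density_global; last exact: gg_bmeas (graphon_clip Gf).
by apply: hom_density_ext => u uI; rewrite clipE.
Qed.

Lemma mem_nat_edges k : k \in nat_edges ->
  [/\ (k.1 < k.2)%N, k.1 \in iota 0 v & k.2 \in iota 0 v].
Proof.
case/mapP => -[i j]; rewrite mem_filter /= => /andP[/andP[ij _] _] ->.
by rewrite !mem_iota /= !add0n !ltn_ord.
Qed.

Lemma uniq_nat_edges : uniq nat_edges.
Proof.
rewrite map_inj_uniq; first by apply: filter_uniq; exact: index_enum_uniq.
by move=> [i j] [i' j'] [/val_inj -> /val_inj ->].
Qed.

Lemma counting_lemma f g : graphon f -> graphon g ->
  `|hom_density e f - hom_density e g| <= (size edges)%:R * cut_dist f g.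
Proof.
move=> Gf Gg; rewrite !(hom_densityE (fun=> 0))// -(size_map (fun ij : 'I_v * 'I_v => (val ij.1, val ij.2))).
have Cf := graphon_clip Gf; have Cg := graphon_clip Gg.
apply: Es_edge_prod_diff.
- exact: gg_bmeas.
- exact: gg_bmeas.
- exact: gg_itv.
- exact: gg_itv.
- move=> a b ba bb a01 b01; have [? ?] := cut_form_le Gf Gg ba bb a01 b01.
  by rewrite ler_norml; apply/andP.
- exact: uniq_nat_edges.
- exact: mem_nat_edges.
Qed.

End hom_density.

(** * Invariance under relabelling *)

Section relabelling.
Context {R : realType}.
Local Notation mu := (@lebesgue_measure R).
Local Notation nu := (@nu R).
Local Notation nu2 := (nu \x nu)%E.
Implicit Types f g h : R * R -> R.
Implicit Types phi : R -> R.

(** With this extension, clipping commutes with relabelling on the whole plane. *)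
Definition extend_id phi (x : R) : R := if x \in unit_itv then phi x else x.

Lemma nuE (A : set R) : measurable A -> nu A = mu (A `&` unit_itv).
Proof.
move=> mA; transitivity (\int[nu]_x (\1_A x)%:E)%E.
  by rewrite integral_indic// setIT.
rewrite -ge0_integral_unit_itv//; last first.
  by apply/measurable_EFinP; exact: measurable_indic.
by rewrite integral_indic//; exact: measurable_unit_itv.
Qed.

Section fixed_bijection.
Variables (phi : R -> R) (mpb : measure_preserving_bij phi).
Local Notation phi' := (extend_id phi).

Lemma mpb_unit x : x \in unit_itv -> phi x \in unit_itv.
Proof.
by case: mpb => -[fun_phi _ _] _ _ _; rewrite !inE => /fun_phi.
Qed.

Lemma extend_id_unit x : (phi' x \in unit_itv) = (x \in unit_itv).
Proof.
rewrite /extend_id; case: ifPn => [xI|/negbTE //]; exact: mpb_unit.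
Qed.

Lemma preimage_mem_unit_itv : (fun x : R => x \in unit_itv) @^-1` [set true] = unit_itv.
Proof. by apply/seteqP; split=> x h; [exact: set_mem h|exact: mem_set h]. Qed.

Lemma measurable_extend_id : measurable_fun setT phi'.
Proof.
case: mpb => _ mphi _ _.
apply: measurable_fun_if => //.
- by apply: (measurable_fun_bool true); rewrite setTI preimage_mem_unit_itv; exact: measurable_unit_itv.
- by rewrite setTI preimage_mem_unit_itv.
Qed.

Lemma nu_extend_id (A : set R) : measurable A -> nu (phi' @^-1` A) = nu A.
Proof.
move=> mA; have [_ _ _ pres] := mpb.
have mI := @measurable_unit_itv R.
rewrite !nuE//; last by rewrite -[X in measurable X]setTI; exact: measurable_extend_id.
rewrite -(pres (A `&` unit_itv))//; last exact: measurableI.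
congr (mu _); apply/seteqP; split=> x /=.
  move=> [+ xI]; rewrite /extend_id mem_set// => Ax; split=> //; split=> //.
  by apply/set_mem/mpb_unit/mem_set.
by move=> [xI [Ax _]]; split=> //; rewrite /extend_id mem_set.
Qed.

Lemma mean_extend_id (F : R -> R) : bmeas F ->
  \int[nu]_y F (phi' y) = \int[nu]_y F y.
Proof.
move=> bF; rewrite /Rintegral; congr fine.
have mphi := measurable_extend_id.
have bF' : bmeas (fun y => F (phi' y)) by exact: (bmeas_comp bF mphi).
have := @integral_pushforward _ _ (measurableTypeR R) (measurableTypeR R) R phi' mphi nu setT (EFin \o F).
move=> /= <- //.
- apply: eq_measure_integral => A mA _; rewrite /pushforward; exact: nu_extend_id.
- by apply/measurable_EFinP; case: bF.
- exact: (bmeas_integrable nu bF').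
Qed.

Lemma Es_extend_id s (F : (nat -> R) -> R) z : smeas F ->
  Es s (fun z => F (phi' \o z)) z = Es s F (phi' \o z).
Proof.
move=> sF; elim: s z => //= i s IH z; rewrite /integ.
transitivity (\int[nu]_y Es s F (upd (phi' \o z) i (phi' y))).
  apply: eq_Rintegral => y _; rewrite IH; congr (Es s F _).
  by apply/funext => j; rewrite /upd /=; case: ifP.
rewrite (@mean_extend_id (fun y => Es s F (upd (phi' \o z) i y)))//.
by apply: smeas_upd; exact: smeas_Es.
Qed.

Lemma clip_relabel f x y : clip (relabel f phi) (x, y) = clip f (phi' x, phi' y).
Proof.
have [xy|xy] := boolP ((x, y) \in unit_sq).
  have : (phi' x, phi' y) \in unit_sq.
    by move: xy; rewrite /unit_sq !in_setX/= !extend_id_unit.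
  move=> xy'; rewrite !clipE// /relabel/= /extend_id.
  by move: xy; rewrite /unit_sq in_setX/= => /andP[-> ->].
rewrite !clip_out//; move: xy.
by rewrite /unit_sq !in_setX/= !extend_id_unit.
Qed.

Lemma graphon_relabel f : graphon f -> graphon (relabel f phi).
Proof.
move=> Gf; have [mf fsym f01] := Gf; have Cf := graphon_clip Gf.
have phiI z : z \in unit_sq -> (phi z.1, phi z.2) \in unit_sq.
  by rewrite /unit_sq !in_setX/= => /andP[? ?]; rewrite !mpb_unit.
split.
- have : measurable_fun setT (clip (relabel f phi)).
    rewrite (_ : clip _ = fun z => clip f (phi' z.1, phi' z.2)); last first.
      by apply/funext => -[x y]; exact: clip_relabel.
    apply: measurableT_comp; first exact: gg_meas.
    by apply: measurable_fun_pair; apply: measurableT_comp => //;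
       exact: measurable_extend_id.
  by move/(measurable_restrictT _ measurable_unit_sq).
- by move=> z zI; rewrite /relabel /= fsym// phiI.
- by move=> z zI; rewrite /relabel f01// phiI.
Qed.

Lemma hom_density_relabel v (e : rel 'I_v) f : graphon f ->
  hom_density e (relabel f phi) = hom_density e f.
Proof.
move=> Gf; pose z : nat -> R := fun=> 0.
rewrite (hom_densityE _ (phi' \o z) Gf) (hom_densityE _ z (graphon_relabel Gf)).
rewrite -Es_extend_id; last exact/smeas_edge_prod/gg_bmeas/graphon_clip.
apply: Es_ext => y; apply: eq_bigr => k _; exact: clip_relabel.
Qed.

Lemma L1dist_relabel f g : graphon f -> graphon g ->
  L1dist (clip (relabel f phi)) (clip (relabel g phi)) =
  L1dist (clip f) (clip g).
Proof.
move=> Gf Gg.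
have bD f' g' : graphon f' -> graphon g' -> bmeas (fun z => `|clip f' z - clip g' z|).
  by move=> Gf' Gg'; apply: bmeas_norm; apply: bmeasB; exact: gg_bmeas (graphon_clip _).
have b := bD _ _ Gf Gg; have b' := bD _ _ (graphon_relabel Gf) (graphon_relabel Gg).
rewrite /L1dist (mean_prod nu nu b) (mean_prod nu nu b').
rewrite -[RHS](@mean_extend_id (fun x => \int[nu]_y `|clip f (x, y) - clip g (x, y)|));
  last exact: (bmeas_mean nu b).
apply: eq_Rintegral => x _.
rewrite -[RHS](@mean_extend_id (fun y => `|clip f (phi' x, y) - clip g (phi' x, y)|));
  last exact: (bmeas_comp b (phi := pair (phi' x))).
by apply: eq_Rintegral => y _; rewrite !clip_relabel.
Qed.

End fixed_bijection.

Lemma mpb_id : measure_preserving_bij (@idfun R).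
Proof.
split => /=.
- by split=> //; move=> x; exists x.
- exact: measurable_id.
- by move=> A mA _; rewrite (_ : _ @` A = A)//; exact: image_id.
- by move=> A mA AI; congr (mu _); rewrite setIidr.
Qed.

Lemma relabel_id f : relabel f idfun = f.
Proof. by apply/funext => -[]. Qed.

Definition delta_values f g : set R :=
  [set cut_dist f (relabel g phi) | phi in measure_preserving_bij].

Lemma delta_values0 f g : nonempty (delta_values f g).
Proof. by exists (cut_dist f (relabel g idfun)), idfun => //; exact: mpb_id. Qed.

Lemma delta_values_ge0 f g : graphon f -> graphon g -> lbound (delta_values f g) 0.
Proof.
by move=> Gf Gg _ [phi mphi <-]; apply: cut_dist_ge0 => //; exact: graphon_relabel.
Qed.

Lemma delta_cut_ge0 f g : graphon f -> graphon g -> 0 <= delta_cut f g.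
Proof.
by move=> Gf Gg; apply: lb_le_inf; [exact: delta_values0|exact: delta_values_ge0].
Qed.

Lemma delta_cut_le f g phi : graphon f -> graphon g ->
  measure_preserving_bij phi -> delta_cut f g <= cut_dist f (relabel g phi).
Proof.
move=> Gf Gg mphi; apply: ge_inf; last by exists phi.
by exists 0; exact: delta_values_ge0.
Qed.

Lemma delta_cut_le_L1 f g : graphon f -> graphon g ->
  delta_cut f g <= L1dist (clip f) (clip g).
Proof.
move=> Gf Gg; apply: le_trans (cut_dist_le_L1 Gf Gg).
by rewrite -{2}[g]relabel_id; apply: delta_cut_le => //; exact: mpb_id.
Qed.

(** A common relabelling of g and h leaves their L1 distance unchanged, so the
    two infima can be compared relabelling by relabelling. *)
Lemma delta_cutD_L1 f g h : graphon f -> graphon g -> graphon h ->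
  delta_cut f h <= delta_cut f g + L1dist (clip g) (clip h).
Proof.
move=> Gf Gg Gh; rewrite -lerBlDr; apply: lb_le_inf; first exact: delta_values0.
move=> _ [phi mphi <-]; rewrite lerBlDr -(L1dist_relabel mphi Gg Gh).
apply: (le_trans (delta_cut_le Gf Gh mphi)).
by apply: cut_distD_L1 => //; exact: graphon_relabel.
Qed.

(** The counting lemma, applied to every relabelling of g. *)
Lemma hom_density_delta v (e : rel 'I_v) f g : graphon f -> graphon g ->
  `|hom_density e f - hom_density e g| <= (size (edges e)).+1%:R * delta_cut f g.
Proof.
move=> Gf Gg; rewrite mulrC -ler_pdivrMr ?ltr0n//.
apply: lb_le_inf; first exact: delta_values0.
move=> _ [phi mphi <-]; rewrite ler_pdivrMr ?ltr0n// mulrC.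
rewrite -(hom_density_relabel mphi e Gg).
apply: (le_trans (counting_lemma e Gf (graphon_relabel mphi Gg))).
by rewrite ler_wpM2r ?cut_dist_ge0 ?ler_nat//; exact: graphon_relabel.
Qed.

Lemma hom_density_weakly v (e : rel 'I_v) f g : graphon f -> graphon g ->
  weakly_equal f g -> hom_density e f = hom_density e g.
Proof.
move=> Gf Gg fg; apply/eqP; rewrite -subr_eq0 -normr_le0.
by rewrite (le_trans (hom_density_delta e Gf Gg))// fg mulr0.
Qed.

Lemma L1dist_ge0 f g : 0 <= L1dist f g.
Proof. exact: mean_ge0. Qed.

Lemma weakly_equal_L1 f g : graphon f -> graphon g ->
  L1dist (clip f) (clip g) = 0 -> weakly_equal f g.
Proof.
move=> Gf Gg fg; apply/eqP; rewrite eq_le delta_cut_ge0// andbT -fg.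
exact: delta_cut_le_L1.
Qed.

Lemma weakly_equal_refl f : graphon f -> weakly_equal f f.
Proof.
move=> Gf; apply: weakly_equal_L1 => //; rewrite /L1dist.
by under eq_Rintegral do rewrite subrr normr0; rewrite mean_cst.
Qed.

End relabelling.

(** * Relative entropy of Bernoulli laws *)

Section entropy.
Context {R : realType}.
Implicit Types p q u r : R.

Definition kl p u : R := u * ln (u / p) + (1 - u) * ln ((1 - u) / (1 - p)).

Lemma rel_entropyE p u : 0 < p < 1 -> rel_entropy p u = (kl p u)%:E.
Proof. by move=> /andP[p0 p1]; rewrite /rel_entropy gt_eqF// lt_eqF. Qed.

Lemma ln_le_subr1 u : 0 < u -> ln u <= u - 1.
Proof.
by move=> u0; rewrite -{1}(subrK 1 u) addrC le_ln1Dx// ltrBDr addrC subrr.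
Qed.

(** This is ln x <= x - 1 at x = sqrt (q / u). *)
Lemma ulnu_ge q u : 0 < q -> 0 <= u ->
  2 * u - 2 * (Num.sqrt q * Num.sqrt u) <= u * ln (u / q).
Proof.
move=> q0; rewrite le_eqVlt => /predU1P[<-|u0].
  by rewrite sqrtr0 !mulr0 subrr mul0r.
have sq0 : 0 < Num.sqrt q by rewrite sqrtr_gt0.
have su0 : 0 < Num.sqrt u by rewrite sqrtr_gt0.
have -> : ln (u / q) = - (2 * ln (Num.sqrt q / Num.sqrt u)).
  have -> : u / q = ((Num.sqrt q / Num.sqrt u) ^+ 2)^-1.
    by rewrite exprMn exprVn !sqr_sqrtr ?ltW// invfM invrK mulrC.
  by rewrite lnV ?lnXn ?posrE ?exprn_gt0 ?divr_gt0// mulr_natl.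
have := ln_le_subr1 (divr_gt0 sq0 su0); rewrite -(ler_pM2l u0).
have -> : u * (Num.sqrt q / Num.sqrt u - 1) = Num.sqrt q * Num.sqrt u - u.
  have {1 4}-> : u = Num.sqrt u * Num.sqrt u by rewrite -expr2 sqr_sqrtr// ltW.
  by field; rewrite gt_eqF.
by lra.
Qed.

Lemma ulnu_le q u : 0 < q -> 0 <= u -> u * ln (u / q) <= u * (u / q - 1).
Proof.
move=> q0; rewrite le_eqVlt => /predU1P[<-|u0]; first by rewrite !mul0r.
by apply: ler_wpM2l; [exact: ltW|apply: ln_le_subr1; rewrite divr_gt0].
Qed.

(** Summing [ulnu_ge] over the two atoms gives the squared Hellinger distance;
    this yields nonnegativity together with its equality case. *)
Lemma kl_ge_hellinger p u : 0 < p < 1 -> 0 <= u <= 1 ->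
  (Num.sqrt u - Num.sqrt p) ^+ 2 <= kl p u.
Proof.
move=> /andP[p0 p1] /andP[u0 u1].
have := ulnu_ge p0 u0.
have p1' : 0 < 1 - p by rewrite subr_gt0.
have u1' : 0 <= 1 - u by rewrite subr_ge0.
have := ulnu_ge p1' u1'; rewrite /kl.
have := sqr_sqrtr u0; have := sqr_sqrtr (ltW p0).
have := sqr_sqrtr u1'; have := sqr_sqrtr (ltW p1').
set a := Num.sqrt u; set b := Num.sqrt p; set c := Num.sqrt (1 - u).
set e := Num.sqrt (1 - p).
move=> ee cc bb aa; have := sqr_ge0 (c - e).
rewrite !sqrrB ee cc bb aa; lra.
Qed.

Lemma kl_ge0 p u : 0 < p < 1 -> 0 <= u <= 1 -> 0 <= kl p u.
Proof. by move=> p01 u01; rewrite (le_trans _ (kl_ge_hellinger p01 u01))// sqr_ge0. Qed.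

Lemma kl_le0 p u : 0 < p < 1 -> 0 <= u <= 1 -> kl p u <= 0 -> u = p.
Proof.
move=> p01 u01 h0; have := le_trans (kl_ge_hellinger p01 u01) h0.
move: p01 u01 => /andP[p0 p1] /andP[u0 u1].
rewrite real_exprn_even_le0 ?num_real//= subr_eq0 => /eqP su.
by rewrite -[u]sqr_sqrtr// su sqr_sqrtr// ltW.
Qed.

Lemma kl_pp p : 0 < p < 1 -> kl p p = 0.
Proof.
move=> /andP[p0 p1]; rewrite /kl !divff ?ln1 ?mulr0 ?addr0// gt_eqF// subr_gt0//.
Qed.

Lemma kl_gt0 p u : 0 < p < 1 -> 0 <= u <= 1 -> u != p -> 0 < kl p u.
Proof.
by move=> p01 u01; rewrite ltNge; apply: contra => /(kl_le0 p01 u01)/eqP.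
Qed.

Definition dkl p r : R := ln (r / p) - ln ((1 - r) / (1 - p)).

(** The gap between kl p and its tangent at r is again a relative entropy, which
    proves convexity without a second derivative. *)
Lemma kl_tangent p r u : 0 < p < 1 -> 0 < r < 1 -> 0 <= u <= 1 ->
  kl p u = kl p r + dkl p r * (u - r) + kl r u.
Proof.
move=> /andP[p0 p1] /andP[r0 r1] /andP[u0 u1].
have E (a b c : R) : 0 < a -> 0 < b -> 0 <= c ->
    c * ln (c / a) = c * ln (c / b) + c * ln (b / a).
  move=> a0 b0; rewrite le_eqVlt => /predU1P[<-|c0]; first by rewrite !mul0r addr0.
  rewrite -mulrDr -lnM ?posrE ?divr_gt0//; congr (_ * ln _).
  by rewrite mulrA divfK// gt_eqF.
rewrite /kl (E p r u)// (E (1 - p) (1 - r) (1 - u)) ?subr_gt0 ?subr_ge0//.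
by rewrite /dkl; ring.
Qed.

Lemma kl_ge_tangent p r u : 0 < p < 1 -> 0 < r < 1 -> 0 <= u <= 1 ->
  kl p r + dkl p r * (u - r) <= kl p u.
Proof. by move=> p01 r01 u01; rewrite (kl_tangent p01 r01 u01) lerDl kl_ge0. Qed.

Lemma kl_bound p u : 0 < p < 1 -> 0 <= u <= 1 -> kl p u <= p^-1 + (1 - p)^-1.
Proof.
move=> /andP[p0 p1] /andP[u0 u1].
have E (a c : R) : 0 < a -> 0 <= c <= 1 -> c * ln (c / a) <= a^-1.
  move=> a0 /andP[c0 c1]; apply: (le_trans (ulnu_le a0 c0)).
  rewrite (@le_trans _ _ (c * (c / a)))//; first by rewrite ler_wpM2l// gerBl.
  by rewrite mulrA ler_piMl ?invr_ge0 ?(ltW a0)// mulr_ile1.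
by rewrite lerD// E ?u0 ?u1 ?subr_gt0// subr_ge0 u1 gerBl.
Qed.

(** At 0 the function is squeezed by [ulnu_ge] and [ulnu_le]; to the left of 0
    it is constant because ln vanishes there. *)
Lemma continuous_ulnu q : 0 < q -> continuous (fun u : R => u * ln (u / q)).
Proof.
move=> q0 u.
have cdiv : {for u, continuous (fun u : R => u / q)}.
  by apply: continuousM; [exact: cvg_id|exact: cvg_cst].
have [u0|u0|->] := ltgtP u 0.
- rewrite /continuous_at (_ : u * _ = 0); last by rewrite ln0 ?mulr0// pmulr_lle0 ?invr_gt0// ltW.
  apply: (cvg_trans _ (@cvg_cst _ (0 : R) _ (nbhs u) _)).
  apply: near_eq_cvg; near=> y; apply/esym; rewrite /= ln0 ?mulr0// pmulr_lle0 ?invr_gt0// ltW//.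
  by near: y; exact: lt_nbhsl.
- apply: cvgM; first exact: cvg_id.
  apply: (@continuous_comp _ _ _ (fun u : R => u / q) (@ln R)) => //.
  by apply: continuous_ln; rewrite divr_gt0.
- rewrite /continuous_at mul0r.
  apply: (@squeeze_cvgr _ _ _ _ (fun u : R => - (2 * (Num.sqrt q * Num.sqrt u)) - 2 * `|u|)
     (fun u : R => u * (u / q) + `|u|)).
  + near=> y; have [y0|y0] := leP 0 y.
      have := ulnu_ge q0 y0; have := ulnu_le q0 y0.
      by rewrite ger0_norm// mulrBr mulr1 => ? ?; apply/andP; split; lra.
    rewrite ln0 ?mulr0; last by rewrite pmulr_lle0 ?invr_gt0// ltW.
    rewrite (ler0_sqrtr (ltW y0)) !mulr0 oppr0 sub0r; apply/andP; split.
      by rewrite lerNl oppr0 mulr_ge0.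
    by rewrite addr_ge0// mulrA divr_ge0 ?(ltW q0)// -expr2 sqr_ge0.
  + have : (fun u : R => - (2 * (Num.sqrt q * Num.sqrt u)) - 2 * `|u|) x @[x --> (0 : R)]
        --> - (2 * (Num.sqrt q * Num.sqrt 0)) - 2 * `|0 : R|.
      apply: cvgB.
        apply: cvgN; apply: cvgM; first exact: cvg_cst.
        by apply: cvgM; [exact: cvg_cst|exact: sqrt_continuous].
      by apply: cvgM; [exact: cvg_cst|apply: cvg_norm; exact: cvg_id].
    rewrite sqrtr0 normr0 !mulr0 oppr0 addr0; apply.
  + have : (fun u : R => u * (u / q) + `|u|) x @[x --> (0 : R)]
        --> 0 * (0 / q) + `|0 : R|.
      apply: cvgD; last by apply: cvg_norm; exact: cvg_id.
      apply: cvgM; first exact: cvg_id.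
      by apply: cvgM; [exact: cvg_id|exact: cvg_cst].
    by rewrite mul0r normr0 addr0.
Unshelve. all: by end_near. Qed.

Lemma continuous_kl p : 0 < p < 1 -> continuous (kl p).
Proof.
move=> /andP[p0 p1] u; apply: cvgD; first exact: continuous_ulnu.
apply: (@continuous_comp _ _ _ (fun u : R => 1 - u)
   (fun u : R => u * ln (u / (1 - p)))).
  by apply: cvgB; [exact: cvg_cst|exact: cvg_id].
by apply: continuous_ulnu; rewrite subr_gt0.
Qed.

Lemma measurable_kl p : measurable_fun setT (kl p).
Proof.
have E (q : R) : measurable_fun setT (fun u : R => u * ln (u / q)).
  apply: measurable_funM => //; apply: (measurableT_comp (@measurable_ln R)).
  exact: measurable_funM.
apply: measurable_funD; first exact: E.
apply: (measurableT_comp (E (1 - p))).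
exact: measurable_funB.
Qed.

Lemma is_derive_kl p u : 0 < p < 1 -> 0 < u < 1 -> is_derive u 1 (kl p) (dkl p u).
Proof.
move=> /andP[p0 p1] /andP[u0 u1].
have D (q w : R) : 0 < q -> 0 < w ->
    is_derive w 1 (fun u : R => u * ln (u / q)) (ln (w / q) + 1).
  move=> q0 w0.
  have l1 : is_derive (w / q) 1 (@ln R) (w / q)^-1.
    by apply: is_derive1_ln; rewrite divr_gt0.
  have l2 : is_derive w 1 (fun u : R => u * q^-1) q^-1.
    by apply: is_derive_eq; rewrite ?scaler0 ?add0r /GRing.scale/= mulr1.
  have l3 := @is_derive1_comp R (@ln R) (fun u => u * q^-1) w _ _ l1 l2.
  have l4 := is_deriveM (is_derive_id w 1) l3.
  apply: is_derive_eq; rewrite /GRing.scale/= mulr1 addrC; congr (_ + _).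
  by rewrite invf_div; field; rewrite !gt_eqF.
have d1 := D p u p0 u0.
have u1' : 0 < 1 - u by rewrite subr_gt0.
have p1' : 0 < 1 - p by rewrite subr_gt0.
have d2 := D (1 - p) (1 - u) p1' u1'.
have d3 : is_derive u 1 (fun u : R => 1 - u) (-1).
  by have := is_deriveB (is_derive_cst (1 : R) u 1) (is_derive_id u (1 : R)); rewrite sub0r.
have d4 := @is_derive1_comp R _ (fun u => 1 - u) u _ _ d2 d3.
have d5 := is_deriveD d1 d4.
by apply: is_derive_eq; rewrite /dkl /GRing.scale/=; ring.
Qed.

Lemma is_derive_dkl p u : 0 < p < 1 -> 0 < u < 1 ->
  is_derive u 1 (dkl p) (u^-1 + (1 - u)^-1).
Proof.
move=> /andP[p0 p1] /andP[u0 u1].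
have D (q w : R) : 0 < q -> 0 < w ->
    is_derive w 1 (fun u : R => ln (u / q)) w^-1.
  move=> q0 w0.
  have l1 : is_derive (w / q) 1 (@ln R) (w / q)^-1.
    by apply: is_derive1_ln; rewrite divr_gt0.
  have l2 : is_derive w 1 (fun u : R => u * q^-1) q^-1.
    by apply: is_derive_eq; rewrite ?scaler0 ?add0r /GRing.scale/= mulr1.
  have l3 := @is_derive1_comp R (@ln R) (fun u => u * q^-1) w _ _ l1 l2.
  by apply: is_derive_eq; rewrite invf_div; field; rewrite !gt_eqF.
have d1 := D p u p0 u0.
have u1' : 0 < 1 - u by rewrite subr_gt0.
have p1' : 0 < 1 - p by rewrite subr_gt0.
have d2 := D (1 - p) (1 - u) p1' u1'.
have d3 : is_derive u 1 (fun u : R => 1 - u) (-1).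
  by have := is_deriveB (is_derive_cst (1 : R) u 1) (is_derive_id u (1 : R)); rewrite sub0r.
have d4 := @is_derive1_comp R _ (fun u => 1 - u) u _ _ d2 d3.
have d5 := is_deriveB d1 d4.
by apply: is_derive_eq; rewrite /GRing.scale/=; ring.
Qed.

End entropy.

(** * Convex minorants on the unit interval *)

Section convexity.
Context {R : realType}.
Implicit Types (f g m : R -> R) (x y a s t : R).

Lemma unit_itvE x : (x \in unit_itv) = (0 <= x <= 1).
Proof. by rewrite /unit_itv mem_setE in_itv. Qed.

Lemma convex_functionP g : convex_function (unit_itv : set R) g <->
  (forall t x y, 0 <= t <= 1 -> 0 <= x <= 1 -> 0 <= y <= 1 ->
     g (t * x + (1 - t) * y) <= t * g x + (1 - t) * g y).
Proof.
split=> [cg t x y /andP[t0 t1] x01 y01|cg t x y].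
  have := cg (Itv01 t0 t1) x y; rewrite !unit_itvE => /(_ x01 y01).
  by rewrite /conv/= /GRing.scale/=.
rewrite !unit_itvE => x01 y01.
have := cg t%:num x y; rewrite x01 y01 => /(_ _ isT isT).
by rewrite /conv/= /GRing.scale/=; apply; apply/andP; split.
Qed.

Lemma convex_affine a s y : convex_function (unit_itv : set R) (fun x => a + s * (x - y)).
Proof. by apply/convex_functionP => t x x' _ _ _; rewrite le_eqVlt; apply/orP; left; apply/eqP; ring. Qed.

(** The slope is the supremum of the difference quotients on the left of x0. *)
Lemma supporting_line m x0 : convex_function (unit_itv : set R) m ->
  0 < x0 < 1 ->
  exists s, forall x, 0 <= x <= 1 -> m x0 + s * (x - x0) <= m x.
Proof.
move=> /convex_functionP cm /andP[x00 x01].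
have slope x y : 0 <= x < x0 -> x0 < y <= 1 ->
    (m x0 - m x) / (x0 - x) <= (m y - m x0) / (y - x0).
  move=> /andP[x0' xx0] /andP[x0y y1].
  have xy : 0 < y - x by lra.
  have t01 : 0 <= (y - x0) / (y - x) <= 1.
    by rewrite divr_ge0 ?ler_pdivrMr ?mul1r//=; lra.
  have x01' : 0 <= x <= 1 by apply/andP; split; lra.
  have y01' : 0 <= y <= 1 by apply/andP; split; lra.
  have := cm _ x y t01 x01' y01'.
  have -> : (y - x0) / (y - x) * x + (1 - (y - x0) / (y - x)) * y = x0.
    by field; rewrite gt_eqF.
  have -> : (y - x0) / (y - x) * m x + (1 - (y - x0) / (y - x)) * m y =
     ((y - x0) * m x + (x0 - x) * m y) / (y - x) by field; rewrite gt_eqF.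
  rewrite ler_pdivlMr// => cmx.
  by rewrite ler_pdivrMr ?subr_gt0// mulrAC ler_pdivlMr ?subr_gt0//; lra.
pose A := [set z | exists2 x, 0 <= x < x0 & z = (m x0 - m x) / (x0 - x)].
have A0 : nonempty A.
  by exists ((m x0 - m 0) / (x0 - 0)), 0 => //; rewrite lexx x00.
have Aub y : x0 < y <= 1 -> ubound A ((m y - m x0) / (y - x0)).
  by move=> y1 _ [x xx0 ->]; exact: slope.
exists (sup A) => x /andP[x0' x1].
have [xx0|xx0|->] := ltgtP x x0; last by rewrite subrr mulr0 addr0.
- have : (m x0 - m x) / (x0 - x) <= sup A.
    apply: ub_le_sup; last by exists x => //; rewrite x0'.
    by exists ((m 1 - m x0) / (1 - x0)); apply: Aub; rewrite x01 lexx.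
  rewrite ler_pdivrMr ?subr_gt0//; lra.
- have : sup A <= (m x - m x0) / (x - x0).
    by apply: ge_sup => //; apply: Aub; rewrite xx0.
  rewrite ler_pdivlMr ?subr_gt0//; lra.
Qed.

Definition minorizes f g := convex_function (unit_itv : set R) (g : R -> R) /\
    {in unit_itv, forall x, g x <= f x}.

(** The pointwise supremum of all convex minorants is one. *)
Lemma convex_minorant_exists f : (forall x, 0 <= x <= 1 -> 0 <= f x) ->
  exists m, is_convex_minorant f m.
Proof.
move=> f0; pose V x := [set z | exists2 g, minorizes f g & z = g x].
have zero_min : minorizes f (fun=> 0).
  split; last by move=> x; rewrite unit_itvE => /f0.
  by apply/convex_functionP => t x y _ _ _; rewrite !mulr0 addr0.
have V0 x : nonempty (V x) by exists 0, (fun=> 0).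
have Vub x : 0 <= x <= 1 -> ubound (V x) (f x).
  by move=> x01 _ [g [_ gf] ->]; apply: gf; rewrite unit_itvE.
have Vsup g x : 0 <= x <= 1 -> minorizes f g -> g x <= sup (V x).
  move=> x01 fg; apply: ub_le_sup; last by exists g.
  by exists (f x); exact: Vub.
exists (fun x => sup (V x)); split; last first.
  by move=> g fg x; rewrite unit_itvE => x01; exact: Vsup.
split; last by move=> x; rewrite unit_itvE => x01; apply: ge_sup => //; exact: Vub.
apply/convex_functionP => t x y t01 x01 y01; apply: ge_sup => //.
move=> _ [g fg ->]; have [/convex_functionP cg _] := fg.
have /andP[t0 t1] := t01.
by rewrite (le_trans (cg t x y t01 x01 y01))// lerD// ler_wpM2l ?subr_ge0// Vsup.
Qed.

End convexity.

(** * Positive continuous functions, Rolle's theorem and powers *)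

Section positivity.
Context {R : realType}.
Implicit Types (K : R -> R) (a b : R).

Lemma continuous_pos_bound K a b : a <= b -> continuous K ->
  (forall x, a <= x <= b -> 0 < K x) ->
  exists2 c, 0 < c & forall x, a <= x <= b -> c <= K x.
Proof.
move=> ab cK K0.
have [c cab Kmin] := EVT_min ab (continuous_subspaceT cK).
exists (K c); first by apply: K0; move: cab; rewrite in_itv.
by move=> x xab; apply: Kmin; rewrite in_itv.
Qed.

Lemma continuous_pos_nbhs K x : continuous K -> 0 < K x ->
  exists2 e, 0 < e & forall y, x - e <= y <= x + e -> 0 < K y.
Proof.
move=> cK Kx.
have /cvgrPdist_lt /(_ _ Kx) := cK x.
move=> /nbhs_ballP[e /= e0 xe]; exists (e / 2); first by rewrite divr_gt0.
move=> y /andP[y1 y2]; have := xe y; rewrite /= /ball/= => /(_ _).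
have /[swap] /[apply] : `|x - y| < e.
  by rewrite ltr_distlC; apply/andP; split; lra.
by move=> /(le_lt_trans (ler_norm _)); lra.
Qed.

Lemma rolle_der K (dK : R -> R) a b : a < b ->
  (forall x, a <= x <= b -> {for x, continuous K}) ->
  (forall x, a < x < b -> is_derive x 1 K (dK x)) -> K a = K b ->
  exists2 c, a < c < b & dK c = 0.
Proof.
move=> ab cK dKP Kab.
have [x||c] := @Rolle R K a b ab _ _ Kab.
- by rewrite in_itv/= => xab; have [] := dKP x xab.
- apply: continuous_in_subspaceT => x; rewrite inE/= in_itv/=; exact: cK.
- rewrite in_itv/= => cab dc; exists c => //.
  have d1 := dKP c cab.
  by have [_ <-] := d1; have [_ ->] := dc.
Qed.

Lemma min_der K (k a b c : R) : a < c < b ->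
  (forall x, a < x < b -> derivable K x 1) ->
  is_derive c 1 K k -> (forall x, a < x < b -> K c <= K x) -> k = 0.
Proof.
move=> /andP[ac cb] dK dc Kmin.
have [_ <-] := dc.
have ab : a <= b by rewrite ltW// (lt_trans ac).
have [|||_ ->] // := @derive1_at_min R K a b c ab.
- by rewrite in_itv/= ac.
Qed.

End positivity.

Section power.
Context {R : realType}.
Implicit Types u r x : R.

Lemma powR_root u d : (0 < d)%N -> 0 <= u -> (u ^+ d) `^ (d%:R^-1) = u.
Proof.
move=> d0 u0; rewrite -powR_mulrn// -powRrM mulfV ?powRr1//.
by rewrite pnatr_eq0 -lt0n.
Qed.

Lemma root_powR x d : (0 < d)%N -> 0 <= x -> (x `^ (d%:R^-1)) ^+ d = x.
Proof.
move=> d0 x0; rewrite -powR_mulrn ?powR_ge0// -powRrM mulVf ?powRr1//.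
by rewrite pnatr_eq0 -lt0n.
Qed.

Lemma exprn_01 u d : 0 <= u <= 1 -> 0 <= u ^+ d <= 1.
Proof. by move=> /andP[u0 u1]; rewrite exprn_ge0// exprn_ile1. Qed.

Lemma root_01 x d : (0 < d)%N -> 0 <= x <= 1 -> 0 <= x `^ (d%:R^-1) <= 1.
Proof.
move=> d0 /andP[x0 x1]; rewrite powR_ge0/=.
have E : (1 : R) `^ d%:R^-1 = 1 by rewrite powR1.
by rewrite -[leRHS]E ge0_ler_powR ?nnegrE ?invr_ge0.
Qed.

Lemma expr_dist_le u r d : 0 <= u <= 1 -> 0 <= r <= 1 ->
  `|u ^+ d - r ^+ d| <= d%:R * `|u - r|.
Proof.
move=> /andP[u0 u1] /andP[r0 r1].
rewrite subrXX normrM mulrC ler_wpM2r//.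
have -> : (d%:R : R) = \sum_(i < d) 1 by rewrite sumr_const card_ord.
rewrite (le_trans (ler_norm_sum _ _ _))// ler_sum// => i _.
by rewrite ger0_norm ?mulr_ge0 ?exprn_ge0// mulr_ile1 ?exprn_ge0 ?exprn_ile1.
Qed.

Lemma ltr_pXn u r d : (0 < d)%N -> 0 <= u -> u < r -> u ^+ d < r ^+ d.
Proof. by move=> d0 u0 ur; rewrite ltrXn2r// -?lt0n// ltW// (le_lt_trans u0). Qed.

Lemma ler_pXn u r d : 0 <= u -> u <= r -> u ^+ d <= r ^+ d.
Proof. by move=> u0 ur; rewrite lerXn2r// nnegrE// (le_trans u0). Qed.

Lemma expr_dist_ge u r d : (0 < d)%N -> 0 <= u -> 0 < r ->
  r ^+ d.-1 * `|u - r| <= `|u ^+ d - r ^+ d|.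
Proof.
case: d => // d _ u0 r0; rewrite subrXX normrM mulrC ler_wpM2l//=.
rewrite ger0_norm; last by apply: sumr_ge0 => i _; rewrite mulr_ge0 ?exprn_ge0// ltW.
rewrite big_ord_recr/= subnn expr0 mul1r lerDr.
by apply: sumr_ge0 => i _; rewrite mulr_ge0 ?exprn_ge0// ltW.
Qed.

End power.

(** * Entropy as a function of the d-th power *)

Section quantitative.
Context {R : realType}.
Variables (K : R -> R) (d : nat) (r : R).
Hypotheses (cK : continuous K) (r01 : 0 <= r <= 1).
Hypothesis K0 : forall u, 0 <= u <= 1 -> 0 <= K u.

(** Away from r the continuous function K is bounded below, by compactness;
    near r the gap between the powers is at most e. *)
Lemma power_gap_below (e : R) : 0 < e ->
  (forall u, 0 <= u < r -> 0 < K u) ->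
  exists2 C, 0 <= C & forall u, 0 <= u <= 1 -> r ^+ d - u ^+ d <= e + C * K u.
Proof.
move=> e0 Kpos; have /andP[r0 r1] := r01.
(* |u^d - r^d| <= d |u - r| <= e within distance h; d + 1 keeps h positive *)
pose h := e / d.+1%:R; have h0 : 0 < h by rewrite divr_gt0.
have near u : 0 <= u <= 1 -> r - h <= u -> r ^+ d - u ^+ d <= e.
  move=> u01 ru; have [ur|ur] := leP u r; last first.
    rewrite (@le_trans _ _ 0) ?(ltW e0)// subr_le0 ler_pXn// ltW//.
  have := expr_dist_le d r01 u01; move=> /(le_trans (ler_norm _)) /le_trans; apply.
  rewrite ger0_norm ?subr_ge0// (@le_trans _ _ (d%:R * h))//.
    by rewrite ler_wpM2l//; lra.
  by rewrite /h mulrCA ler_piMr ?(ltW e0)// ler_pdivrMr ?ltr0n// mul1r ler_nat.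
have [rh|rh] := ltP r h.
  exists 0 => // u u01; rewrite mul0r addr0 near//.
  by have /andP[? ?] := u01; lra.
have [||c c0 cK'] := @continuous_pos_bound R K 0 (r - h) _ cK.
- by rewrite subr_ge0.
- by move=> u /andP[u0 u1]; apply: Kpos; rewrite u0/=; lra.
exists c^-1; first by rewrite invr_ge0 ltW.
move=> u u01; have [ru|ru] := leP (r - h) u.
  by rewrite (le_trans (near u u01 ru))// lerDl mulr_ge0 ?K0// invr_ge0 ltW.
have /andP[u0 u1] := u01.
have cu : 1 <= c^-1 * K u.
  by rewrite ler_pdivlMl// mulr1 cK'// u0 ltW.
have := exprn_01 d r01; have := exprn_01 d u01.
by move=> /andP[? ?] /andP[? ?]; lra.
Qed.

Lemma power_gap_above (e : R) : 0 < e ->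
  (forall u, r < u <= 1 -> 0 < K u) ->
  exists2 C, 0 <= C & forall u, 0 <= u <= 1 -> u ^+ d - r ^+ d <= e + C * K u.
Proof.
move=> e0 Kpos; have /andP[r0 r1] := r01.
(* |u^d - r^d| <= d |u - r| <= e within distance h; d + 1 keeps h positive *)
pose h := e / d.+1%:R; have h0 : 0 < h by rewrite divr_gt0.
have near u : 0 <= u <= 1 -> u <= r + h -> u ^+ d - r ^+ d <= e.
  move=> u01 ru; have [ur|ur] := leP r u; last first.
    rewrite (@le_trans _ _ 0) ?(ltW e0)// subr_le0 ler_pXn//; last exact: ltW.
    by case/andP: u01.
  have := expr_dist_le d u01 r01; move=> /(le_trans (ler_norm _)) /le_trans; apply.
  rewrite ger0_norm ?subr_ge0// (@le_trans _ _ (d%:R * h))//.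
    by rewrite ler_wpM2l//; lra.
  by rewrite /h mulrCA ler_piMr ?(ltW e0)// ler_pdivrMr ?ltr0n// mul1r ler_nat.
have [rh|rh] := ltP 1 (r + h).
  exists 0 => // u u01; rewrite mul0r addr0 near//.
  by have /andP[? ?] := u01; lra.
have [||c c0 cK'] := @continuous_pos_bound R K (r + h) 1 _ cK.
- by [].
- by move=> u /andP[u0 u1]; apply: Kpos; rewrite u1 andbT; lra.
exists c^-1; first by rewrite invr_ge0 ltW.
move=> u u01; have [ru|ru] := leP u (r + h).
  by rewrite (le_trans (near u u01 ru))// lerDl mulr_ge0 ?K0// invr_ge0 ltW.
have /andP[u0 u1] := u01.
have cu : 1 <= c^-1 * K u.
  by rewrite ler_pdivlMl// mulr1 cK'// u1 andbT ltW.
have := exprn_01 d r01; have := exprn_01 d u01.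
by move=> /andP[? ?] /andP[? ?]; lra.
Qed.

End quantitative.

Section minorant.
Context {R : realType}.
Variables (p : R) (d : nat).
Hypotheses (p01 : 0 < p < 1) (d0 : (0 < d)%N).
Implicit Types (u r s : R) (m : R -> R).

Definition root_entropy : R -> R := fun x => kl p (x `^ (d%:R^-1)).

Lemma root_entropyE u : 0 <= u -> root_entropy (u ^+ d) = kl p u.
Proof. by move=> u0; rewrite /root_entropy powR_root. Qed.

Lemma root_entropy_minorant : exists m, is_convex_minorant root_entropy m.
Proof.
by apply: convex_minorant_exists => x x01; apply: kl_ge0 => //; exact: root_01.
Qed.

Lemma minorant_le m u : is_convex_minorant root_entropy m -> 0 <= u <= 1 ->
  m (u ^+ d) <= kl p u.
Proof.
move=> [[_ mle] _] u01; rewrite -root_entropyE; last by case/andP: u01.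
by apply: mle; rewrite unit_itvE exprn_01.
Qed.

Lemma minorant_ge_line m (a : R) s (y x : R) : is_convex_minorant root_entropy m ->
  (forall u, 0 <= u <= 1 -> a + s * (u ^+ d - y) <= kl p u) ->
  0 <= x <= 1 -> a + s * (x - y) <= m x.
Proof.
move=> [_ mmax] line x01.
apply: (mmax (fun x => a + s * (x - y))); last by rewrite unit_itvE.
split; first exact: convex_affine.
move=> z; rewrite unit_itvE => z01; have /andP[z0 z1] := z01.
by rewrite -{1}(root_powR d0 z0); apply: line; exact: root_01.
Qed.

Lemma minorant_support m r : is_convex_minorant root_entropy m -> 0 < r < 1 ->
  exists s, forall u, 0 <= u <= 1 ->
    m (r ^+ d) + s * (u ^+ d - r ^+ d) <= kl p u.
Proof.
move=> mm /andP[r0 r1]; have [[cm _] _] := mm.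
have [|s sP] := @supporting_line R m (r ^+ d) cm.
  by rewrite exprn_gt0//= exprn_ilt1 ?ltW// -lt0n.
exists s => u u01; apply: (le_trans (sP _ _)); first exact: exprn_01.
exact: minorant_le.
Qed.

(** The slope of the entropy at 1 is infinite, so that no line supports its graph
    there; lines passing below the graph by at most e at 1 are used instead. *)
Lemma entropy_near_1 (e : R) : 0 < e ->
  exists2 B, 0 <= B & forall u, 0 <= u <= 1 ->
    kl p 1 - kl p u <= e + B * (1 - u ^+ d).
Proof.
move=> e0.
have [||h h0 hP] := @continuous_pos_nbhs R (fun u => kl p u - kl p 1 + e) 1.
- move=> x; apply: cvgD; last exact: cvg_cst.
  by apply: cvgB; [exact: continuous_kl|exact: cvg_cst].
- by rewrite subrr add0r.
have h1 : 0 <= kl p 1 by rewrite kl_ge0// ler01 lexx.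
exists (kl p 1 / h); first by rewrite divr_ge0// ltW.
move=> u u01; have /andP[u0 u1] := u01.
have ud : u ^+ d <= u.
  by rewrite -[leRHS]expr1; apply: ler_wiXn2l.
have [hu|hu] := leP (1 - h) u.
  have : 0 < kl p u - kl p 1 + e by apply: hP; apply/andP; split; lra.
  have : 0 <= kl p 1 / h * (1 - u ^+ d).
    by rewrite mulr_ge0 ?divr_ge0 ?(ltW h0)//; lra.
  lra.
have : kl p 1 <= kl p 1 / h * (1 - u ^+ d).
  rewrite -mulrA ler_peMr// mulrC ler_pdivlMr// mul1r; lra.
have := kl_ge0 p01 u01; lra.
Qed.

(** The line is at most kl p p = 0 at p, and positive at r. *)
Lemma contact_slope r s : p < r <= 1 ->
  (forall u, 0 <= u <= 1 -> kl p r + s * (u ^+ d - r ^+ d) <= kl p u) -> 0 < s.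
Proof.
move=> /andP[pr r1] line; have /andP[p0 p1] := p01.
have p01' : 0 <= p <= 1 by rewrite !ltW.
have := line p p01'; rewrite kl_pp//.
have : 0 < kl p r.
  by rewrite kl_gt0// ?gt_eqF// r1 ltW// (lt_trans p0).
have : p ^+ d < r ^+ d by apply: ltr_pXn => //; exact: ltW.
move=> pdrd hr; rewrite -mulrN1 => h.
have : 0 < s * (r ^+ d - p ^+ d) by lra.
by rewrite pmulr_lgt0// subr_gt0.
Qed.

(** At three contact points the gap K and at the first two also K' would vanish,
    so by Rolle K'' would have three zeros in (0,1).  Up to the factor u (1 - u),
    K'' is 1 - c u^(d-1) (1 - u), and a level of u^(d-1) (1 - u) is taken at most
    twice because its derivative has a single zero in (0,1). *)
Lemma no_three_contacts r s u1 u2 : p < r < 1 ->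
  (forall u, 0 <= u <= 1 -> kl p r + s * (u ^+ d - r ^+ d) <= kl p u) ->
  0 <= u1 < r -> r < u2 <= 1 ->
  kl p u1 = kl p r + s * (u1 ^+ d - r ^+ d) ->
  kl p u2 = kl p r + s * (u2 ^+ d - r ^+ d) -> False.
Proof.
move=> /andP[pr r1] line /andP[u10 u1r] /andP[ru2 u21] E1 E2.
have /andP[p0 p1] := p01.
have s0 : 0 < s by apply: (@contact_slope r) => //; rewrite pr ltW.
pose K u := kl p u - (kl p r + s * (u ^+ d - r ^+ d)).
pose K1 u := dkl p u - s * (d%:R * u ^+ d.-1).
have Kge0 u : 0 <= u <= 1 -> 0 <= K u by move=> /line; rewrite subr_ge0.
have dpow n (u : R) : is_derive u 1 (fun u : R => u ^+ n) (n%:R * u ^+ n.-1).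
  have := @is_deriveX R R id n u 1 1 (is_derive_id u 1).
  by rewrite exprfctE /GRing.scale/= mulr1.
have cpow n : continuous (fun u : R => u ^+ n) by move=> u; exact: exprn_continuous.
have cK : continuous K.
  move=> u; apply: cvgB; first exact: continuous_kl.
  apply: cvgD; first exact: cvg_cst.
  apply: cvgM; first exact: cvg_cst.
  by apply: cvgB; [exact: cpow|exact: cvg_cst].
have dK u : 0 < u < 1 -> is_derive u 1 K (K1 u).
  move=> u01; have h1 := is_derive_kl p01 u01.
  have h2 := dpow d u.
  have h3 := is_deriveB h2 (is_derive_cst (r ^+ d) u (1 : R)).
  have h4 := is_deriveZ s h3.
  have h5 := is_deriveD (is_derive_cst (kl p r) u (1 : R)) h4.
  have h6 := is_deriveB h1 h5.
  by apply: is_derive_eq; rewrite /K1 /GRing.scale/= subr0 add0r.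
(* an increasing line lying below the entropy is negative on [0,p) *)
have u1p : p <= u1.
  rewrite leNgt; apply/negP => u1p.
  have p01' : 0 <= p <= 1 by rewrite !ltW.
  have := line p p01'; rewrite kl_pp// => hline.
  have : 0 <= kl p u1 by rewrite kl_ge0// u10; lra.
  rewrite E1 => h1.
  have : u1 ^+ d < p ^+ d by exact: ltr_pXn.
  rewrite -subr_gt0 -(pmulr_rgt0 _ s0); lra.
have u1pos : 0 < u1 by lra.
(* u1 and r are interior minima of K, where K vanishes *)
have K1_u1 : K1 u1 = 0.
  have u1in : 0 < u1 < 1 by rewrite u1pos; lra.
  apply: (min_der u1in _ (dK _ u1in)); first by move=> x /dK[].
  move=> x /andP[x0 x1]; rewrite {1}/K E1 subrr Kge0// !ltW//.
have K1_r : K1 r = 0.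
  have rin : 0 < r < 1 by rewrite r1 andbT; lra.
  apply: (min_der rin _ (dK _ rin)); first by move=> x /dK[].
  by move=> x /andP[x0 x1]; rewrite {1}/K subrr mulr0 addr0 subrr Kge0// !ltW.
have Kr : K r = 0 by rewrite /K subrr mulr0 addr0 subrr.
have K_u1 : K u1 = 0 by rewrite /K E1 subrr.
have K_u2 : K u2 = 0 by rewrite /K E2 subrr.
have [|||x1 /andP[ux1 x1r] Kx1] := @rolle_der R K K1 u1 r u1r.
- by move=> x _; exact: cK.
- by move=> x /andP[? ?]; apply: dK; apply/andP; split; lra.
- by rewrite K_u1 Kr.
have [|||x2 /andP[rx2 x2u] Kx2] := @rolle_der R K K1 r u2 ru2.
- by move=> x _; exact: cK.
- by move=> x /andP[? ?]; apply: dK; apply/andP; split; lra.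
- by rewrite K_u2 Kr.
pose K2 u := u^-1 + (1 - u)^-1 - s * (d%:R * (d.-1%:R * u ^+ d.-2)).
have dK1 u : 0 < u < 1 -> is_derive u 1 K1 (K2 u).
  move=> u01; have h1 := is_derive_dkl p01 u01.
  have h2 := dpow d.-1 u.
  have h3 := is_deriveZ s (is_deriveZ d%:R h2).
  have h6 := is_deriveB h1 h3.
  by apply: is_derive_eq.
have cK1 u : 0 < u < 1 -> {for u, continuous K1}.
  move=> /dK1[du _]; apply: differentiable_continuous; exact/derivable1_diffP.
have rolle2 a b : 0 < a -> a < b -> b < 1 -> K1 a = 0 -> K1 b = 0 ->
    exists2 c, a < c < b & K2 c = 0.
  move=> a0 ab b1 Ka Kb; apply: (@rolle_der R K1 K2 a b ab).
  - by move=> x /andP[? ?]; apply: cK1; apply/andP; split; lra.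
  - by move=> x /andP[? ?]; apply: dK1; apply/andP; split; lra.
  - by rewrite Ka Kb.
have [|y1 /andP[uy1 y1x] Ky1] := rolle2 u1 x1 u1pos ux1 _ K1_u1 Kx1; first lra.
have [|y2 /andP[xy2 y2r] Ky2] := rolle2 x1 r _ x1r r1 Kx1 K1_r; first lra.
have [||y3 /andP[ry3 y3x] Ky3] := rolle2 r x2 _ rx2 _ K1_r Kx2; [lra..|].
pose c := s * (d%:R * d.-1%:R).
pose w u := u ^+ d.-1 * (1 - u).
have K2w u : 0 < u < 1 -> K2 u = 0 -> c * w u = 1.
  move=> /andP[u0 u1']; rewrite /K2 /c /w.
  have un0 : u != 0 by rewrite gt_eqF.
  have un1 : 1 - u != 0 by rewrite subr_eq0 gt_eqF.
  have -> : u^-1 + (1 - u)^-1 = (u * (1 - u))^-1 by field; rewrite un0 un1.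
  case: (d) d0 => // -[|n] _ /=.
    rewrite mul0r !mulr0 subr0 => /eqP; rewrite invr_eq0 mulf_eq0.
    by rewrite (negbTE un0) (negbTE un1).
  move=> /eqP; rewrite subr_eq0 => /eqP E.
  rewrite exprS.
  transitivity (u * (1 - u) * (s * (n.+2%:R * (n.+1%:R * u ^+ n)))); first by ring.
  by rewrite -E mulfV// mulf_neq0.
have w1 := K2w y1 _ Ky1; have w2 := K2w y2 _ Ky2; have w3 := K2w y3 _ Ky3.
have {}w1 : c * w y1 = 1 by apply: w1; apply/andP; split; lra.
have {}w2 : c * w y2 = 1 by apply: w2; apply/andP; split; lra.
have {}w3 : c * w y3 = 1 by apply: w3; apply/andP; split; lra.
have c0 : c != 0 by apply: contra_eq_neq w1 => ->; rewrite mul0r eq_sym oner_eq0.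
have d2 : (1 < d)%N.
  by move: c0; rewrite /c; case: (d) d0 => // -[|n] //= _; rewrite !mulr0 eqxx.
pose dw (u : R) := d.-1%:R * u ^+ d.-2 * (1 - u) + u ^+ d.-1 * (-1).
have dwP u : is_derive u 1 w (dw u).
  have h1 := dpow d.-1 u.
  have h2 := is_deriveB (is_derive_cst (1 : R) u 1) (is_derive_id u (1 : R)).
  have h3 := is_deriveM h1 h2.
  apply: is_derive_eq; rewrite /dw /GRing.scale/= sub0r.
  by rewrite (_ : (cst 1 - id) u = 1 - u)//; ring.
have cw u : {for u, continuous w}.
  by have [du _] := dwP u; apply: differentiable_continuous; exact/derivable1_diffP.
have weq a b : c * w a = 1 -> c * w b = 1 -> w a = w b.
  by move=> wa wb; apply: (mulfI c0); rewrite wa wb.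
have y12 : y1 < y2 by lra.
have y23 : y2 < y3 by lra.
have [||z1 /andP[yz1 z1y] wz1] := @rolle_der R w dw y1 y2 y12.
- by move=> x _; exact: cw.
- exact: weq.
have [||z2 /andP[yz2 z2y] wz2] := @rolle_der R w dw y2 y3 y23.
- by move=> x _; exact: cw.
- exact: weq.
have root u : 0 < u -> dw u = 0 -> d%:R * u = d.-1%:R.
  move=> u0; rewrite /dw; case: (d) d2 => // -[|n] // _ /=.
  rewrite exprS => /eqP E.
  have : u ^+ n * (n.+1%:R - n.+2%:R * u) = 0.
    rewrite -(eqP E) -[n.+2%:R](natr1 n.+1); ring.
  move=> /eqP; rewrite mulf_eq0 expf_eq0 (gt_eqF u0) andbF /= subr_eq0.
  by move=> /eqP ->.
have := root z1 _ wz1; have := root z2 _ wz2.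
move=> /(_ _)<- //; last by lra.
move=> /(_ _) h; have : z1 = z2.
  apply: (mulfI (_ : d%:R != 0 :> R)); last by apply: h; lra.
  by rewrite pnatr_eq0 -lt0n.
lra.
Qed.

End minorant.

Section entropy_stability.
Context {R : realType}.
Variables (p : R) (d : nat) (r : R).
Hypotheses (p01 : 0 < p < 1) (d0 : (0 < d)%N) (pr1 : p <= r <= 1).

Let r01 : 0 <= r <= 1.
Proof. by move: p01 pr1 => /andP[? ?] /andP[? ?]; apply/andP; split; lra. Qed.

Lemma continuous_gap a s : continuous (fun u : R => kl p u - (a + s * (u ^+ d - r ^+ d))).
Proof.
move=> u; apply: cvgB; first exact: continuous_kl.
apply: cvgD; first exact: cvg_cst.
apply: cvgM; first exact: cvg_cst.
by apply: cvgB; [exact: exprn_continuous|exact: cvg_cst].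
Qed.

(** Integrated over a graphon, the factor of A is its excess of entropy over f_r
    and the factor of -B its excess of d-th moment, so the left side is small for
    nearly optimal graphons.

    Let K be the gap above the supporting line.  As r^d is not strictly between
    two other contact points, K controls the negative or the positive part of
    u^d - r^d up to eps; the absolute value is obtained from it by adding or
    subtracting u^d - r^d, a multiple of which the line also contributes. *)
Lemma entropy_stability : on_convex_minorant (root_entropy p d) (r ^+ d) (kl p r) ->
  forall e : R, 0 < e -> exists A B : R, [/\ 1 <= A, 0 <= B, r = p -> B = 0 &
    forall u, 0 <= u <= 1 -> `|u ^+ d - r ^+ d| <=
      e + A * (kl p u - kl p r) - B * (u ^+ d - r ^+ d)].
Proof.
move=> [m mm mr] e e0; have /andP[p0 p1] := p01; have /andP[pr r1] := pr1.
have norm_below u C x : r ^+ d - u ^+ d <= C -> u ^+ d - r ^+ d + 2 * C = x -> 0 <= C ->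
    `|u ^+ d - r ^+ d| <= x.
  by move=> h <- C0; rewrite ler_norml; apply/andP; split; lra.
have norm_above u C x : u ^+ d - r ^+ d <= C -> r ^+ d - u ^+ d + 2 * C = x -> 0 <= C ->
    `|u ^+ d - r ^+ d| <= x.
  by move=> h <- C0; rewrite ler_norml; apply/andP; split; lra.
have e2 : 0 < e / 2 by rewrite divr_gt0.
have [rp|rp] := eqVneq r p.
  have hpr0 : kl p r = 0 by rewrite rp kl_pp.
  have hpos u : 0 <= u <= 1 -> u != r -> 0 < kl p u.
    by move=> u01 ur; rewrite kl_gt0// -rp.
  have hge u : 0 <= u <= 1 -> 0 <= kl p u by exact: kl_ge0.
  have [|C1 C10 C1P] := power_gap_below d (continuous_kl p01) r01 hge e0.
    move=> u /andP[u0 ur]; apply: hpos; last by rewrite lt_eqF.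
    by rewrite u0; lra.
  have [|C2 C20 C2P] := power_gap_above d (continuous_kl p01) r01 hge e0.
    move=> u /andP[u0 ur]; apply: hpos; last by rewrite gt_eqF.
    by rewrite ur andbT; move/andP: r01 => [? ?]; lra.
  exists (C1 + C2 + 1), 0; split=> //; first lra.
  move=> u u01; rewrite mul0r subr0 hpr0 subr0.
  have := C1P u u01; have := C2P u u01; have h0 := hge u u01.
  have := mulr_ge0 C10 h0; have := mulr_ge0 C20 h0 => ? ? ? ?.
  by rewrite ler_norml; apply/andP; split; lra.
have {}rp : p < r by rewrite lt_neqAle eq_sym rp.
have rne (B : R) : r = p -> B = 0 by move=> E; rewrite E ltxx in rp.
have [r_1|r_1] := eqVneq r 1.
  have [B B0 BP] := entropy_near_1 p01 d0 e0.
  exists 1, (B + 1); split=> //; [lra|exact: rne|].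
  move=> u u01; have := BP u u01; rewrite r_1 expr1n.
  have /andP[ud0 ud1] := exprn_01 d u01.
  by rewrite ler0_norm; lra.
have {}r_1 : r < 1 by rewrite lt_neqAle r_1.
have [|s sP] := minorant_support d0 (r := r) mm.
  by rewrite r_1 andbT (lt_trans p0).
rewrite mr in sP.
have s0 : 0 < s by apply: (contact_slope p01 d0 (r := r)) => //; rewrite rp.
pose K u := kl p u - (kl p r + s * (u ^+ d - r ^+ d)).
have cK : continuous K by exact: continuous_gap.
have K0 u : 0 <= u <= 1 -> 0 <= K u by move=> /sP; rewrite subr_ge0.
have [below|] := pselect (forall u, 0 <= u < r -> 0 < K u).
  have [C C0 CP] := power_gap_below d cK r01 K0 e2 below.
  (* enlarging C to C' makes 2 C' s - 1 nonnegative; K >= 0 allows it *)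
  pose C' := C + s^-1 + 1.
  have si0 : 0 < s^-1 by rewrite invr_gt0.
  have C's : 2 * (C' * s) = 2 * C * s + 2 + 2 * s.
    by rewrite /C'; field; rewrite gt_eqF.
  exists (2 * C'), (2 * (C' * s) - 1); split; [rewrite /C'; lra| |exact: rne|].
    by rewrite C's; have := mulr_ge0 C0 (ltW s0); lra.
  move=> u u01; apply: (norm_below u (e / 2 + C' * K u)).
  - rewrite (le_trans (CP u u01))// lerD2l ler_wpM2r ?K0// /C'; lra.
  - by rewrite /K; field.
  - by rewrite addr_ge0 ?(ltW e2)// mulr_ge0 ?K0// /C'; lra.
move=> /existsNP[u1 /not_implyP[u1r /negP]]; rewrite -leNgt => Ku1.
have above u : r < u <= 1 -> 0 < K u.
  move=> ru1; rewrite lt_neqAle K0 ?andbT; last first.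
    by move/andP: ru1 => [? ->]; rewrite andbT (le_trans (ltW p0))//; lra.
  apply/eqP => Ku0.
  apply: (@no_three_contacts R p d p01 d0 r s u1 u) => //.
  - by rewrite rp.
  - apply/eqP; rewrite eq_le -subr_le0 Ku1 sP//.
    by move/andP: u1r => [-> ?]/=; lra.
  - by move/eqP: Ku0; rewrite eq_sym subr_eq0 => /eqP.
have [C C0 CP] := power_gap_above d cK r01 K0 e2 above.
exists (2 * C + 1), (1 + (2 * C + 1) * s); split; [lra| |exact: rne|].
  by rewrite addr_ge0// mulr_ge0 ?(ltW s0)//; lra.
move=> u u01; apply: (norm_above u (e / 2 + (C + 2^-1) * K u)).
- by rewrite (le_trans (CP u u01))// lerD2l ler_wpM2r ?K0//; lra.
- by rewrite /K; field.
- by rewrite addr_ge0 ?(ltW e2)// mulr_ge0 ?K0//; lra.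
Qed.

(** The line supports the convex minorant at r^d.  If it had no contact with the
    graph on one side of r^d, it could be tilted upwards about a point w^d on the
    other side of r^d and would exceed the minorant at r^d. *)
Lemma bitangent : ~ on_convex_minorant (root_entropy p d) (r ^+ d) (kl p r) ->
  exists s u1 u2 : R, [/\ p < r < 1, 0 <= u1 < r, r < u2 <= 1, 0 <= s &
    exists a, [/\ forall u, 0 <= u <= 1 -> a + s * (u ^+ d - r ^+ d) <= kl p u,
     kl p u1 = a + s * (u1 ^+ d - r ^+ d),
     kl p u2 = a + s * (u2 ^+ d - r ^+ d) & a < kl p r]].
Proof.
move=> noton; have /andP[p0 p1] := p01; have /andP[pr r1] := pr1.
have [m mm] := root_entropy_minorant p01 d0.
have mle u : 0 <= u <= 1 -> m (u ^+ d) <= kl p u by exact: minorant_le.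
have mne : m (r ^+ d) != kl p r by apply/eqP => E; apply: noton; exists m.
have mlt : m (r ^+ d) < kl p r by rewrite lt_neqAle mne mle.
have rd01 := exprn_01 d r01.
have rp : p < r.
  rewrite lt_neqAle pr andbT; apply: contraTneq mlt => E.
  rewrite -leNgt -E kl_pp//.
  have := minorant_ge_line d0 (a := 0) (s := 0) (y := 0) (x := r ^+ d) mm.
  rewrite -E mul0r addr0; apply; last by apply: exprn_01; rewrite !ltW.
  by move=> u u01; rewrite mul0r addr0 kl_ge0.
have r_1 : r < 1.
  rewrite lt_neqAle r1 andbT; apply: contraTneq mlt => E; rewrite E expr1n -leNgt.
  apply/ler_addgt0Pr => e e0; have [B B0 BP] := entropy_near_1 p01 d0 e0.
  have := minorant_ge_line d0 (a := kl p 1 - e) (s := B) (y := 1) (x := 1) mm.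
  rewrite subrr mulr0 addr0 ler01 lexx lerBlDr; apply=> // u u01.
  by have := BP u u01; lra.
have r0 : 0 < r by rewrite (lt_trans p0).
have [|s sP] := minorant_support d0 (r := r) mm; first by rewrite r0.
set a := m (r ^+ d) in sP mlt.
pose K u := kl p u - (a + s * (u ^+ d - r ^+ d)).
have cK : continuous K by exact: continuous_gap.
have K0 u : 0 <= u <= 1 -> 0 <= K u by move=> /sP; rewrite subr_ge0.
have Kr : 0 < K r by rewrite /K subrr mulr0 addr0 subr_gt0.
have [h h0 hP] := continuous_pos_nbhs cK Kr.
have tilt (s' b : R) : (forall u, 0 <= u <= 1 -> b + s' * (u ^+ d - r ^+ d) <= kl p u) ->
    b <= a.
  move=> bP; have := minorant_ge_line d0 (x := r ^+ d) mm bP rd01.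
  by rewrite subrr mulr0 addr0.
have Keq u : 0 <= u <= 1 -> ~ (0 < K u) -> kl p u = a + s * (u ^+ d - r ^+ d).
  move=> u01 /negP; rewrite -leNgt => Ku; apply/eqP; rewrite eq_le sP// andbT.
  by move: Ku; rewrite subr_le0.
have [u2 u2r1 Ku2] : exists2 u2, r < u2 <= 1 & ~ (0 < K u2).
  apply: contrapT => no.
  pose w := Num.max 0 (r - h).
  have wr : w < r by rewrite /w gt_max r0/=; lra.
  have w0 : 0 <= w by rewrite /w le_max lexx.
  have [||c c0 cP] := @continuous_pos_bound R K w 1 _ cK.
  - lra.
  - move=> u /andP[wu u1]; have [ur|ur] := leP u r.
      apply: hP; apply/andP; split; last by lra.
      by rewrite (le_trans _ wu)// /w le_max lexx orbT.
    by apply: contrapT => Ku; apply: no; exists u => //; rewrite ur.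
  suff : a + c * (r ^+ d - w ^+ d) <= a.
    by rewrite gerDl pmulr_rle0// subr_le0 leNgt ltr_pXn.
  apply: (tilt (s + c)) => u u01; have /andP[u0 u1] := u01.
  have wd : w ^+ d <= r ^+ d by rewrite ler_pXn// ltW.
  have /andP[ud0 ud1] := exprn_01 d u01.
  have wd0 : 0 <= w ^+ d by rewrite exprn_ge0.
  have [wu|wu] := leP w u.
    have h1 : c <= K u by rewrite cP// wu.
    have : c * (u ^+ d - w ^+ d) <= c by rewrite ler_piMr ?(ltW c0)//; lra.
    by move: h1; rewrite /K; lra.
  have : c * (u ^+ d - w ^+ d) <= 0.
    by rewrite pmulr_rle0// subr_le0 ler_pXn// ltW.
  by have := sP u u01; lra.
have [u1 u1r Ku1] : exists2 u1, 0 <= u1 < r & ~ (0 < K u1).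
  apply: contrapT => no.
  pose w := Num.min 1 (r + h).
  have wr : r < w by rewrite /w lt_min r_1/=; lra.
  have w1 : w <= 1 by rewrite /w ge_min lexx.
  have [||c c0 cP] := @continuous_pos_bound R K 0 w _ cK.
  - lra.
  - move=> u /andP[u0 wu]; have [ur|ur] := leP r u.
      apply: hP; apply/andP; split; first by lra.
      by rewrite (le_trans wu)// /w ge_min lexx orbT.
    by apply: contrapT => Ku; apply: no; exists u => //; rewrite u0.
  suff : a + c * (w ^+ d - r ^+ d) <= a.
    by rewrite gerDl pmulr_rle0// subr_le0 leNgt ltr_pXn// ltW.
  apply: (tilt (s - c)) => u u01; have /andP[u0 u1] := u01.
  have wd : r ^+ d <= w ^+ d by rewrite ler_pXn// ltW.
  have /andP[ud0 ud1] := exprn_01 d u01.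
  have wd0 : w ^+ d <= 1 by rewrite exprn_ile1//; lra.
  have [wu|wu] := leP u w.
    have h1 : c <= K u by rewrite cP// u0.
    have : c * (w ^+ d - u ^+ d) <= c by rewrite ler_piMr ?(ltW c0)//; lra.
    by move: h1; rewrite /K; lra.
  have : c * (w ^+ d - u ^+ d) <= 0.
    rewrite pmulr_rle0// subr_le0 ler_pXn// ?(ltW wu)//; lra.
  by have := sP u u01; lra.
have u101 : 0 <= u1 <= 1 by move/andP: u1r => [-> ?]/=; lra.
have u201 : 0 <= u2 <= 1 by move/andP: u2r1 => [? ->]; rewrite andbT; lra.
have E1 := Keq u1 u101 Ku1; have E2 := Keq u2 u201 Ku2.
exists s, u1, u2; split=> //; [by rewrite rp| |by exists a].
have h1 := kl_ge0 p01 u101; have h2 := kl_ge0 p01 u201.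
have p01' : 0 <= p <= 1 by rewrite !ltW.
have hpl := sP p p01'; rewrite kl_pp// in hpl.
have pd : p ^+ d < r ^+ d by rewrite ltr_pXn// ltW.
rewrite leNgt; apply/negP => sneg.
have u2d : r ^+ d < u2 ^+ d by rewrite ltr_pXn ?(ltW r0)//; case/andP: u2r1.
have : 0 < s * (p ^+ d - r ^+ d) by rewrite nmulr_rgt0// subr_lt0.
have : s * (u2 ^+ d - r ^+ d) < 0 by rewrite nmulr_rlt0// subr_gt0.
by move: h2; rewrite E2; lra.
Qed.

End entropy_stability.

(** * Hoelder's inequality for regular bipartite graphs *)

Section holder.
Context {R : realType}.
Local Notation nu := (@nu R).

Lemma prod_le_mean_powers (I : finType) (A : {pred I}) (y : I -> R) :
  (0 < #|A|)%N -> (forall i, 0 <= y i) ->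
  \prod_(i in A) y i <= #|A|%:R^-1 * \sum_(i in A) y i ^+ #|A|.
Proof.
move=> A0 y0; set n := #|A|.
have n0 : 0 < n%:R :> R by rewrite ltr0n.
have := @leif_AGM R I A (fun i => y i ^+ n).
move=> /(_ (fun i _ => exprn_ge0 _ (y0 i)))[+ _].
rewrite prodrXl mulrC -/n ler_pXn2r// nnegrE ?prodr_ge0//.
by rewrite mulr_ge0 ?invr_ge0// sumr_ge0// => i _; rewrite exprn_ge0.
Qed.

(** The arithmetic-geometric mean inequality is applied to the g_i divided by
    their norms; adding e to the integrals keeps these norms positive. *)
Lemma holder_prod (I : finType) (A : {pred I}) (w : R -> R) (g : I -> R -> R) (e : R) :
  (0 < #|A|)%N -> 0 < e -> bmeas w -> (forall x, 0 <= w x) ->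
  (forall i, bmeas (g i)) -> (forall i x, 0 <= g i x) ->
  \int[nu]_x (w x * \prod_(i in A) g i x) <=
  \prod_(i in A) (\int[nu]_x (w x * g i x ^+ #|A|) + e) `^ (#|A|%:R^-1).
Proof.
move=> A0 e0 bw w0 bg g0; set n := #|A|.
pose Phi i := \int[nu]_x (w x * g i x ^+ n).
pose t i := (Phi i + e) `^ (n%:R^-1).
have bwg i : bmeas (fun x => w x * g i x ^+ n) by apply: bmeasM => //; exact: bmeasX.
have Phi0 i : 0 <= Phi i by apply: mean_ge0 => x; rewrite mulr_ge0// exprn_ge0.
have Pe0 i : 0 < Phi i + e by rewrite ltr_wpDl.
have t0 i : 0 < t i by rewrite powR_gt0.
have tn i : t i ^+ n = Phi i + e.
  rewrite -powR_mulrn ?powR_ge0// -powRrM mulVf; last by rewrite pnatr_eq0 -lt0n.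
  by rewrite powRr1// ltW.
have n0 : 0 < n%:R :> R by rewrite ltr0n.
pose C := \prod_(i in A) t i.
have C0 : 0 <= C by apply: prodr_ge0 => i _; exact: ltW.
rewrite -/C.
apply: (@le_trans _ _ (\int[nu]_x (\sum_(i in A) (C * n%:R^-1 * (t i ^+ n)^-1) *
    (w x * g i x ^+ n)))).
  apply: le_mean.
  - by apply: bmeasM => //; apply: bmeas_prod => i _; exact: bg.
  - by apply: bmeas_sum => i _; apply: bmeasM; [exact: bmeas_cst|exact: bwg].
  - move=> x.
    have -> : \prod_(i in A) g i x = C * \prod_(i in A) (g i x / t i).
      by rewrite /C -big_split; apply: eq_bigr => i _ /=; rewrite mulrC divfK// gt_eqF.
    have h : \prod_(i in A) (g i x / t i) <= n%:R^-1 * \sum_(i in A) (g i x / t i) ^+ n.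
      by apply: prod_le_mean_powers => // i; rewrite divr_ge0// ltW.
    rewrite (le_trans (ler_wpM2l (w0 x) (ler_wpM2l C0 h)))// !mulr_sumr.
    by rewrite ler_sum// => i _; rewrite expr_div_n le_eqVlt; apply/orP; left; apply/eqP; ring.
rewrite mean_sum; last by move=> i _; apply: bmeasM; [exact: bmeas_cst|exact: bwg].
rewrite (eq_bigr (fun i => C * n%:R^-1 * (t i ^+ n)^-1 * Phi i)); last first.
  by move=> i _; rewrite meanZ//; exact: bwg.
apply: (@le_trans _ _ (\sum_(i in A) C * n%:R^-1)).
  apply: ler_sum => i _; rewrite -[leRHS]mulr1 -mulrA.
  rewrite ler_wpM2l ?mulr_ge0 ?invr_ge0//.
  by rewrite tn ler_pdivrMl// mulr1 lerDl ltW.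
by rewrite sumr_const -[leLHS]mulr_natr divfK ?gt_eqF.
Qed.

End holder.

Section colouring.
Context {R : realType} (gam : R) (gam01 : 0 < gam < 1).
Local Notation mu := (@lebesgue_measure R).
Local Notation nu := (@nu R).

(** The colour true stands for [0,gam] and the colour false for (gam,1]. *)
Definition part (k : bool) (x : R) : R := ((x <= gam) == k)%:R.

Lemma part_itv k x : 0 <= part k x <= 1.
Proof. by rewrite /part; case: eqP; rewrite /= ?ler01 ?lexx. Qed.

Lemma sum_part x : \sum_(k : bool) part k x = 1.
Proof. by rewrite big_bool /part; case: (x <= gam); rewrite /= ?addr0 ?add0r. Qed.

Lemma part_true : part true = \1_[set` `]-oo, gam]] :> (R -> R).
Proof.
apply/funext => x; rewrite /part indicE eqb_id; congr ((_ : bool)%:R).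
by apply/idP/idP; rewrite ?inE/= ?in_itv//=.
Qed.

Lemma part_false x : part false x = 1 - part true x.
Proof. by rewrite /part; case: (x <= gam); rewrite /= ?subrr ?subr0. Qed.

Lemma bmeas_part k : bmeas (part k).
Proof.
have bt : bmeas (part true).
  by rewrite part_true; apply: bmeas_indic; exact: measurable_itv.
case: k => //; rewrite (_ : part false = fun x => 1 - part true x).
  by apply: bmeasB => //; exact: bmeas_cst.
by apply/funext => x; rewrite part_false.
Qed.

Lemma mean_part_true : \int[nu]_x part true x = gam.
Proof.
have /andP[g0 g1] := gam01.
transitivity (fine (nu `]-oo, gam]%classic)).
  by rewrite part_true /Rintegral integral_indic// setIT.
rewrite nuE; last exact: measurable_itv.
rewrite (_ : _ `&` _ = `[0, gam]%classic).
  by rewrite lebesgue_measure_itv/= lte_fin g0 oppr0 adde0.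
apply/seteqP; split=> x; rewrite /unit_itv /= !in_itv/=.
  by move=> [xg /andP[x0 x1]]; rewrite x0.
by move=> /andP[x0 xg]; rewrite xg x0 (le_trans xg) ?ltW.
Qed.

Lemma mean_part_false : \int[nu]_x part false x = 1 - gam.
Proof.
under eq_Rintegral do rewrite part_false.
rewrite meanB; [|exact: bmeas_cst|exact: bmeas_part].
by rewrite mean_cst mean_part_true.
Qed.

Definition off_supported (h : R * R -> R) : Prop :=
  forall x y, (x <= gam) == (y <= gam) -> h (x, y) = 0.

Variables (v d : nat) (e : rel 'I_v).
Hypotheses (se : simple_graph e) (d0 : (0 < d)%N) (re : regular_graph e d).

Definition proper (c : {ffun 'I_v -> bool}) : bool :=
  [forall i, forall j, e i j ==> (c i != c j)].

Definition ncol : nat := #|[set c | proper c]%SET|.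

Lemma properP c i j : proper c -> e i j -> c j = ~~ c i.
Proof.
by move=> /forallP/(_ i)/forallP/(_ j)/implyP h /h; case: (c i); case: (c j).
Qed.

Lemma edge_prodE (h : R * R -> R) z : edge_prod h (nat_edges e) z =
  \prod_(ij : 'I_v * 'I_v | (ij.1 < ij.2)%N && e ij.1 ij.2) h (z ij.1, z ij.2).
Proof. by rewrite /edge_prod /nat_edges /edges big_map big_filter. Qed.

(** An edge of a properly coloured graph has exactly one endpoint of colour
    false, from which it is listed on the right-hand side. *)
Lemma edge_prod_proper (h : R * R -> R) (c : {ffun 'I_v -> bool}) z :
  (forall x y, h (x, y) = h (y, x)) -> proper c ->
  edge_prod h (nat_edges e) z =
  \prod_(a | ~~ c a) \prod_(b | e a b) h (z a, z b).
Proof.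
move=> hs pc; have [esym eirr] := se.
rewrite edge_prodE pair_big_dep/= (bigID (fun ij : 'I_v * 'I_v => c ij.1))/=.
rewrite [RHS](bigID (fun ij : 'I_v * 'I_v => (ij.2 < ij.1)%N))/=; congr (_ * _).
  rewrite (reindex_inj (h := fun ij : 'I_v * 'I_v => (ij.2, ij.1)))/=; last first.
    by move=> [i j] [i' j'] /= [-> ->].
  apply: eq_big => [[i j]|[i j] _] /=; last by rewrite hs.
  rewrite esym; case eij: (e i j); rewrite ?andbF ?andbT//=.
  by rewrite (properP pc eij) andbC.
apply: eq_bigl => -[i j] /=; case eij: (e i j); rewrite ?andbF ?andbT//=.
rewrite andbC; congr andb; rewrite -leqNgt ltn_neqAle.
rewrite (_ : (i == j :> nat) = false)//; apply/eqP => /val_inj ij.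
by rewrite ij eirr in eij.
Qed.

(** Either colour class meets every edge once, so both have as many vertices as
    there are edges divided by d. *)
Lemma proper_card c : proper c ->
  #|[set i | c i]%SET| = v./2 /\ #|[set i | ~~ c i]%SET| = v./2.
Proof.
move=> pc; have [esym _] := se.
have cardd (k : bool) : (#|[set i | c i == k]%SET| * d)%N =
    (\sum_(i | c i == k) \sum_(j | c j != k) (e i j : nat))%N.
  rewrite -sum_nat_const; rewrite (eq_bigl (fun i => c i == k)); last by move=> i; rewrite inE.
  apply: eq_bigr => i /eqP cik; rewrite -[LHS](re i) -sum1_card.
  rewrite big_mkcond [RHS]big_mkcond; apply: eq_bigr => j _; rewrite inE.
  case eij: (e i j); last by case: ifP.
  by rewrite (properP pc eij) cik; case: (k).
have eqc : #|[set i | c i == true]%SET| = #|[set i | c i == false]%SET|.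
  apply/eqP; rewrite -(eqn_pmul2r d0) !cardd exchange_big/=; apply/eqP.
  apply: eq_big => [i|i _]; first by case: (c i).
  by apply: eq_big => [j|j _]; [case: (c j)|rewrite esym].
have tot : (#|[set i | c i == true]%SET| + #|[set i | c i == false]%SET|)%N = v.
  have := cardsC [set i | c i == true]%SET; rewrite card_ord; apply: etrans; congr (_ + _)%N.
  by apply: eq_card => i; rewrite !inE; case: (c i).
have E1 : [set i | c i]%SET = [set i | c i == true]%SET.
  by apply/setP => i; rewrite !inE eqb_id.
have E2 : [set i | ~~ c i]%SET = [set i | c i == false]%SET.
  by apply/setP => i; rewrite !inE; case: (c i).
by rewrite E1 E2; have := congr1 half tot; rewrite eqc addnn doubleK => <-.
Qed.

Definition vertices (P : pred 'I_v) : seq 'I_v := [seq i <- enum 'I_v | P i].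

Lemma vertices_perm (P : pred 'I_v) :
  perm_eq (iota 0 v) (map val (vertices P) ++ map val (vertices (predC P))).
Proof.
rewrite -map_cat -val_enum_ord perm_map// perm_sym.
by apply/permEl; exact: perm_filterC.
Qed.

Lemma vertices_uniq P : uniq (vertices P).
Proof. by rewrite filter_uniq// enum_uniq. Qed.

Lemma big_vertices (P : pred 'I_v) (F : 'I_v -> R) :
  \prod_(i <- vertices P) F i = \prod_(i | P i) F i.
Proof. by rewrite big_filter big_enum_cond. Qed.

Definition colour_weight (h : R * R -> R) (c : {ffun 'I_v -> bool}) (z : nat -> R) : R :=
  (\prod_i part (c i) (z i)) * edge_prod h (nat_edges e) z.

Lemma smeas_colour_weight h c : bmeas h -> smeas (colour_weight h c).
Proof.
move=> bh; apply: smeasM; last exact: smeas_edge_prod.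
by apply: smeas_prod => i _; apply: smeas_coord; exact: bmeas_part.
Qed.

(** Every variable is split according to the part it lies in; improper colourings
    contribute 0 because h vanishes on pairs from the same part. *)
Lemma colour_sum h z : bmeas h -> (forall x y, h (x, y) = h (y, x)) ->
  off_supported h ->
  Es (iota 0 v) (edge_prod h (nat_edges e)) z =
  \sum_(c in [set c | proper c]%SET) Es (iota 0 v) (colour_weight h c) z.
Proof.
move=> bh hs oh; have [esym eirr] := se.
rewrite -Es_sum; last by move=> c _; exact: smeas_colour_weight.
apply: Es_ext => y.
transitivity (\sum_c colour_weight h c y).
  rewrite -mulr_suml -(bigA_distr_bigA (fun (i : 'I_v) k => part k (y i))).
  by rewrite big1 ?mul1r// => i _; exact: sum_part.
rewrite [RHS]big_mkcond; apply: eq_bigr => c _; rewrite inE; case: ifPn => // /forallPn[i].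
move=> /forallPn[j]; rewrite negb_imply negbK => /andP[eij /eqP cij].
wlog ij : i j eij cij / (i < j)%N.
  move=> H; have [ij|ij|ij] := ltngtP i j; first exact: (H i j).
    by apply: (H j i) => //; rewrite esym.
  by rewrite (val_inj ij) eirr in eij.
have [yij|yij] := boolP ((y i <= gam) == (y j <= gam)).
  rewrite /colour_weight edge_prodE (bigD1 (i, j)) /=; last by rewrite ij.
  by rewrite oh ?mul0r ?mulr0.
rewrite /colour_weight (bigD1 i)//= (bigD1 j)/=; last by rewrite gt_eqF.
rewrite /part -cij; move: yij.
by case: (y i <= gam); case: (y j <= gam); case: (c i); rewrite //= ?mul0r ?mulr0 ?mul0r.
Qed.

Definition bip_moment (h : R * R -> R) : R :=
  \int[nu]_y (part true y * \int[nu]_x (part false x * h (x, y) ^+ d)).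

Lemma card_nbh i : #|[pred j | e i j]| = d.
Proof. by rewrite -(re i); apply: eq_card => j; rewrite !inE. Qed.

(** The vertices a of colour false are integrated first.  Given the others, each
    of them contributes at most the product of psi over its d neighbours, by
    Hoelder's inequality; a vertex of colour true occurs d times in the resulting
    product, which turns psi into psi^d = Phi + eps and leaves independent
    factors. *)
Lemma colour_weight_le h c z (eps : R) : global_graphon h -> proper c -> 0 < eps ->
  Es (iota 0 v) (colour_weight h c) z <= (bip_moment h + eps * gam) ^+ v./2.
Proof.
move=> Gh pc e0; have bh := gg_bmeas Gh; have hs := gg_sym Gh.
have [esym eirr] := se.
have h0 u : 0 <= h u by case/andP: (gg_itv Gh u).
pose Phi y := \int[nu]_x (part false x * h (x, y) ^+ d).
have bPhi : bmeas Phi.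
  apply: (@bmeas_mean R _ R _ _ nu (fun u : R * R => part false u.2 * h (u.2, u.1) ^+ d)).
  apply: bmeasM; first exact: (bmeas_comp (bmeas_part false)).
  by apply: bmeasX; apply: (bmeas_comp bh (phi := fun u => (u.2, u.1)));
     exact: measurable_fun_pair.
have Phi0 y : 0 <= Phi y.
  by apply: mean_ge0 => x; rewrite mulr_ge0 ?exprn_ge0//; case/andP: (part_itv false x).
pose psi y := (Phi y + eps) `^ (d%:R^-1).
have psid y : psi y ^+ d = Phi y + eps.
  rewrite -powR_mulrn ?powR_ge0// -powRrM mulVf; last by rewrite pnatr_eq0 -lt0n.
  by rewrite powRr1// addr_ge0// ltW.
pose G (a : 'I_v) (y : nat -> R) := part false (y a) * \prod_(b | e a b) h (y a, y b).
have sG a : smeas (G a).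
  apply: smeasM; first by apply: smeas_coord; exact: bmeas_part.
  by apply: smeas_prod => b _; exact: smeas_coord2.
pose B (y : nat -> R) := \prod_(b | c b) part true (y b).
have sB : smeas B.
  by apply: smeas_prod => b _; apply: smeas_coord; exact: bmeas_part.
have weightE y : colour_weight h c y = B y * \prod_(a <- vertices (predC c)) G a y.
  rewrite /colour_weight (edge_prod_proper _ hs pc) big_vertices /G big_split/= mulrA.
  congr (_ * _); rewrite /B (bigID c)/=; congr (_ * _); apply: eq_bigr => i.
    by move=> ->.
  by move=> /negbTE ->.
have sP : smeas (fun y => \prod_(a <- vertices (predC c)) G a y).
  by apply: smeas_prod => a _; exact: sG.
rewrite (Es_ext _ weightE).
rewrite (Es_perm (smeasM sB sP) (vertices_perm c)) Es_cat.
have inner y : Es (map val (vertices (predC c))) (fun y => B y *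
    \prod_(a <- vertices (predC c)) G a y) y <=
    \prod_(b <- vertices c) (part true (y b) * (Phi (y b) + eps)).
  rewrite Es_indepl//; last first.
    move=> _ /mapP[a + ->]; rewrite mem_filter => /andP[/= ca _] y' x.
    apply: eq_bigr => b cb; rewrite upd_neq//.
    by apply: contraTneq cb => /val_inj ->.
  rewrite (@Es_prod _ _ val)//; [|exact: vertices_uniq|]; last first.
    move=> i j; rewrite !mem_filter => /andP[/= ci _] /andP[/= cj _] ij y' x.
    have ji : val j != val i by rewrite (inj_eq val_inj) eq_sym.
    rewrite /G (upd_neq _ _ ji).
    congr (_ * _); apply: eq_bigr => b ejb; rewrite upd_neq//.
    by apply: contraNneq ci => /val_inj <-; rewrite (properP pc ejb) (negbTE cj).
  rewrite !big_vertices big_split/= ler_wpM2l//.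
    by apply: prodr_ge0 => b _; case/andP: (part_itv true (y b)).
  apply: (@le_trans _ _ (\prod_(a | ~~ c a) \prod_(b | e a b) psi (y b))).
    apply: ler_prod => a ca; apply/andP; split.
      apply: mean_ge0 => x; rewrite mulr_ge0//; exact: prodr_ge0.
    have -> : integ a (G a) y = \int[nu]_x (part false x *
        \prod_(b in [pred b | e a b]) h (x, y b)).
      apply: eq_Rintegral => x _; rewrite /G upd_eq; congr (_ * _).
      apply: eq_bigr => b eab; rewrite upd_neq//.
      by apply: contraTneq eab => /val_inj ->; rewrite eirr.
    have := @holder_prod R 'I_v [pred b | e a b] (part false)
      (fun b x => h (x, y b)) eps.
    rewrite card_nbh; apply => //; first exact: bmeas_part.
    by move=> b; apply: (bmeas_comp bh (phi := fun x => (x, y b))).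
  rewrite (exchange_big_dep c)/=; last first.
    by move=> a b ca eab; rewrite (properP pc eab).
  apply: ler_prod => b cb; rewrite prodr_ge0/=; last by move=> a _; exact: powR_ge0.
  rewrite prodr_const -psid le_eqVlt; apply/orP; left; apply/eqP; congr (_ ^+ _).
  rewrite -(card_nbh b); apply: eq_card => a; rewrite !inE /= unfold_in /= (esym a b) andbC.
  by case eba : (e b a) => //=; rewrite (properP pc eba) cb.
have sF i : smeas (fun y : nat -> R => part true (y i) * (Phi (y i) + eps)).
  apply: smeasM; first by apply: smeas_coord; exact: bmeas_part.
  apply: smeasD; last exact: smeas_cst.
  exact: smeas_coord.
apply: (@le_trans _ _ (Es (map val (vertices c)) (fun y => \prod_(b <- vertices c)
    (part true (y b) * (Phi (y b) + eps))) z)).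
  apply: Es_le => //; first by apply: smeas_Es; exact: smeasM.
  by apply: smeas_prod => b _.
rewrite (@Es_prod _ _ val)//; [|exact: vertices_uniq|]; last first.
  by move=> i j _ _ ij y' x; rewrite !upd_neq// eq_sym.
rewrite (eq_bigr (fun=> bip_moment h + eps * gam)); last first.
  move=> i _; rewrite /integ.
  under eq_Rintegral do rewrite upd_eq mulrDr [_ * eps]mulrC.
  rewrite meanD; last first.
  - by apply: bmeasM; [exact: bmeas_cst|exact: bmeas_part].
  - by apply: bmeasM => //; exact: bmeas_part.
  by rewrite meanZ ?mean_part_true//; exact: bmeas_part.
rewrite big_vertices prodr_const -(proper_card pc).1.
rewrite (_ : #|_| = #|[set i | c i]%SET|)//; apply: eq_card => i; rewrite inE//.
Qed.

Lemma tau_upper h z (eps : R) : global_graphon h -> off_supported h -> 0 < eps ->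
  Es (iota 0 v) (edge_prod h (nat_edges e)) z <=
  ncol%:R * (bip_moment h + eps * gam) ^+ v./2.
Proof.
move=> Gh oh e0; rewrite colour_sum//; [|exact: gg_bmeas|exact: gg_sym].
rewrite /ncol mulr_natl -sumr_const.
by apply: ler_sum => c; rewrite inE => pc; exact: colour_weight_le.
Qed.

(** Equality case of [colour_weight_le]: when h does not depend on the variables
    of colour false, every colour weight is a product of functions of one
    variable. *)
Lemma tau_row h (f : R -> R) z : bmeas h -> (forall x y, h (x, y) = h (y, x)) ->
  off_supported h -> bmeas f ->
  (forall x y, gam < x -> y <= gam -> h (x, y) = f y) ->
  Es (iota 0 v) (edge_prod h (nat_edges e)) z =
  ncol%:R * ((1 - gam) * \int[nu]_y (part true y * f y ^+ d)) ^+ v./2.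
Proof.
move=> bh hs oh bf hf; have [esym eirr] := se.
rewrite colour_sum// /ncol mulr_natl -sumr_const; apply: eq_bigr => c; rewrite inE => pc.
pose G (i : 'I_v) (y : nat -> R) := if c i then part true (y i) * f (y i) ^+ d
  else part false (y i).
have sG i : smeas (G i).
  rewrite /G; case: (c i); last by apply: smeas_coord; exact: bmeas_part.
  apply: (smeas_coord (g := fun y => part true y * f y ^+ d)).
  by apply: bmeasM; [exact: bmeas_part|exact: bmeasX].
have E y : colour_weight h c y = \prod_(i <- enum 'I_v) G i y.
  rewrite big_enum/= /colour_weight (edge_prod_proper _ hs pc).
  have [bad|good] := boolP [exists i : 'I_v, (y i <= gam) != c i].
    case/existsP: bad => i yi.
    rewrite (bigD1 i)//= [RHS](bigD1 i)//= {1}/part (negbTE yi) mul0r mul0r.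
    by rewrite /G /part; move: yi; case: (c i) => /negbTE ->; rewrite ?mul0r.
  have {}good (i : 'I_v) : (y i <= gam) = c i.
    by apply/eqP; apply: contraNT good => yi; apply/existsP; exists i.
  have -> : \prod_i part (c i) (y i) = 1.
    by apply: big1 => i _; rewrite /part good eqxx.
  rewrite mul1r.
  rewrite [RHS](eq_bigr (fun i => if c i then f (y i) ^+ d else 1)); last first.
    by move=> i _; rewrite /G /part good; case: (c i); rewrite ?mul1r.
  rewrite -big_mkcond/=.
  transitivity (\prod_(a | ~~ c a) \prod_(b | e a b) f (y b)).
    apply: eq_bigr => a ca; apply: eq_bigr => b eab; apply: hf.
      by rewrite ltNge good.
    by rewrite good (properP pc eab).
  rewrite (exchange_big_dep c)/=; last first.
    by move=> a b ca eab; rewrite (properP pc eab).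
  apply: eq_bigr => b cb; rewrite prodr_const; congr (_ ^+ _).
  rewrite -(card_nbh b); apply: eq_card => a; rewrite !inE /= unfold_in /= (esym a b) andbC.
  by case eba : (e b a) => //=; rewrite (properP pc eba) cb.
rewrite (Es_ext _ E) -val_enum_ord (@Es_prod _ _ val)//; last first.
- by move=> i j _ _ ij y x; rewrite /G upd_neq// (inj_eq val_inj) eq_sym.
- exact: enum_uniq.
rewrite big_enum/= (bigID c)/= exprMn mulrC; congr (_ * _).
  rewrite (eq_bigr (fun=> 1 - gam)); last first.
    move=> i /negbTE ci; rewrite /integ /G ci.
    under eq_Rintegral do rewrite upd_eq.
    exact: mean_part_false.
  rewrite prodr_const -(proper_card pc).2; congr (_ ^+ _).
  by apply: eq_card => i; rewrite inE.
rewrite (eq_bigr (fun=> \int[nu]_y (part true y * f y ^+ d))); last first.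
  move=> i ci; rewrite /integ /G ci.
  by under eq_Rintegral do rewrite upd_eq.
rewrite prodr_const -(proper_card pc).1; congr (_ ^+ _).
by apply: eq_card => i; rewrite inE.
Qed.

End colouring.

(** * Rates of bipartite graphons *)

Section off_diagonal.
Context {R : realType} (gam p : R).
Hypotheses (gam01 : 0 < gam < 1) (p01 : 0 < p < 1).
Local Notation mu := (@lebesgue_measure R).
Local Notation mu2 := (mu \x mu)%E.
Local Notation nu := (@nu R).
Local Notation nu2 := (nu \x nu)%E.
Implicit Types f g h F G : R * R -> R.

Definition off : R * R -> R := bip_graphon gam 1.

Lemma offE x y : off (x, y) =
  part gam true x * part gam false y + part gam false x * part gam true y.
Proof.
by rewrite /off /bip_graphon /part /=; case: (x <= gam); case: (y <= gam);
  rewrite /= ?mulr0 ?mul0r ?mulr1 ?addr0 ?add0r.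
Qed.

Lemma bip_graphonE r z : bip_graphon gam r z = r * off z.
Proof. by rewrite /off /bip_graphon; case: ifP; rewrite ?mulr0 ?mulr1. Qed.

Lemma off_case z : off z = 0 \/ off z = 1.
Proof. by rewrite /off /bip_graphon; case: ifP; [left|right]. Qed.

Lemma off_itv z : 0 <= off z <= 1.
Proof. by case: (off_case z) => ->; rewrite ?lexx ler01. Qed.

Lemma offC x y : off (x, y) = off (y, x).
Proof. by rewrite /off /bip_graphon /= eq_sym. Qed.

Lemma off_diag x y : ((x <= gam) == (y <= gam)) = (off (x, y) == 0).
Proof. by rewrite /off /bip_graphon /=; case: ifP; rewrite ?eqxx ?oner_eq0. Qed.

Lemma bmeas_off : bmeas off.
Proof.
rewrite (_ : off = fun z => part gam true z.1 * part gam false z.2 +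
    part gam false z.1 * part gam true z.2); last first.
  by apply/funext => -[x y]; exact: offE.
by apply: bmeasD; apply: bmeasM; apply: (bmeas_comp (bmeas_part gam _)).
Qed.

Lemma bip_global_graphon r : 0 <= r <= 1 -> global_graphon (bip_graphon gam r).
Proof.
move=> r01; split.
- rewrite (_ : bip_graphon gam r = fun z => r * off z); last first.
    by apply/funext => z; exact: bip_graphonE.
  by apply: measurable_funM => //; case: bmeas_off.
- by move=> x y; rewrite !bip_graphonE offC.
- by move=> z; rewrite bip_graphonE; case: (off_case z) => ->;
    rewrite ?mulr0 ?mulr1 ?lexx ?ler01.
Qed.

Lemma global_graphon_graphon f : global_graphon f -> graphon f.
Proof.
move=> [mf fs f01]; split; first exact: measurable_funTS.
- by move=> [x y] _; exact: fs.
- by move=> z _; exact: f01.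
Qed.

Lemma bip_off_supported r : off_supported gam (bip_graphon gam r).
Proof. by move=> x y xy; rewrite /bip_graphon /= xy. Qed.

Definition offmean F : R := \int[nu2]_z (off z * F z).
Definition off_mass : R := 2 * (gam * (1 - gam)).

Lemma bmeas_offM F : bmeas F -> bmeas (fun z => off z * F z).
Proof. by move=> bF; apply: bmeasM => //; exact: bmeas_off. Qed.

(** The measure nu is carried by [0,1]. *)
Lemma nu2_ext F G : bmeas F -> bmeas G -> {in unit_sq, F =1 G} ->
  \int[nu2]_z F z = \int[nu2]_z G z.
Proof.
move=> [mF _] [mG _] FG; rewrite -!Rintegral_unit_sq//.
by apply: eq_Rintegral => z zI; rewrite FG.
Qed.

Lemma offmean_sym F : bmeas F -> (forall x y, F (x, y) = F (y, x)) ->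
  offmean F = 2 * \int[nu]_y (part gam true y * \int[nu]_x (part gam false x * F (x, y))).
Proof.
move=> bF sF; have b1 := bmeas_part gam true; have b0 := bmeas_part gam false.
pose Q (k l : bool) (z : R * R) := part gam k z.1 * part gam l z.2 * F z.
have bQ k l : bmeas (Q k l).
  apply: bmeasM => //; apply: bmeasM.
    exact: (bmeas_comp (bmeas_part gam k)).
  exact: (bmeas_comp (bmeas_part gam l)).
have Fy y : bmeas (fun x => F (x, y)) by apply: (bmeas_comp bF (phi := fun x => (x, y))).
have -> : offmean F = \int[nu2]_z (Q true false z + Q false true z).
  by apply: eq_Rintegral => -[x y] _; rewrite offE mulrDl.
rewrite (meanD nu2 (bQ true false) (bQ false true)).
rewrite (mean_prod nu nu (bQ true false)) (mean_prod nu nu (bQ false true)).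
have -> : \int[nu]_x \int[nu]_y Q true false (x, y) =
    \int[nu]_y (part gam true y * \int[nu]_x (part gam false x * F (x, y))).
  apply: eq_Rintegral => x _; rewrite -meanZ; last first.
    by apply: bmeasM => //; exact: Fy.
  by apply: eq_Rintegral => y _; rewrite /Q /= mulrA sF.
rewrite (mean_swap nu nu (bQ false true)).
have -> : \int[nu]_y \int[nu]_x Q false true (x, y) =
    \int[nu]_y (part gam true y * \int[nu]_x (part gam false x * F (x, y))).
  apply: eq_Rintegral => y _; rewrite -meanZ; last first.
    by apply: bmeasM => //; exact: Fy.
  by apply: eq_Rintegral => x _; rewrite /Q /=; ring.
by rewrite mulr_natl mulr2n.
Qed.

Lemma offmean_cst (c : R) : offmean (fun=> c) = off_mass * c.
Proof.
rewrite offmean_sym//; last exact: bmeas_cst.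
under eq_Rintegral => y _.
  under eq_Rintegral do rewrite mulrC.
  rewrite meanZ; last exact: bmeas_part.
  rewrite mean_part_false// mulrC; over.
rewrite meanZ ?mean_part_true//; last exact: bmeas_part.
by rewrite /off_mass; ring.
Qed.

Lemma offmeanD F G : bmeas F -> bmeas G ->
  offmean (fun z => F z + G z) = offmean F + offmean G.
Proof.
move=> bF bG; rewrite /offmean -meanD; [|exact: bmeas_offM..].
by apply: eq_Rintegral => z _; rewrite mulrDr.
Qed.

Lemma offmeanB F G : bmeas F -> bmeas G ->
  offmean (fun z => F z - G z) = offmean F - offmean G.
Proof.
move=> bF bG; rewrite /offmean -meanB; [|exact: bmeas_offM..].
by apply: eq_Rintegral => z _; rewrite mulrBr.
Qed.

Lemma offmeanZ (c : R) F : bmeas F -> offmean (fun z => c * F z) = c * offmean F.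
Proof.
move=> bF; rewrite /offmean -meanZ; last exact: bmeas_offM.
by apply: eq_Rintegral => z _; rewrite mulrCA.
Qed.

Lemma le_offmean F G : bmeas F -> bmeas G -> (forall z, F z <= G z) ->
  offmean F <= offmean G.
Proof.
move=> bF bG FG; apply: le_mean; [exact: bmeas_offM..|].
by move=> z; apply: ler_wpM2l => //; case/andP: (off_itv z).
Qed.

Lemma offmean_ge0 F : (forall z, 0 <= F z) -> 0 <= offmean F.
Proof. by move=> F0; apply: mean_ge0 => z; rewrite mulr_ge0//; case/andP: (off_itv z). Qed.

Lemma off_mass_gt0 : 0 < off_mass.
Proof. by move/andP: gam01 => [g0 g1]; rewrite /off_mass !mulr_gt0// subr_gt0. Qed.

Definition cutoff h : R * R -> R := fun z => off z * h z.

Lemma clip_cutoff h z : clip (cutoff h) z = off z * clip h z.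
Proof. by rewrite /clip /cutoff !patchE; case: ifP; rewrite ?mulr0. Qed.

Lemma graphon_cutoff h : graphon h -> graphon (cutoff h).
Proof.
move=> [mh hs h01]; split.
- by apply: measurable_funM => //; apply: measurable_funTS; case: bmeas_off.
- move=> [x y] xy; rewrite /cutoff offC; congr (_ * _); exact: hs.
- move=> z zI; have /andP[w0 w1] := off_itv z; have /andP[h0 h1] := h01 z zI.
  by rewrite /cutoff mulr_ge0//= mulr_ile1.
Qed.

Lemma cutoff_off_supported h : off_supported gam (clip (cutoff h)).
Proof. by move=> x y; rewrite off_diag clip_cutoff => /eqP ->; rewrite mul0r. Qed.

Definition vanishes_on_diag h : Prop := forall z, off z = 0 -> h z = 0.

Lemma bip_itv (z : R * R) (r : R) : off z != 0 -> bip_graphon gam r z = r.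
Proof. by rewrite bip_graphonE; case: (off_case z) => ->; rewrite ?eqxx ?mulr1. Qed.

Definition rel_density h z : \bar R := rel_entropy (bip_graphon gam p z) (clip h z).

Lemma rel_densityE h z : rel_density h z =
  if off z == 0 then (if clip h z == 0 then 0%E else +oo%E)
  else (kl p (clip h z))%:E.
Proof.
rewrite /rel_density; have [z0|z0] := eqVneq (off z) 0.
  by rewrite bip_graphonE z0 mulr0 /rel_entropy eqxx.
by rewrite (bip_itv _ z0) rel_entropyE.
Qed.

Lemma measurable_rel_density h : graphon h -> measurable_fun setT (rel_density h).
Proof.
move=> Gh; have Ch := graphon_clip Gh.
have meq0 F : measurable_fun setT F -> measurable_fun setT (fun z => F z == 0).
  by move=> mF; apply: measurable_fun_eqr.
rewrite (_ : rel_density h = fun z => if off z == 0 then (if clip h z == 0 then 0%E else +oo%E)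
   else (kl p (clip h z))%:E); last by apply/funext => z; exact: rel_densityE.
apply: measurable_fun_ifT; first by apply: meq0; case: bmeas_off.
- by apply: measurable_fun_ifT => //; apply: meq0; exact: gg_meas.
- apply/measurable_EFinP; apply: (measurableT_comp (measurable_kl p)).
  exact: gg_meas.
Qed.

Lemma bmeas_kl_clip h : graphon h -> bmeas (fun z => kl p (clip h z)).
Proof.
move=> Gh; have Ch := graphon_clip Gh.
apply: (@bmeas_itv _ _ _ _ 0 (p^-1 + (1 - p)^-1)).
  by apply: (measurableT_comp (measurable_kl p)); exact: gg_meas.
by move=> z; have c01 := gg_itv Ch z; rewrite kl_ge0//= kl_bound.
Qed.

Lemma rel_density_ge0 h z : graphon h -> (0 <= rel_density h z)%E.
Proof.
move=> Gh; rewrite rel_densityE; case: ifP => _; first by case: ifP.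
by rewrite lee_fin kl_ge0//; exact: gg_itv (graphon_clip Gh) z.
Qed.

Lemma rate_IE h : graphon h ->
  rate_I (bip_graphon gam p) h = (2^-1%:E * \int[nu2]_z rel_density h z)%E.
Proof.
move=> Gh; rewrite /rate_I; congr (_ * _)%E.
rewrite -ge0_integral_unit_sq; last 2 first.
- exact: measurable_rel_density.
- by move=> z; exact: rel_density_ge0.
by apply: eq_integral => z zI; rewrite /rel_density clipE.
Qed.

Lemma rate_I_ge_mean h F : graphon h -> bmeas F -> (forall z, 0 <= F z) ->
  (forall z, (F z)%:E <= rel_density h z)%E ->
  ((2^-1 * \int[nu2]_z F z)%:E <= rate_I (bip_graphon gam p) h)%E.
Proof.
move=> Gh bF F0 FR; rewrite rate_IE// EFinM lee_wpmul2l//.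
rewrite (EFin_mean nu2 bF); apply: ge0_le_integral => //.
- by move=> z _; rewrite lee_fin.
- by apply/measurable_EFinP; case: bF.
- exact: measurable_rel_density.
Qed.

Lemma rate_I_ge h : graphon h ->
  ((2^-1 * offmean (fun z => kl p (clip h z)))%:E <= rate_I (bip_graphon gam p) h)%E.
Proof.
move=> Gh; have hp0 z : 0 <= kl p (clip h z).
  by rewrite kl_ge0//; exact: gg_itv (graphon_clip Gh) z.
apply: rate_I_ge_mean => //.
- by apply: bmeas_offM; exact: bmeas_kl_clip.
- by move=> z; rewrite mulr_ge0//; case/andP: (off_itv z).
- move=> z; rewrite rel_densityE; case: (off_case z) => ->.
    by rewrite eqxx mul0r; case: ifP => _; rewrite ?leey.
  by rewrite oner_eq0 mul1r.
Qed.

Lemma rate_I_off h : graphon h -> vanishes_on_diag h ->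
  rate_I (bip_graphon gam p) h = (2^-1 * offmean (fun z => kl p (clip h z)))%:E.
Proof.
move=> Gh h0; rewrite rate_IE// EFinM; congr (_ * _)%E.
rewrite /offmean (EFin_mean nu2 (bmeas_offM (bmeas_kl_clip Gh))).
apply: eq_integral => z _; rewrite rel_densityE; case: (off_case z) => oz.
  rewrite oz eqxx mul0r (_ : clip h z = 0) ?eqxx// /clip patchE; case: ifP => // _.
  exact: h0.
by rewrite oz oner_eq0 mul1r.
Qed.

Lemma rate_I_ge0 h : graphon h -> (0 <= rate_I (bip_graphon gam p) h)%E.
Proof.
move=> Gh; apply: le_trans (rate_I_ge Gh); rewrite lee_fin mulr_ge0//.
by apply: offmean_ge0 => z; rewrite kl_ge0//; exact: gg_itv (graphon_clip Gh) z.
Qed.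

(** On the diagonal blocks the reference value is 0, so the integrand of the rate
    is infinite wherever h is nonzero; it exceeds M |h| for every M. *)
Lemma finite_rate_cutoff h : graphon h -> (rate_I (bip_graphon gam p) h < +oo)%E ->
  L1dist (clip h) (clip (cutoff h)) = 0.
Proof.
move=> Gh hfin; have Ch := graphon_clip Gh; have Cc := graphon_clip (graphon_cutoff Gh).
set L := L1dist _ _.
have L0 : 0 <= L by exact: L1dist_ge0.
have bL : bmeas (fun z => `|clip h z - clip (cutoff h) z|).
  by apply: bmeas_norm; apply: bmeasB; exact: gg_bmeas.
(* letting M tend to infinity below forces L = 0 *)
have bound (M : R) : 0 <= M -> ((2^-1 * (M * L))%:E <= rate_I (bip_graphon gam p) h)%E.
  move=> M0; rewrite /L /L1dist -(meanZ nu2 _ bL).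
  apply: rate_I_ge_mean => //.
  - by apply: bmeasM => //; exact: bmeas_cst.
  - by move=> z; rewrite mulr_ge0.
  - move=> z; rewrite rel_densityE clip_cutoff; case: (off_case z) => ->.
      rewrite eqxx mul0r subr0; case: ifPn => [/eqP ->|_].
        by rewrite normr0 mulr0.
      exact: leey.
    rewrite oner_eq0 mul1r subrr normr0 mulr0 lee_fin kl_ge0//.
    exact: gg_itv.
apply/eqP; rewrite eq_le L0 andbT leNgt; apply/negP => Lpos.
have I0 := rate_I_ge0 Gh.
have /fineK Ifin : rate_I (bip_graphon gam p) h \is a fin_num by rewrite ge0_fin_numE.
set c := fine _ in Ifin.
have c0 : 0 <= c by rewrite -lee_fin Ifin.
have := bound (2 * (c + 1) / L); rewrite divr_ge0 ?mulr_ge0 ?addr_ge0//.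
move=> /(_ isT); rewrite divfK ?gt_eqF// mulKf// -Ifin lee_fin gerDl.
by rewrite ler10.
Qed.

Lemma hom_density_cutoff v (e : rel 'I_v) h : graphon h ->
  L1dist (clip h) (clip (cutoff h)) = 0 ->
  hom_density e h = hom_density e (cutoff h).
Proof.
move=> Gh h0; apply: hom_density_weakly => //; first exact: graphon_cutoff.
by apply: weakly_equal_L1 => //; exact: graphon_cutoff.
Qed.

Lemma graphon_OmegaP h : graphon h -> vanishes_on_diag h ->
  graphon_Omega (bip_graphon gam p) h.
Proof.
move=> Gh h0; split=> //; apply: aeW => z [zI zO].
have /andP[p0 p1] := p01.
have [oz|oz] := off_case z.
  by rewrite h0// bip_graphonE oz mulr0.
by exfalso; apply: zO; split=> //=; rewrite bip_graphonE oz mulr1 p0.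
Qed.

Lemma graphon_Omega_cutoff h : graphon_Omega (bip_graphon gam p) h ->
  L1dist (clip h) (clip (cutoff h)) = 0.
Proof.
move=> [Gh hae]; have Ch := graphon_clip Gh; have Cc := graphon_clip (graphon_cutoff Gh).
have bL : bmeas (fun z => `|clip h z - clip (cutoff h) z|).
  by apply: bmeas_norm; apply: bmeasB; exact: gg_bmeas.
rewrite /L1dist -Rintegral_unit_sq; last by case: bL.
rewrite /Rintegral (ae_eq_integral (cst 0%E))//.
- by rewrite integral0.
- exact: measurable_unit_sq.
- by apply/measurable_EFinP; apply: measurable_funTS; case: bL.
apply: (@filterS _ _ (ae_filter_ringOfSetsType mu2) _ _ _ hae) => z hz zI; congr EFin; rewrite clip_cutoff.
have [oz|oz] := off_case z; last by rewrite oz mul1r subrr normr0.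
rewrite oz mul0r subr0 clipE ?mem_set// hz ?bip_graphonE ?oz ?mulr0 ?normr0//.
split=> //; case=> _ /=; by rewrite bip_graphonE oz mulr0 ltxx.
Qed.

End off_diagonal.

(** * Density constraints and the function J *)

Section variational.
Context {R : realType} (gam p : R).
Hypotheses (gam01 : 0 < gam < 1) (p01 : 0 < p < 1).
Local Notation W0 := (bip_graphon gam p).
Local Notation nu := (@nu R).
Local Notation nu2 := (nu \x nu)%E.
Local Notation offmass := (off_mass gam).
Implicit Types f g h : R * R -> R.

Definition off_entropy h : R := offmean gam (fun z => kl p (clip h z)).

Lemma bip_graphon_graphon r : 0 <= r <= 1 -> graphon (bip_graphon gam r).
Proof. by move=> r01; apply: global_graphon_graphon; exact: bip_global_graphon. Qed.

Lemma bip_vanishes r : vanishes_on_diag gam (bip_graphon gam r).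
Proof. by move=> z z0; rewrite bip_graphonE z0 mulr0. Qed.

Lemma tilde_refl (A : set (R * R -> R)) f : graphon f -> A f -> tilde A f.
Proof. by move=> Gf Af; split=> //; exists f => //; exact: weakly_equal_refl. Qed.

Lemma tilde_Omega f : graphon f -> vanishes_on_diag gam f ->
  tilde (graphon_Omega W0) f.
Proof. by move=> Gf f0; apply: tilde_refl => //; exact: graphon_OmegaP. Qed.

Lemma rate_J_le f : graphon f -> vanishes_on_diag gam f ->
  (rate_J W0 f <= (2^-1 * off_entropy f)%:E)%E.
Proof.
move=> Gf f0; rewrite /rate_J mem_set; last exact: tilde_Omega.
apply: ge_ereal_sup => _ [eta /= eta0 <-].
rewrite -(rate_I_off p01 Gf f0).
apply: ge_ereal_inf; exists (rate_I W0 f) => //; exists f => //; split=> //.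
by rewrite (weakly_equal_refl Gf) ltW.
Qed.

Section graph.
Variables (v : nat) (e : rel 'I_v).
Local Notation tau := (hom_density e).

Lemma delta_tau_close (delta : R) : 0 < delta -> exists2 eta : R, 0 < eta &
  forall f h, graphon f -> graphon h -> delta_cut f h <= eta ->
  tau f - delta <= tau h.
Proof.
move=> d0; exists (delta / (size (edges e)).+1%:R); first by rewrite divr_gt0 ?ltr0n.
move=> f h Gf Gh; rewrite ler_pdivlMr ?ltr0n// mulrC => fh.
have := le_trans (hom_density_delta e Gf Gh) fh.
by rewrite ler_norml => /andP[_]; lra.
Qed.

(** Graphons close to f in the cut metric have nearly the density of f, so
    a rate bound valid under the relaxed constraint t - delta passes to J. *)
Lemma rate_J_ge (c t : R) f : graphon f -> t <= tau f ->
  (forall eps : R, 0 < eps -> exists2 delta : R, 0 < delta &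
    forall h, graphon h -> (rate_I W0 h < +oo)%E -> t - delta <= tau h ->
      c - eps <= 2^-1 * off_entropy h) ->
  (c%:E <= rate_J W0 f)%E.
Proof.
move=> Gf tf H; rewrite /rate_J; case: ifP => _; last exact: leey.
apply/lee_addgt0Pr => eps eps0; rewrite -leeBlDr// -EFinB.
have [delta d0 dP] := H eps eps0.
have [eta eta0 etaP] := delta_tau_close d0.
apply: le_ereal_sup_tmp; eexists; first by exists eta.
apply: le_ereal_inf_tmp => _ [h [Gh fh] <-].
have [hfin|] := ltP (rate_I W0 h) +oo%E; last by rewrite leye_eq => /eqP ->; exact: leey.
apply: le_trans (rate_I_ge gam p01 Gh); rewrite lee_fin.
apply: dP => //; have := etaP f h Gf Gh fh; lra.
Qed.

End graph.

Lemma near_minimizer (c : R) g : graphon g -> (rate_J W0 g <= c%:E)%E ->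
  forall eta eps : R, 0 < eta -> 0 < eps ->
  exists h, [/\ graphon h, delta_cut g h <= eta & (rate_I W0 h < (c + eps)%:E)%E].
Proof.
move=> Gg; rewrite /rate_J; case: ifP => _ // Jc eta eps eta0 eps0.
have h1 : (ereal_inf [set rate_I W0 h | h in [set h | graphon h /\ (delta_cut g h <= eta)%R]] <
    (c + eps)%:E)%E.
  apply: (@le_lt_trans _ _ c%:E); last by rewrite lte_fin ltrDl.
  by apply: le_trans Jc; apply: ereal_sup_ubound; exists eta.
by have [_ [h [Gh gh] <-] hc] := ereal_inf_lt h1; exists h.
Qed.

Variables (v d : nat) (e : rel 'I_v).
Hypotheses (v0 : (0 < v)%N) (se : simple_graph e) (d0 : (0 < d)%N)
  (re : regular_graph e d).
Local Notation tau := (hom_density e).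

Definition off_moment h : R := offmean gam (fun z => clip h z ^+ d).

Lemma bmeas_clip h : graphon h -> bmeas (clip h).
Proof. by move=> Gh; exact: gg_bmeas (graphon_clip Gh). Qed.

Lemma hom_density_bip r : 0 <= r <= 1 ->
  tau (bip_graphon gam r) = (ncol e)%:R * ((1 - gam) * (gam * r ^+ d)) ^+ v./2.
Proof.
move=> r01; have Gr := bip_global_graphon gam r01.
rewrite (hom_density_global _ (fun=> 0) (gg_bmeas Gr)).
rewrite (tau_row gam01 se d0 re (f := fun=> r) _ (gg_bmeas Gr))//.
- congr (_ * (_ * _) ^+ _); under eq_Rintegral do rewrite mulrC.
  rewrite meanZ ?mean_part_true//; first by rewrite mulrC.
  exact: bmeas_part.
- exact: gg_sym.
- exact: bip_off_supported.
- exact: bmeas_cst.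
- by move=> x y gx yg; rewrite /bip_graphon/= yg leNgt gx.
Qed.

Lemma ncol_gt0 : bipartite_graph e -> (0 < ncol e)%N.
Proof.
move=> [c cP]; apply/card_gt0P; exists [ffun i => c i]; rewrite inE.
by apply/forallP => i; apply/forallP => j; apply/implyP => /cP; rewrite !ffunE.
Qed.

Lemma half_gt0 : (0 < ncol e)%N -> (0 < v./2)%N.
Proof.
move=> /card_gt0P[c]; rewrite inE => pc.
have [c1 c2] := proper_card se d0 re pc.
have := cardsC [set i | c i]%SET.
have -> : (~: [set i | c i])%SET = [set i | ~~ c i]%SET.
  by apply/setP => i; rewrite !inE.
by rewrite c1 c2 card_ord addnn; case: (posnP v./2) => // -> E; move: v0; rewrite -E.
Qed.

Lemma tau_cutoff h : graphon h -> (rate_I W0 h < +oo)%E -> tau h = tau (cutoff gam h).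
Proof.
move=> Gh hfin; apply: hom_density_cutoff => //; exact: (finite_rate_cutoff p01).
Qed.

Lemma off_moment_cutoff h : graphon h ->
  off_moment h = 2 * bip_moment gam d (clip (cutoff gam h)).
Proof.
move=> Gh; have Cc := graphon_clip (graphon_cutoff gam Gh).
have bC : bmeas (fun z => clip (cutoff gam h) z ^+ d).
  by apply: bmeasX; exact: gg_bmeas.
have sC x y : clip (cutoff gam h) (x, y) ^+ d = clip (cutoff gam h) (y, x) ^+ d.
  by rewrite (gg_sym Cc).
rewrite /bip_moment -(offmean_sym gam bC sC).
apply: eq_Rintegral => z _; rewrite clip_cutoff.
by case: (off_case gam z) => ->; rewrite ?mul0r// !mul1r.
Qed.

(** Hoelder's bound on the density is strictly increasing in the d-th moment and
    equals the density of f_r at the moment of f_r. *)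
Lemma moment_lower (r eps : R) : 0 <= r <= 1 -> (0 < ncol e)%N -> 0 < eps ->
  exists2 delta : R, 0 < delta & forall h, graphon h -> (rate_I W0 h < +oo)%E ->
    tau (bip_graphon gam r) - delta <= tau h ->
    offmass * r ^+ d - eps <= off_moment h.
Proof.
move=> r01 N0 eps0; have n0 := half_gt0 N0; have /andP[g0 g1] := gam01.
have NR : 0 < (ncol e)%:R :> R by rewrite ltr0n.
pose M0 := (1 - gam) * (gam * r ^+ d).
have massE : offmass * r ^+ d = 2 * M0 by rewrite /off_mass /M0; ring.
(* half of the loss eps / 2 in one block pays for the eps of [tau_upper] *)
pose a := M0 - eps / 4.
have upper h : graphon h -> (rate_I W0 h < +oo)%E ->
    off_moment h < offmass * r ^+ d - eps -> 0 <= a /\ tau h <= (ncol e)%:R * a ^+ v./2.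
  move=> Gh hfin; rewrite off_moment_cutoff// massE => hM.
  have Cc := graphon_clip (graphon_cutoff gam Gh).
  have bM0 : 0 <= bip_moment gam d (clip (cutoff gam h)).
    apply: mean_ge0 => y; rewrite mulr_ge0//; apply: mean_ge0 => x.
    by rewrite mulr_ge0// exprn_ge0//; case/andP: (gg_itv Cc (x, y)).
  have e4 : 0 < eps / 4 by rewrite divr_gt0.
  have eg : 0 <= eps / 4 * gam <= eps / 4.
    by rewrite mulr_ge0 ?(ltW e4) ?(ltW g0)//= ler_piMr// ltW.
  have h1 : bip_moment gam d (clip (cutoff gam h)) + eps / 4 * gam <= a.
    by rewrite /a; move/andP: eg => [? ?]; lra.
  have a0 : 0 <= a by apply: le_trans h1; rewrite addr_ge0//; case/andP: eg.
  split=> //; rewrite (tau_cutoff Gh hfin).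
  rewrite (hom_densityE _ (fun=> 0) (graphon_cutoff gam Gh)).
  rewrite (le_trans (tau_upper gam01 se d0 re _ Cc (@cutoff_off_supported _ _ _) e4))//.
  rewrite ler_wpM2l// lerXn2r ?nnegrE// addr_ge0//; by case/andP: eg.
have [a0|a0] := ltP a 0.
  exists 1 => // h Gh hfin _; rewrite leNgt; apply/negP => /(upper h Gh hfin)[+ _].
  by rewrite leNgt a0.
have aM : a < M0 by rewrite /a gtrBl divr_gt0.
pose gap := (ncol e)%:R * (M0 ^+ v./2 - a ^+ v./2).
have gap0 : 0 < gap by rewrite mulr_gt0// subr_gt0 ltr_pXn.
exists (gap / 2); first by rewrite divr_gt0.
move=> h Gh hfin; rewrite hom_density_bip// -/M0 => th.
rewrite leNgt; apply/negP => /(upper h Gh hfin)[_ th'].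
have := le_trans th th'; rewrite /gap in gap0 *; lra.
Qed.

Lemma tau_le_bip1 w : graphon_Omega W0 w -> tau w <= tau (bip_graphon gam 1).
Proof.
move=> Ow; have Gw : graphon w by case: Ow.
rewrite (hom_density_cutoff e Gw (graphon_Omega_cutoff Ow)).
have r01 : 0 <= (1 : R) <= 1 by rewrite ler01 lexx.
have G1 := bip_global_graphon gam r01.
have Cc := graphon_clip (graphon_cutoff gam Gw).
rewrite (hom_densityE _ (fun=> 0) (graphon_cutoff gam Gw)).
rewrite (hom_density_global _ (fun=> 0) (gg_bmeas G1)).
apply: Es_le; [exact/smeas_edge_prod/gg_bmeas..|].
move=> z; apply: ler_prod => k _; have /andP[-> _] /= := gg_itv Cc (z k.1, z k.2).
rewrite clip_cutoff -/(off gam) ler_piMr//; first by case/andP: (off_itv gam (z k.1, z k.2)).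
by case/andP: (gg_itv (graphon_clip Gw) (z k.1, z k.2)).
Qed.

Lemma tau_bip_le1 r : 0 <= r <= 1 -> tau (bip_graphon gam r) <= tau (bip_graphon gam 1).
Proof.
move=> r01; apply: tau_le_bip1; apply: graphon_OmegaP => //.
  exact: bip_graphon_graphon.
exact: bip_vanishes.
Qed.

Lemma admissible_bip r : 0 <= r <= 1 ->
  admissible_value W0 tau (tau (bip_graphon gam r)).
Proof.
move=> r01; exists (bip_graphon gam 1).
have o01 : 0 <= (1 : R) <= 1 by rewrite ler01 lexx.
split; last exact: tau_bip_le1.
- by apply: tilde_Omega; [exact: bip_graphon_graphon|exact: bip_vanishes].
- move=> g [Gg [w Ow gw]]; rewrite (hom_density_weakly e Gg _ gw); last by case: Ow.
  exact: tau_le_bip1.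
Qed.

End variational.

(** * On the convex minorant *)

Section symmetric_case.
Context {R : realType} (gam p : R).
Hypotheses (gam01 : 0 < gam < 1) (p01 : 0 < p < 1).
Local Notation W0 := (bip_graphon gam p).
Local Notation nu := (@nu R).
Local Notation nu2 := (nu \x nu)%E.
Local Notation offmass := (off_mass gam).
Implicit Types f g h : R * R -> R.

Variables (v d : nat) (e : rel 'I_v).
Hypotheses (v0 : (0 < v)%N) (se : simple_graph e) (d0 : (0 < d)%N)
  (re : regular_graph e d).
Local Notation tau := (hom_density e).

Variable r : R.
Hypotheses (pr1 : p <= r <= 1) (bip : p < r -> bipartite_graph e).
Hypothesis on_min : on_convex_minorant (root_entropy p d) (r ^+ d) (kl p r).
Local Notation fr := (bip_graphon gam r).

Let r01 : 0 <= r <= 1.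
Proof. by move: p01 pr1 => /andP[? ?] /andP[? ?]; apply/andP; split; lra. Qed.

Let r0 : 0 < r.
Proof. by move: p01 pr1 => /andP[? ?] /andP[? ?]; lra. Qed.

Definition off_dist h : R := offmean gam (fun z => `|clip h z ^+ d - r ^+ d|).

(** The integral of [entropy_stability] over the off-diagonal blocks.  The moment
    term is negligible by [moment_lower]; when r = p that lemma has no content,
    as H may fail to be bipartite, but then B = 0. *)
Lemma stability (eps : R) : 0 < eps -> exists2 A : R, 1 <= A &
  exists2 delta : R, 0 < delta & forall h, graphon h -> (rate_I W0 h < +oo)%E ->
    tau fr - delta <= tau h ->
    off_dist h <= eps + A * (off_entropy gam p h - offmass * kl p r).
Proof.
move=> eps0; have m0 := off_mass_gt0 gam01.
pose eps' := eps / (offmass + 1).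
have m1 : 0 < offmass + 1 by rewrite addr_gt0.
have eps'0 : 0 < eps' by rewrite divr_gt0.
have epsE : offmass * eps' + eps' = eps by rewrite /eps'; field; rewrite gt_eqF.
have [A [B [A1 B0 Bp AB]]] := entropy_stability p01 d0 pr1 on_min eps'0.
exists A => //.
have [delta dlt0 dP] : exists2 delta : R, 0 < delta &
    forall h, graphon h -> (rate_I W0 h < +oo)%E -> tau fr - delta <= tau h ->
      B * (offmass * r ^+ d - off_moment gam d h) <= eps'.
  have [rp|rp] := eqVneq r p.
    by exists 1 => // h _ _ _; rewrite (Bp rp) mul0r ltW.
  have N0 : (0 < ncol e)%N.
    by apply: ncol_gt0; apply: bip; rewrite lt_neqAle eq_sym rp; case/andP: pr1.
  have B1 : 0 < B + 1 by rewrite ltr_wpDl.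
  have eB0 : 0 < eps' / (B + 1) by rewrite divr_gt0.
  have [delta dlt0 dP] := moment_lower gam01 p01 v0 se d0 re r01 N0 eB0.
  exists delta => // h Gh hfin th.
  have := dP h Gh hfin th; rewrite lerBlDr -lerBlDl => hB.
  apply: (le_trans (ler_wpM2l B0 hB)).
  by rewrite mulrCA ler_piMr ?(ltW eps'0)// ler_pdivrMr// mul1r lerDl.
exists delta => // h Gh hfin th.
have bE := bmeas_kl_clip p01 Gh.
have bX : bmeas (fun z => clip h z ^+ d) by apply: bmeasX; exact: bmeas_clip.
pose c := eps' - A * kl p r + B * r ^+ d.
have bAE : bmeas (fun z => A * kl p (clip h z)) by apply: bmeasM => //; exact: bmeas_cst.
have bBX : bmeas (fun z => B * clip h z ^+ d) by apply: bmeasM => //; exact: bmeas_cst.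
have bAB : bmeas (fun z => A * kl p (clip h z) - B * clip h z ^+ d) by exact: bmeasB.
apply: (@le_trans _ _ (offmean gam (fun z => c + (A * kl p (clip h z) - B * clip h z ^+ d)))).
  apply: le_offmean.
  - by apply: bmeas_norm; apply: bmeasB => //; exact: bmeas_cst.
  - by apply: bmeasD => //; exact: bmeas_cst.
  - move=> z; have := AB _ (gg_itv (graphon_clip Gh) z); rewrite /c; lra.
rewrite offmeanD//; last exact: bmeas_cst.
rewrite (offmeanB gam bAE bBX).
rewrite (offmeanZ gam A bE) (offmeanZ gam B bX) (offmean_cst gam01).
rewrite -/(off_entropy gam p h) -/(off_moment gam d h).
have := dP h Gh hfin th; rewrite /c; lra.
Qed.

Let value : R := 2^-1 * (offmass * kl p r).

(** The left side of [stability] is nonnegative, and A >= 1. *)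
Lemma off_entropy_lower (eps : R) : 0 < eps -> exists2 delta : R, 0 < delta &
  forall h, graphon h -> (rate_I W0 h < +oo)%E -> tau fr - delta <= tau h ->
    value - eps <= 2^-1 * off_entropy gam p h.
Proof.
move=> eps0; have [A A1 [delta dlt0 dP]] := stability eps0.
exists delta => // h Gh hfin th; have := dP h Gh hfin th.
have : 0 <= off_dist h by exact: offmean_ge0.
move=> h0 /(le_trans h0) h1.
have : - eps <= off_entropy gam p h - offmass * kl p r.
  have [pos|neg] := leP 0 (off_entropy gam p h - offmass * kl p r).
    by rewrite (le_trans _ pos)// oppr_le0 ltW.
  have := ler_wnM2r (ltW neg) A1; rewrite mul1r; lra.
rewrite /value; lra.
Qed.

Lemma rate_J_fr : (rate_J W0 fr <= value%:E)%E.
Proof.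
apply: (le_trans (rate_J_le p01 (bip_graphon_graphon gam r01) (@bip_vanishes _ gam r))).
rewrite lee_fin /value ler_wpM2l// /off_entropy.
rewrite -(offmean_cst gam01) le_eqVlt; apply/orP; left; apply/eqP.
have Gr := bip_graphon_graphon gam r01.
rewrite /offmean; apply: nu2_ext.
- by apply: bmeas_offM; exact: bmeas_kl_clip.
- by apply: bmeas_offM; exact: bmeas_cst.
- move=> z zI; rewrite clipE// bip_graphonE.
  by case: (off_case gam z) => ->; rewrite ?mul0r// !mul1r mulr1.
Qed.

Lemma fr_minimizer : is_minimizer W0 tau (tau fr) fr.
Proof.
split; [exact: bip_graphon_graphon|exact: lexx|] => f Gf tf.
apply: (le_trans rate_J_fr).
exact: (rate_J_ge p01 Gf tf off_entropy_lower).
Qed.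

Lemma L1dist_fr h : graphon h -> (rate_I W0 h < +oo)%E ->
  L1dist (clip h) (clip fr) <= off_dist h / r ^+ d.-1.
Proof.
move=> Gh hfin; have Gr := bip_graphon_graphon gam r01.
have Cr := graphon_clip Gr; have Ch := graphon_clip Gh.
have Cc := graphon_clip (graphon_cutoff gam Gh).
have rd0 : 0 < r ^+ d.-1 by rewrite exprn_gt0.
have bD : bmeas (fun z => `|clip h z ^+ d - r ^+ d|).
  apply: bmeas_norm; apply: bmeasB; last exact: bmeas_cst.
  by apply: bmeasX; exact: gg_bmeas.
have b1 : bmeas (fun z => `|clip h z - clip (cutoff gam h) z|).
  by apply: bmeas_norm; apply: bmeasB; exact: gg_bmeas.
have b2 := bmeas_offM gam bD.
have b3 : bmeas (fun z => (r ^+ d.-1)^-1 * (off gam z * `|clip h z ^+ d - r ^+ d|)).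
  by apply: bmeasM => //; exact: bmeas_cst.
have : L1dist (clip h) (clip fr) <= \int[nu2]_z (`|clip h z - clip (cutoff gam h) z| +
    (r ^+ d.-1)^-1 * (off gam z * `|clip h z ^+ d - r ^+ d|)).
  apply: (le_mean nu2).
  - by apply: bmeas_norm; apply: bmeasB; exact: gg_bmeas.
  - exact: bmeasD.
  move=> z; have [zI|zI] := boolP (z \in unit_sq); last first.
    rewrite !clip_out// !subr0 normr0 add0r mulr_ge0 ?invr_ge0 ?(ltW rd0)//.
    by rewrite mulr_ge0//; case/andP: (off_itv gam z).
  rewrite clip_cutoff (clipE fr zI) bip_graphonE.
  case: (off_case gam z) => ->; first by rewrite !(mul0r, mulr0, addr0).
  rewrite !mul1r mulr1 subrr normr0 add0r ler_pdivlMl//.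
  apply: expr_dist_ge => //; by case/andP: (gg_itv Ch z).
rewrite (meanD nu2 b1 b3) (meanZ nu2 _ b2).
rewrite -/(L1dist _ _) (finite_rate_cutoff p01 Gh hfin) add0r.
by rewrite mulrC.
Qed.

(** Graphons near g of nearly minimal rate are close to f_r in L1, by
    [stability]; hence g is at distance 0 from f_r. *)
Lemma unique_minimizer g : graphon g -> tau fr <= tau g ->
  (rate_J W0 g <= value%:E)%E -> weakly_equal g fr.
Proof.
move=> Gg tg Jg; have Gr := bip_graphon_graphon gam r01.
have rd0 : 0 < r ^+ d.-1 by rewrite exprn_gt0.
apply/eqP; rewrite eq_le delta_cut_ge0// andbT.
apply/ler_addgt0Pr => eps eps0; rewrite add0r.
pose eps' := eps / 4 * r ^+ d.-1.
have eps'0 : 0 < eps' by rewrite mulr_gt0// divr_gt0.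
have [A A1 [delta dlt0 dP]] := stability eps'0.
have A0 : 0 < A by rewrite (lt_le_trans ltr01).
have [eta eta0 etaP] := delta_tau_close e dlt0.
have slack0 : 0 < eps' / (2 * A) by rewrite divr_gt0// mulr_gt0.
have eta'0 : 0 < Num.min eta (eps / 2) by rewrite lt_min eta0 divr_gt0.
have [h [Gh gh Ih]] := near_minimizer Gg Jg eta'0 slack0.
have hfin : (rate_I W0 h < +oo)%E by apply: (lt_trans Ih); exact: ltry.
move: gh; rewrite le_min => /andP[gh gh'].
have th : tau fr - delta <= tau h by have := etaP g h Gg Gh gh; lra.
have hd := dP h Gh hfin th.
have hE : off_entropy gam p h - offmass * kl p r <= eps' / A.
  have := le_lt_trans (rate_I_ge gam p01 Gh) Ih.
  rewrite lte_fin -/(off_entropy gam p h) /value => hlt.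
  have -> : eps' / A = 2 * (eps' / (2 * A)) by field; rewrite gt_eqF.
  lra.
have hd2 : off_dist h <= 2 * eps'.
  have := ler_wpM2l (ltW A0) hE; rewrite mulrCA divff ?gt_eqF// mulr1; lra.
apply: (le_trans (delta_cutD_L1 Gg Gh Gr)).
have : L1dist (clip h) (clip fr) <= eps / 2.
  rewrite (le_trans (L1dist_fr Gh hfin))// ler_pdivrMr// (le_trans hd2)//.
  by rewrite /eps'; lra.
lra.
Qed.

Lemma fr_block : block_graphon gam fr.
Proof.
split; first exact: bip_graphon_graphon.
- exists 0 => -[x y] [/= ]; rewrite !in_itv/= => /andP[_ xg] /andP[_ yg].
  by rewrite /bip_graphon/= xg yg.
- exists 0 => -[x y] [/= ]; rewrite !in_itv/= => /andP[xg _] /andP[yg _].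
  by rewrite /bip_graphon/= !leNgt xg yg.
- exists r => -[x y] [] [/= ]; rewrite !in_itv/= => /andP[a b] /andP[c d'].
    by rewrite /bip_graphon/= b leNgt c.
  by rewrite /bip_graphon/= d' leNgt a.
Qed.

Lemma symmetric_case :
  symmetric_regime gam W0 tau (tau fr) /\ unique_solution W0 tau (tau fr) fr.
Proof.
have Gr := bip_graphon_graphon gam r01.
have min_eq g : is_minimizer W0 tau (tau fr) g -> weakly_equal g fr.
  move=> [Gg tg gmin]; apply: unique_minimizer => //.
  by apply: (le_trans (gmin fr Gr _)); [exact: lexx|exact: rate_J_fr].
split; first split.
- exact: (admissible_bip gam p01).
- move=> g mg; split; first by case: mg.
  by exists fr; [exact: fr_block|exact: min_eq].
split; [|exact: fr_minimizer|by move=> g _; exact: min_eq].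
by apply: tilde_Omega => //; exact: bip_vanishes.
Qed.

End symmetric_case.

(** * Row graphons and block graphons *)

Section complete_graphs.

Definition complete_rel n : rel 'I_n := fun i j => i != j.

Lemma complete_simple n : simple_graph (@complete_rel n).
Proof. by split=> [i j|i]; rewrite /complete_rel ?eqxx// eq_sym. Qed.

Lemma complete_regular n : regular_graph (@complete_rel n.+1) n.
Proof.
move=> i; rewrite (_ : [set j | _]%SET = [set~ i]%SET).
  by rewrite cardsC1 card_ord.
by apply/setP => j; rewrite !inE /complete_rel eq_sym.
Qed.

Lemma K2_bipartite : bipartite_graph (@complete_rel 2).
Proof.
exists (fun i => i == ord0) => i j; rewrite /complete_rel.
by case: i => -[|[|]]// ?; case: j => -[|[|]].
Qed.

(** As a consequence, triangle densities vanish on graphons that are supported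
    off the diagonal blocks. *)
Lemma K3_not_colourable : ncol (@complete_rel 3) = 0%N.
Proof.
apply/eqP; rewrite /ncol cards_eq0; apply/eqP/setP => c; rewrite !inE.
apply/negbTE/negP => /forallP pc.
have h i j : i != j -> c i != c j by move=> ij; have /forallP/(_ j)/implyP := pc i; apply.
have := h ord0 (inord 1); have := h ord0 (inord 2); have := h (inord 1) (inord 2).
have -> : (inord 1 : 'I_3) != inord 2 by rewrite -val_eqE /= !inordK.
have -> : (ord0 : 'I_3) != inord 2 by rewrite -val_eqE /= !inordK.
have -> : (ord0 : 'I_3) != inord 1 by rewrite -val_eqE /= !inordK.
move=> /(_ isT) + /(_ isT) + /(_ isT).
by case: (c ord0); case: (c (inord 1)); case: (c (inord 2)).
Qed.

End complete_graphs.

Section two_row_graphon.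
Context {R : realType} (gam p : R).
Hypotheses (gam01 : 0 < gam < 1) (p01 : 0 < p < 1).
Local Notation W0 := (bip_graphon gam p).
Local Notation nu := (@nu R).
Local Notation nu2 := (nu \x nu)%E.
Local Notation offmass := (off_mass gam).
Implicit Types (f : R -> R) (g h : R * R -> R).

(** Its values depend only on the coordinate lying in [0,gam]. *)
Definition row_graphon (f : R -> R) : R * R -> R :=
  fun z => off gam z * f (if z.1 <= gam then z.1 else z.2).

Lemma row_graphonE f x y : row_graphon f (x, y) =
  part gam true x * part gam false y * f x + part gam false x * part gam true y * f y.
Proof.
rewrite /row_graphon offE /part /=; case: (x <= gam); case: (y <= gam);
  by rewrite /= ?(mulr0, mul0r, mulr1, mul1r, addr0, add0r).
Qed.

Lemma row_global (f : R -> R) : measurable_fun setT f -> (forall x, 0 <= f x <= 1) ->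
  global_graphon (row_graphon f).
Proof.
move=> mf f01; split.
- rewrite (_ : row_graphon f = fun z => part gam true z.1 * part gam false z.2 * f z.1 +
      part gam false z.1 * part gam true z.2 * f z.2); last first.
    by apply/funext => -[x y]; exact: row_graphonE.
  have m k := bmeas_meas (bmeas_part gam k).
  by apply: measurable_funD; apply: measurable_funM; try apply: measurable_funM;
    apply: measurableT_comp.
- by move=> x y; rewrite !row_graphonE; ring.
- move=> [x y]; have /andP[w0 w1] := off_itv gam (x, y).
  have /andP[? ?] := f01 (if x <= gam then x else y).
  by rewrite /row_graphon mulr_ge0//= mulr_ile1.
Qed.

Lemma row_vanishes f : vanishes_on_diag gam (row_graphon f).
Proof. by move=> z z0; rewrite /row_graphon z0 mul0r. Qed.

Lemma hom_density_row v d (e : rel 'I_v) (f : R -> R) : simple_graph e -> (0 < d)%N ->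
  regular_graph e d -> measurable_fun setT f -> (forall x, 0 <= f x <= 1) ->
  hom_density e (row_graphon f) =
  (ncol e)%:R * ((1 - gam) * \int[nu]_y (part gam true y * f y ^+ d)) ^+ v./2.
Proof.
move=> se d0 re mf f01; have G := row_global mf f01.
rewrite (hom_density_global _ (fun=> 0) (gg_bmeas G)).
apply: (tau_row gam01 se d0 re (f := f)) => //.
- exact: gg_bmeas.
- exact: gg_sym.
- by move=> x y; rewrite off_diag => /eqP o0; rewrite /row_graphon o0 mul0r.
- exact: bmeas_itv f01.
- move=> x y gx yg; rewrite row_graphonE /part yg leNgt gx /=.
  by rewrite mul0r mul0r add0r !mul1r.
Qed.

(** The value is u1 on a proportion lam of [0,gam] and u2 on the rest of it. *)
Definition two_valued (lam u1 u2 : R) : R -> R :=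
  fun x => u2 + (u1 - u2) * part (lam * gam) true x.

Section values.
Variables (lam u1 u2 : R).
Hypotheses (lam01 : 0 < lam < 1) (u101 : 0 <= u1 <= 1) (u201 : 0 <= u2 <= 1).
Local Notation f := (two_valued lam u1 u2).

Lemma two_valued_case x : f x = u1 \/ f x = u2.
Proof.
rewrite /two_valued /part; case: eqP => _ /=; first by left; rewrite mulr1 addrC subrK.
by right; rewrite mulr0 addr0.
Qed.

Lemma two_valued_meas : measurable_fun setT f.
Proof.
apply: measurable_funD => //; apply: measurable_funM => //.
exact: bmeas_meas (bmeas_part _ _).
Qed.

Lemma two_valued_itv x : 0 <= f x <= 1.
Proof. by case: (two_valued_case x) => ->. Qed.

Lemma two_valued_moment d : \int[nu]_y (part gam true y * f y ^+ d) =
  gam * (lam * u1 ^+ d + (1 - lam) * u2 ^+ d).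
Proof.
have /andP[g0 g1] := gam01; have /andP[l0 l1] := lam01.
have lg : lam * gam <= gam by rewrite ler_piMl// ltW.
have lg01 : 0 < lam * gam < 1 by rewrite mulr_gt0//= (le_lt_trans lg).
transitivity (\int[nu]_y (u2 ^+ d * part gam true y +
    (u1 ^+ d - u2 ^+ d) * part (lam * gam) true y)).
  apply: eq_Rintegral => y _; rewrite /two_valued /part.
  have [ylg|ylg] := leP y (lam * gam).
    by rewrite (le_trans ylg lg)/= !mulr1 mul1r addrC subrK [RHS]addrC subrK.
  by rewrite /= !mulr0 !addr0 mulrC.
have b1 := bmeas_part gam true; have b2 := bmeas_part (lam * gam) true.
rewrite meanD; [|by apply: bmeasM => //; exact: bmeas_cst..].
by rewrite (meanZ nu _ b1) (meanZ nu _ b2) !mean_part_true//; ring.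
Qed.

End values.

(** An explicit extension of a block graphon to the whole plane. *)
Definition block3 (a c m : R) : R * R -> R := fun z =>
  a * (part gam true z.1 * part gam true z.2) +
  c * (part gam false z.1 * part gam false z.2) + m * off gam z.

Lemma block3_bmeas a c m : bmeas (block3 a c m).
Proof.
have b k l : bmeas (fun z : R * R => part gam k z.1 * part gam l z.2).
  apply: bmeasM; first exact: (bmeas_comp (bmeas_part gam k)).
  exact: (bmeas_comp (bmeas_part gam l)).
apply: bmeasD; last by apply: bmeasM; [exact: bmeas_cst|exact: bmeas_off].
by apply: bmeasD; apply: bmeasM => //; exact: bmeas_cst.
Qed.

Lemma block_graphon_block3 b : block_graphon gam b ->
  exists a c m, [/\ 0 <= a, 0 <= c, 0 <= m <= 1 & {in unit_sq, b =1 block3 a c m}].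
Proof.
have /andP[g0 g1] := gam01.
move=> [[_ _ b01] [a ba] [c bc] [m bm]].
have z0 : (0 : R) \in `[0, gam] by rewrite in_itv/= lexx ltW.
have o1 : (1 : R) \in `]gam, 1] by rewrite in_itv/= g1 lexx.
have inI x y : 0 <= x <= 1 -> 0 <= y <= 1 -> (x, y) \in (unit_sq : set (R * R)).
  by move=> x01 y01; rewrite /unit_sq in_setX/= !unit_itvE x01.
have i0 : 0 <= (0 : R) <= 1 by rewrite lexx ler01.
have i1 : 0 <= (1 : R) <= 1 by rewrite lexx ler01.
exists a, c, m; split.
- by rewrite -(ba (0, 0)) ?(andP (b01 _ (inI _ _ i0 i0))).1//; split.
- by rewrite -(bc (1, 1)) ?(andP (b01 _ (inI _ _ i1 i1))).1//; split.
- by rewrite -(bm (0, 1)) ?b01 ?inI//; left; split.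
move=> [x y]; rewrite /unit_sq in_setX/= !unit_itvE => /andP[/andP[x0 x1] /andP[y0 y1]].
rewrite /block3 offE /part /=.
have [xg|xg] := leP x gam; have [yg|yg] := leP y gam;
  rewrite /= ?(mulr0, mul0r, mulr1, addr0, add0r).
- by apply: ba; split; rewrite /= in_itv/= ?x0 ?y0.
- by apply: bm; left; split; rewrite /= in_itv/= ?x0 ?yg.
- by apply: bm; right; split; rewrite /= in_itv/= ?y0 ?xg.
- by apply: bc; split; rewrite /= in_itv/= ?xg ?yg.
Qed.

Lemma Es_part_prod n k z : Es (iota 0 n) (fun y => \prod_(i < n) part gam k (y i)) z =
  (\int[nu]_x part gam k x) ^+ n.
Proof.
have E y : \prod_(i < n) part gam k (y i) = \prod_(i <- enum 'I_n) part gam k (y i).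
  by rewrite big_enum.
rewrite (Es_ext _ E) -val_enum_ord (@Es_prod _ _ val)//; last first.
- by move=> i j _ _ ij y x; rewrite upd_neq// (inj_eq val_inj) eq_sym.
- by move=> i _; apply: smeas_coord; exact: bmeas_part.
- exact: enum_uniq.
rewrite big_enum/= (eq_bigr (fun=> \int[nu]_x part gam k x)); last first.
  by move=> i _; apply: eq_Rintegral => x _; rewrite upd_eq.
by rewrite prodr_const card_ord.
Qed.

(** Only the tuples with all their points in the part k are kept. *)
Lemma block3_density_ge n (e : rel 'I_n) k a c m : 0 <= a -> 0 <= c -> 0 <= m ->
  (if k then a else c) ^+ size (edges e) * (\int[nu]_x part gam k x) ^+ n <=
  hom_density e (block3 a c m).
Proof.
move=> a0 c0 m0; pose w := if k then a else c.
have w0 : 0 <= w by rewrite /w; case: (k).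
have bB := block3_bmeas a c m.
have B0 z : 0 <= block3 a c m z.
  rewrite /block3 !addr_ge0 ?mulr_ge0//; first last.
  - by case/andP: (off_itv gam z).
rewrite (hom_density_global _ (fun=> 0) bB) -/w -(Es_part_prod n k (fun=> 0)).
have sP : smeas (fun y : nat -> R => \prod_(i < n) part gam k (y i)).
  by apply: smeas_prod => i _; apply: smeas_coord; exact: bmeas_part.
rewrite -(Es_indepl (G := fun=> w ^+ size (edges e)))//.
apply: Es_le.
- by apply: smeasM => //; exact: smeas_cst.
- exact: smeas_edge_prod.
move=> y; rewrite edge_prodE.
have [/existsP[i yi]|good] := boolP [exists i : 'I_n, (y i <= gam) != k].
  rewrite (bigD1 i)//= {1}/part (negbTE yi) mul0r mulr0.
  by apply: prodr_ge0.
have {}good (i : 'I_n) : (y i <= gam) = k.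
  by apply/eqP; apply: contraNT good => yi; apply/existsP; exists i.
have -> : \prod_(i < n) part gam k (y i) = 1.
  by apply: big1 => i _; rewrite /part good eqxx.
rewrite mulr1 (eq_bigr (fun=> w)); last first.
  move=> [i j] _; rewrite /block3 offE /part !good /w.
  by case: (k) => /=; rewrite ?(mulr0, mul0r, mulr1, addr0, add0r).
by rewrite -big_filter -/(edges e) big_const_seq count_predT iter_mulr_1.
Qed.

End two_row_graphon.

(** * Off the convex minorant *)

Section nonsymmetric_case.
Context {R : realType} (gam p : R).
Hypotheses (gam01 : 0 < gam < 1) (p01 : 0 < p < 1).
Local Notation W0 := (bip_graphon gam p).
Local Notation nu := (@nu R).
Local Notation nu2 := (nu \x nu)%E.
Local Notation offmass := (off_mass gam).

Variables (v d : nat) (e : rel 'I_v).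
Hypotheses (v0 : (0 < v)%N) (se : simple_graph e) (d0 : (0 < d)%N)
  (re : regular_graph e d).
Local Notation tau := (hom_density e).

Lemma off_moment_row (f : R -> R) : measurable_fun setT f ->
  (forall x, 0 <= f x <= 1) ->
  off_moment gam d (row_graphon gam f) =
  2 * ((1 - gam) * \int[nu]_y (part gam true y * f y ^+ d)).
Proof.
move=> mf f01; have G := row_global gam mf f01; have Gh := global_graphon_graphon G.
have bC : bmeas (fun z => clip (row_graphon gam f) z ^+ d).
  by apply: bmeasX; exact: bmeas_clip.
have bX : bmeas (fun z => row_graphon gam f z ^+ d) by apply: bmeasX; exact: gg_bmeas.
have -> : off_moment gam d (row_graphon gam f) =
    offmean gam (fun z => row_graphon gam f z ^+ d).
  rewrite /off_moment /offmean; apply: nu2_ext; [exact: bmeas_offM..|].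
  by move=> z zI; rewrite clipE.
rewrite offmean_sym//; last by move=> x y; rewrite (gg_sym G).
congr (2 * _).
have bf : bmeas (fun y => part gam true y * f y ^+ d).
  by apply: bmeasM; [exact: bmeas_part|apply: bmeasX; exact: bmeas_itv f01].
rewrite -(meanZ nu _ bf); apply: eq_Rintegral => y _.
transitivity (\int[nu]_x (part gam true y * f y ^+ d * part gam false x)).
  rewrite -meanZ; last first.
    apply: bmeasM; first exact: bmeas_part.
    by apply: (bmeas_comp bX (phi := fun x => (x, y))).
  apply: eq_Rintegral => x _; rewrite row_graphonE /part.
  by case: (x <= gam); case: (y <= gam);
    rewrite /= ?(mulr0, mul0r, mulr1, mul1r, addr0, add0r).
by rewrite (meanZ nu _ (bmeas_part gam false)) mean_part_false// mulrC.
Qed.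

Variable r : R.
Hypotheses (pr1 : p <= r <= 1) (bip : p < r -> bipartite_graph e).
Hypothesis off_min : ~ on_convex_minorant (root_entropy p d) (r ^+ d) (kl p r).
Local Notation fr := (bip_graphon gam r).

(** The row graphon h built from the two contact points of [bitangent] is a
    minimizer outside the class of block graphons. *)
Lemma nonsymmetric_case : ~ symmetric_regime gam W0 tau (tau fr).
Proof.
have /andP[g0 g1] := gam01; have /andP[p0 p1] := p01.
have [s [u1 [u2 [/andP[pr r1] /andP[u10 u1r] /andP[ru2 u21] s0
  [a [line E1 E2 ahr]]]]]] := bitangent p01 d0 pr1 off_min.
have r0 : 0 < r by rewrite (lt_trans p0).
have r01 : 0 <= r <= 1 by rewrite !ltW.
have rin : 0 < r < 1 by rewrite r0.
have u101 : 0 <= u1 <= 1 by rewrite u10/=; lra.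
have u201 : 0 <= u2 <= 1 by rewrite u21 andbT; lra.
have N0 : (0 < ncol e)%N by apply: ncol_gt0; exact: bip.
have n0 := half_gt0 v0 se d0 re N0.
have NR : (ncol e)%:R != 0 :> R by rewrite pnatr_eq0 -lt0n.
have d1r : u1 ^+ d < r ^+ d by rewrite ltr_pXn.
have dr2 : r ^+ d < u2 ^+ d by rewrite ltr_pXn// ltW.
(* the weight for which the d-th moment of the two-valued function is r^d *)
pose lam := (u2 ^+ d - r ^+ d) / (u2 ^+ d - u1 ^+ d).
have d12 : 0 < u2 ^+ d - u1 ^+ d by lra.
have lam01 : 0 < lam < 1.
  by rewrite /lam divr_gt0 ?ltr_pdivrMr ?mul1r//=; lra.
have lamE : lam * u1 ^+ d + (1 - lam) * u2 ^+ d = r ^+ d.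
  by rewrite /lam; field; rewrite gt_eqF.
pose f := two_valued gam lam u1 u2; pose h := row_graphon gam f.
have mf : measurable_fun setT f by exact: two_valued_meas.
have f01 x : 0 <= f x <= 1 by exact: two_valued_itv.
have Gh : graphon h by apply: global_graphon_graphon; exact: row_global.
have h0 : vanishes_on_diag gam h by exact: row_vanishes.
have Gr := bip_graphon_graphon gam r01.
have tauh : tau h = tau fr.
  rewrite (hom_density_row gam01 se d0 re mf f01) (hom_density_bip gam01 se d0 re r01).
  by rewrite (two_valued_moment gam01 u1 u2 lam01) lamE.
have hmom : off_moment gam d h = offmass * r ^+ d.
  rewrite (off_moment_row mf f01) (two_valued_moment gam01 u1 u2 lam01) lamE.
  by rewrite /off_mass; ring.
have bXc (g : R * R -> R) : graphon g -> bmeas (fun z => clip g z ^+ d).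
  by move=> Gg; apply: bmeasX; exact: bmeas_clip.
have bline g : graphon g -> bmeas (fun z => a - s * r ^+ d + s * clip g z ^+ d).
  move=> Gg; apply: bmeasD; first exact: bmeas_cst.
  by apply: bmeasM; [exact: bmeas_cst|exact: bXc].
have mline g : graphon g -> offmean gam (fun z => a - s * r ^+ d + s * clip g z ^+ d) =
    offmass * a + s * (off_moment gam d g - offmass * r ^+ d).
  move=> Gg; have bX := bXc g Gg.
  rewrite offmeanD; [|exact: bmeas_cst|by apply: bmeasM; [exact: bmeas_cst|]].
  rewrite (offmeanZ gam s bX) (offmean_cst gam01) -/(off_moment gam d g); ring.
(* u1 and u2 are contact points: the entropy of h is given by the line *)
have hent : off_entropy gam p h = offmass * a.
  transitivity (offmean gam (fun z => a - s * r ^+ d + s * clip h z ^+ d)); last first.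
    by rewrite mline// hmom subrr mulr0 addr0.
  rewrite /off_entropy /offmean; apply: nu2_ext.
  - by apply: bmeas_offM; exact: bmeas_kl_clip.
  - by apply: bmeas_offM; exact: bline.
  move=> z zI; rewrite clipE// /h /row_graphon.
  case: (off_case gam z) => ->; first by rewrite !mul0r.
  rewrite !mul1r /f; case: (two_valued_case gam lam u1 u2 (if z.1 <= gam then z.1 else z.2)) => ->.
    by rewrite E1; ring.
  by rewrite E2; ring.
have hmin : is_minimizer W0 tau (tau fr) h.
  split; [exact: Gh|by rewrite tauh lexx|].
  move=> g Gg tg; apply: (le_trans (rate_J_le p01 Gh h0)); rewrite hent.
  apply: (rate_J_ge p01 Gg tg) => eps eps0.
  have s1 : 0 < s + 1 by rewrite ltr_wpDl.
  have es0 : 0 < eps / (s + 1) by rewrite divr_gt0.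
  have [delta dlt0 dP] := moment_lower gam01 p01 v0 se d0 re r01 N0 es0.
  exists delta => // h' Gh' hfin th'.
  have hm := dP h' Gh' hfin th'.
  have : offmass * a + s * (off_moment gam d h' - offmass * r ^+ d) <= off_entropy gam p h'.
    rewrite -mline//; apply: le_offmean; [exact: bline|exact: bmeas_kl_clip|].
    by move=> z; have := line _ (gg_itv (graphon_clip Gh') z); rewrite mulrBr; lra.
  have : s * (offmass * r ^+ d - off_moment gam d h') <= eps.
    have hm' : offmass * r ^+ d - off_moment gam d h' <= eps / (s + 1) by lra.
    apply: (le_trans (ler_wpM2l s0 hm')).
    by rewrite mulrCA ler_piMr ?(ltW eps0)// ler_pdivrMr// mul1r lerDl.
  by lra.
move=> [_ /(_ h hmin)[_ [b Bb hb]]].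
have Gb : graphon b by case: Bb.
have [a0 [c0 [m [a0p c0p m01 bE]]]] := block_graphon_block3 gam01 Bb.
have dens n (e' : rel 'I_n) : hom_density e' h = hom_density e' (block3 gam a0 c0 m).
  by rewrite (hom_density_weakly e' Gh Gb hb); exact: hom_density_ext.
(* triangles: a graphon with a nonzero diagonal block has some *)
have K3h : hom_density (@complete_rel 3) h = 0.
  rewrite (hom_density_row gam01 (complete_simple 3) _ (@complete_regular 2) mf f01)//.
  by rewrite K3_not_colourable mul0r.
have m0p : 0 <= m by case/andP: m01.
have mean_pos k : 0 < \int[nu]_x part gam k x.
  by case: k; rewrite ?(mean_part_true gam01) ?(mean_part_false gam01) ?subr_gt0.
have diag0 k : (if k then a0 else c0) = 0.
  have := block3_density_ge gam (@complete_rel 3) k a0p c0p m0p.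
  rewrite -dens K3h pmulr_lle0 ?exprn_gt0// => w0.
  have : (if k then a0 else c0) ^+ size (edges (@complete_rel 3)) = 0.
    by apply/eqP; rewrite eq_le w0 exprn_ge0//; case: (k).
  by move=> /eqP; rewrite expf_eq0 => /andP[_ /eqP].
have Bm : block3 gam a0 c0 m = bip_graphon gam m.
  apply/funext => z; rewrite bip_graphonE /block3.
  by rewrite (diag0 true : a0 = 0) (diag0 false : c0 = 0) !mul0r !add0r.
have g1' : 0 < 1 - gam by rewrite subr_gt0.
have cancel_mass (x y : R) : (1 - gam) * (gam * x) = (1 - gam) * (gam * y) -> x = y.
  by move=> /(mulfI (lt0r_neq0 g1'))/(mulfI (lt0r_neq0 g0)).
(* the density of H determines the remaining value *)
have mr : m = r.
  have := dens _ e; rewrite Bm tauh !(hom_density_bip gam01 se d0 re)// => /(mulfI NR) /eqP.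
  have pos x : 0 <= x -> 0 <= (1 - gam) * (gam * x).
    by move=> x0; rewrite !mulr_ge0// ltW.
  rewrite eqrXn2// ?pos ?exprn_ge0 ?(ltW r0)// => /eqP/cancel_mass/eqP.
  by rewrite eqrXn2 ?(ltW r0)// => /eqP.
(* edge density: the mean of h is r *)
have r_mean : r = lam * u1 + (1 - lam) * u2.
  have N2 : (ncol (@complete_rel 2))%:R != 0 :> R.
    by rewrite pnatr_eq0 -lt0n; apply: ncol_gt0; exact: K2_bipartite.
  have := dens _ (@complete_rel 2); rewrite Bm.
  rewrite (hom_density_row gam01 (complete_simple 2) _ (@complete_regular 1) mf f01)//.
  rewrite (hom_density_bip gam01 (complete_simple 2) _ (@complete_regular 1) m01)//.
  rewrite (two_valued_moment gam01 u1 u2 lam01).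
  by move=> /(mulfI N2); rewrite !expr1 => /cancel_mass ->.
have /andP[l0 l1] := lam01.
have l1' : 0 <= 1 - lam by rewrite subr_ge0 ltW.
(* convexity: the tangent at r would lie above the chord of the bitangent *)
have := ler_wpM2l (ltW l0) (kl_ge_tangent p01 rin u101).
have := ler_wpM2l l1' (kl_ge_tangent p01 rin u201).
rewrite E1 E2 => t2 t1.
have S : lam * (a + s * (u1 ^+ d - r ^+ d)) + (1 - lam) * (a + s * (u2 ^+ d - r ^+ d)) = a.
  transitivity (a + s * (lam * u1 ^+ d + (1 - lam) * u2 ^+ d - r ^+ d)); first by ring.
  by rewrite lamE subrr mulr0 addr0.
have T : lam * (kl p r + dkl p r * (u1 - r)) + (1 - lam) * (kl p r + dkl p r * (u2 - r)) =
    kl p r.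
  transitivity (kl p r + dkl p r * (lam * u1 + (1 - lam) * u2 - r)); first by ring.
  by rewrite -r_mean subrr mulr0 addr0.
lra.
Qed.

End nonsymmetric_case.

Theorem theorem1p24 (R : realType) (p : R) (hp : 0 < p < 1)
    (q : rat) (hq : 0 < q < 1)
    (v : nat) (hv : (0 < v)%N) (e : rel 'I_v) (he : simple_graph e)
    (d : nat) (hd : (1 <= d)%N) (hreg : regular_graph e d)
    (r : R) (hr : p <= r <= 1) (hbip : p < r -> bipartite_graph e) :
  let gam : R := ratr q in
  let W0 := bip_graphon gam p in
  let tau := hom_density e in
  let t := tau (bip_graphon gam r) in
  let phi := fun x : R => fine (rel_entropy p (x `^ (d%:R^-1))) in
  (on_convex_minorant phi (r ^+ d) (fine (rel_entropy p r)) ->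
     symmetric_regime gam W0 tau t /\
     unique_solution W0 tau t (bip_graphon gam r)) /\
  (~ on_convex_minorant phi (r ^+ d) (fine (rel_entropy p r)) ->
     admissible_value W0 tau t /\ ~ symmetric_regime gam W0 tau t).
Proof.
move=> gam W0 tau t phi.
have gam01 : 0 < gam < 1.
  move: hq => /andP[q0 q1]; rewrite /gam ltr0q q0/=.
  by rewrite -(rmorph1 (@ratr R)) ltr_rat.
have r01 : 0 <= r <= 1.
  by move: hp hr => /andP[p0 p1] /andP[pr r1]; rewrite r1 andbT (le_trans (ltW p0)).
have -> : phi = root_entropy p d.
  by apply/funext => x; rewrite /phi rel_entropyE.
have -> := congr1 fine (rel_entropyE r hp).
split=> [on_min|off_min].
  exact: (symmetric_case gam01 hp hv he hd hreg hr hbip on_min).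
split; first exact: (admissible_bip gam hp).
exact: (nonsymmetric_case gam01 hp hv he hd hreg hr hbip off_min).
Qed.
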